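(* Let $A$ and $B$ be finitely generated groups. Let $\mathcal{R}$ be a finitely generated symmetrized subset of the free product $A\ast B$ that satisfies the $C'(1/6)$ small cancellation condition, and let $G=(A\ast B)/\langle\!\langle\mathcal{R}\rangle\!\rangle$. Then $H(G)$ and $H(A)\cup H(B)$ are equivalent.
   Context: Here $\langle\!\langle\mathcal{R}\rangle\!\rangle$ is the normal subgroup generated by $\mathcal{R}$. Taut spectrum. Let $\Gamma$ be a connected simplicial graph. An edge loop of length $l$ is a sequence $v_0,\dots,v_l$ of vertices with $v_0=v_l$ and $\{v_{i-1},v_i\}$ an edge for $1\le i\le l$. For an integer $l$, $\Gamma_l$ is the $2$-complex with $1$-skeleton the geometric realization of $\Gamma$ and one $2$-cell attached along each edge loop of length strictly less than $l$. An edge loop of length $l$ is taut if it is not null-homotopic in $\Gamma_l$. The taut loop length spectrum is $H(\Gamma)=\{n\in\mathbb{N} : \text{there is a taut loop in }\Gamma\text{ of length }n\}$. For a group $G$ with finite generating set $S$, $H(G,S)$ is $H$ of the (simplicial) Cayley graph of $G$ with respect to $S$. Two subsets $H,H'\subseteq\mathbb{N}$ are $k$-related if for all $l\ge k^2+2k+2$: if $l\in H$ then there is $l'\in H'$ with $l/k\le l'\le lk$, and vice versa (with $H$ and $H'$ exchanged). They are equivalent if they are $k$-related for some $k>0$. $H(G)$ denotes $H(G,S)$ for any choice of finite generating set $S$; it is well defined up to equivalence. Small cancellation over free products (Lyndon–Schupp). Every nontrivial $w\in A\ast B$ has a unique normal form $w=y_1\cdots y_n$ with each $y_i$ a nontrivial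 element of $A$ or $B$ and consecutive letters in different factors; put $|w|=n$ (and $|1|=0$). A product $uv$, with $u=y_1\cdots y_n$ and $v=x_1\cdots x_m$ in normal form, is in semi-reduced form if $y_nx_1\neq 1$ (the letters $y_n,x_1$ may lie in the same factor), or if $u$ or $v$ is trivial. An element $w=y_1\cdots y_n$ is weakly cyclically reduced if $|w|\le 1$ or $y_ny_1\ne 1$. A subset $\mathcal{R}$ is symmetrized if all its elements are weakly cyclically reduced and, for every $r\in\mathcal{R}$, all weakly cyclically reduced conjugates of $r$ and $r^{-1}$ belong to $\mathcal{R}$. It is finitely generated as a symmetrized subset if it is the smallest symmetrized subset containing some finite set of elements. An element $b$ is a piece if there are distinct $r_1,r_2\in\mathcal{R}$ with $r_1=bc_1$ and $r_2=bc_2$ in semi-reduced form. $\mathcal{R}$ satisfies $C'(\lambda)$ if $\mathcal{R}$ is non-empty, $|r|>1/\lambda$ for all $r\in\mathcal{R}$, and whenever $r\in\mathcal{R}$ with $r=bc$ in semi-reduced form and $b$ a piece, then $|b|<\lambda|r|$. *)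

(* Defs.v *)
From HB Require Import structures.
From mathcomp Require Import all_boot all_order all_algebra.
From mathcomp Require Import generic_quotient boolp classical_sets Rstruct.

Set Implicit Arguments.
Unset Strict Implicit.
Unset Printing Implicit Defensive.

Import Order.TTheory GRing.Theory Num.Theory.

Notation real := Rdefinitions.R.

Local Open Scope classical_set_scope.
Local Open Scope group_scope.

Section Subgroups.
Variable G : groupType.
Implicit Types (H X : set G) (S : seq G).

Definition subgroup H : Prop :=
  H 1 /\ forall x y, H x -> H y -> H (x * y^-1).

Definition normal_subgroup H : Prop :=
  subgroup H /\ forall x g, H x -> H (x ^ g).

Definition generates S : Prop := smallest subgroup [set` S] = setT.

Definition normal_closure X : set G := smallest normal_subgroup X.

Lemma normal_closure_normal X : normal_subgroup (normal_closure X).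
Proof.
split; first split.
- by move=> H [[[]]].
- move=> x y hx hy H hH; have [[[_ hd] _] _] := hH.
  by apply: hd; [exact: hx | exact: hy].
- by move=> x g hx H hH; have [[_ hc] _] := hH; apply: hc; exact: hx.
Qed.

Lemma normal_closureM X x y :
  normal_closure X x -> normal_closure X y -> normal_closure X (x * y).
Proof.
have [[h1 hd] _] := normal_closure_normal X => hx hy.
by have := hd _ _ hx (hd _ _ h1 hy); rewrite mul1g invgK.
Qed.

Lemma normal_closureV X x : normal_closure X x -> normal_closure X x^-1.
Proof.
have [[h1 hd] _] := normal_closure_normal X => hx.
by have := hd _ _ h1 hx; rewrite mul1g.
Qed.

Definition ncl_eqv X : rel G := fun x y => `[< normal_closure X (x^-1 * y) >].

Lemma ncl_eqv_refl X : reflexive (ncl_eqv X).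
Proof. by move=> x; apply/asboolP; rewrite mulVg; case: (normal_closure_normal X) => [[]]. Qed.

Lemma ncl_eqv_sym X : symmetric (ncl_eqv X).
Proof.
suff h x y : ncl_eqv X x y -> ncl_eqv X y x by move=> x y; apply/idP/idP; exact: h.
by move=> /asboolP /normal_closureV; rewrite invgM invgK => ?; apply/asboolP.
Qed.

Lemma ncl_eqv_trans X : transitive (ncl_eqv X).
Proof.
move=> y x z /asboolP hxy /asboolP hyz; apply/asboolP.
by have := normal_closureM hxy hyz; rewrite mulgA mulgK.
Qed.

Canonical ncl_equiv X :=
  EquivRel (ncl_eqv X) (ncl_eqv_refl X) (@ncl_eqv_sym X) (@ncl_eqv_trans X).

End Subgroups.

Definition ncl_quotient (G : groupType) (X : set G) := {eq_quot (ncl_equiv X)}%qT.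

Section Quotient.
Variables (G : groupType) (X : set G).
Local Notation Q := (ncl_quotient X).
Local Open Scope quotient_scope.

HB.instance Definition _ := Choice.on Q.
HB.instance Definition _ := EqQuotient.on Q.

Definition ncl_one : Q := \pi_Q 1.
Definition ncl_mul (p q : Q) : Q := \pi_Q (repr p * repr q).
Definition ncl_inv (p : Q) : Q := \pi_Q (repr p)^-1.

Lemma ncl_piP (x y : G) : \pi_Q x = \pi_Q y <-> normal_closure X (x^-1 * y).
Proof.
have E : (\pi_Q x == \pi_Q y) = ncl_eqv X x y by exact: (@eqquotE _ _ Q).
by split=> [/eqP|h]; [rewrite E => /asboolP | apply/eqP; rewrite E; apply/asboolP].
Qed.

Lemma ncl_repr (x : G) : normal_closure X ((repr (\pi_Q x))^-1 * x).
Proof. by apply/ncl_piP; rewrite reprK. Qed.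

Lemma ncl_piM (x y : G) : ncl_mul (\pi_Q x) (\pi_Q y) = \pi_Q (x * y).
Proof.
apply/ncl_piP; rewrite invgM.
have := ncl_repr x; set x' := repr _ => hx; have := ncl_repr y; set y' := repr _ => hy.
have [_ hc] := normal_closure_normal X.
have := normal_closureM hy (hc _ y hx).
by rewrite /conjg !mulgA mulgK.
Qed.

Lemma ncl_piV (x : G) : ncl_inv (\pi_Q x) = \pi_Q x^-1.
Proof.
apply/ncl_piP; rewrite invgK.
have := ncl_repr x; set x' := repr _ => hx.
have [_ hc] := normal_closure_normal X.
have := hc _ x^-1 (normal_closureV hx).
by rewrite invgM !invgK /conjg invgK !mulgA mulgV mul1g.
Qed.

Lemma ncl_mulA : associative ncl_mul.
Proof. move=> p q r; rewrite -[p]reprK -[q]reprK -[r]reprK.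
by rewrite (ncl_piM (repr q)) (ncl_piM (repr p) (repr q)) !ncl_piM mulgA. Qed.
Lemma ncl_mul1 : left_id ncl_one ncl_mul.
Proof. by move=> p; rewrite -[p]reprK (ncl_piM 1) mul1g. Qed.
Lemma ncl_1mul : right_id ncl_one ncl_mul.
Proof. by move=> p; rewrite -[p]reprK (ncl_piM _ 1) mulg1. Qed.
Lemma ncl_mulV : left_inverse ncl_one ncl_inv ncl_mul.
Proof. by move=> p; rewrite -[p]reprK ncl_piV ncl_piM mulVg. Qed.
Lemma ncl_Vmul : right_inverse ncl_one ncl_inv ncl_mul.
Proof. by move=> p; rewrite -[p]reprK ncl_piV ncl_piM mulgV. Qed.

HB.instance Definition _ :=
  isGroup.Build Q ncl_mulA ncl_mul1 ncl_1mul ncl_mulV ncl_Vmul.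

Lemma ncl_pi_mul (x y : G) : \pi_Q (x * y) = \pi_Q x * \pi_Q y.
Proof. by rewrite -ncl_piM. Qed.

End Quotient.

Section FreeProductWords.
Variables A B : groupType.
Implicit Types (x y z : A + B) (u v w : seq (A + B)).

Definition trivial_letter x : bool :=
  match x with inl a => a == 1 | inr b => b == 1 end.

Definition same_factor x y : bool :=
  match x, y with inl _, inl _ | inr _, inr _ => true | _, _ => false end.

(* Only meaningful when [x] and [y] lie in the same factor. *)
Definition letter_mul x y : A + B :=
  match x, y with
  | inl a, inl b => inl (a * b)
  | inr a, inr b => inr (a * b)
  | _, _ => x
  end.

Definition letter_inv x : A + B :=
  match x with inl a => inl a^-1 | inr b => inr b^-1 end.

Definition normal_form w : bool :=
  all (fun x => ~~ trivial_letter x) w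
  && sorted (fun x y => ~~ same_factor x y) w.

(* Normal form of the product of the letter [x] and the normal form [w]. *)
Definition letter_act x w : seq (A + B) :=
  if trivial_letter x then w else
  if w is y :: w' then
    if same_factor x y then
      if trivial_letter (letter_mul x y) then w' else letter_mul x y :: w'
    else x :: w
  else [:: x].

Lemma normal_form_cons x w :
  normal_form (x :: w) =
    [&& ~~ trivial_letter x, (if w is y :: _ then ~~ same_factor x y else true)
      & normal_form w].
Proof.
case: w => [|y w]; rewrite /normal_form /= ?andbT //.
by case: trivial_letter => //=; case: same_factor => //=; rewrite andbF.
Qed.

Lemma letter_act_normal x w : normal_form w -> normal_form (letter_act x w).
Proof.
rewrite /letter_act; case: ifP => // tx; case: w => [|y w] hw.
  by rewrite normal_form_cons tx.
case: ifP => sxy; last by rewrite normal_form_cons tx sxy.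
move: hw; rewrite normal_form_cons => /and3P[ty hy hw].
case: ifP => // txy; rewrite normal_form_cons txy hw andbT /=.
by case: w hy {hw} => //= z w; case: x y z sxy {tx ty txy} => [?|?] [?|?] [?|?].
Qed.

Lemma letter_act_cons x w : normal_form (x :: w) -> letter_act x w = x :: w.
Proof.
rewrite normal_form_cons /letter_act => /and3P[/negbTE-> + _].
by case: w => // y w /negbTE->.
Qed.

Lemma letter_actM x y w : same_factor x y -> normal_form w ->
  letter_act x (letter_act y w) = letter_act (letter_mul x y) w.
Proof.
case: x y => [a|a] [b|b] // _; rewrite /letter_act /=.
- have [->|ha] := eqVneq a 1.
    by rewrite mul1g; case: eqVneq => // hb; case: w => [|[c|c] w] //=.
  have [->|hb] := eqVneq b 1; first by rewrite mulg1 (negbTE ha).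
  case: w => [|[c|c] w] hw /=; first 1 last.
  + move: hw; rewrite normal_form_cons /= => /and3P[hc hs hw].
    have [bc|bc] := eqVneq (b * c) 1.
      have [ab|ab] := eqVneq (a * b) 1.
        have -> : a = c by rewrite -[a]mulg1 -bc mulgA ab mul1g.
        by case: w hs {hw} => [|[]].
      rewrite -mulgA bc mulg1 (negbTE ha).
      by case: w hs {hw} => [|[]].
    rewrite mulgA; have [ab|ab] := eqVneq (a * b) 1; last by [].
    by rewrite ab mul1g /= (negbTE hc).
  + by have [ab|ab] := eqVneq (a * b) 1.
  + by have [ab|ab] := eqVneq (a * b) 1.
- have [->|ha] := eqVneq a 1.
    by rewrite mul1g; case: eqVneq => // hb; case: w => [|[c|c] w] //=.
  have [->|hb] := eqVneq b 1; first by rewrite mulg1 (negbTE ha).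
  case: w => [|[c|c] w] hw /=; last first.
  + move: hw; rewrite normal_form_cons /= => /and3P[hc hs hw].
    have [bc|bc] := eqVneq (b * c) 1.
      have [ab|ab] := eqVneq (a * b) 1.
        have -> : a = c by rewrite -[a]mulg1 -bc mulgA ab mul1g.
        by case: w hs {hw} => [|[]].
      rewrite -mulgA bc mulg1 (negbTE ha).
      by case: w hs {hw} => [|[]].
    rewrite mulgA; have [ab|ab] := eqVneq (a * b) 1; last by [].
    by rewrite ab mul1g /= (negbTE hc).
  + by have [ab|ab] := eqVneq (a * b) 1.
  + by have [ab|ab] := eqVneq (a * b) 1.
Qed.

Lemma foldr_act_normal u v : normal_form v -> normal_form (foldr letter_act v u).
Proof. by move=> hv; elim: u => //= x u; exact: letter_act_normal. Qed.

Lemma foldr_act_id u : normal_form u -> foldr letter_act [::] u = u.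
Proof.
elim: u => //= x u IHu hu; rewrite IHu ?letter_act_cons //.
by move: hu; rewrite normal_form_cons => /and3P[].
Qed.

Lemma foldr_letter_act x u v : normal_form u -> normal_form v ->
  foldr letter_act v (letter_act x u) = letter_act x (foldr letter_act v u).
Proof.
move=> hu hv; rewrite [letter_act x u]/letter_act; case: ifP => [tx|tx].
  by rewrite /letter_act tx.
case: u hu => [|y u] //= hu; case: ifP => sxy //.
have hu' : normal_form u by move: hu; rewrite normal_form_cons => /and3P[].
rewrite letter_actM ?foldr_act_normal //; case: ifP => // txy.
by rewrite /letter_act txy.
Qed.

Lemma foldr_actA u v w : normal_form u -> normal_form v -> normal_form w ->
  foldr letter_act (foldr letter_act w v) u = foldr letter_act w (foldr letter_act v u).
Proof.
move=> + hv hw; elim: u => //= x u IHu hu.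
rewrite foldr_letter_act ?foldr_act_normal // IHu //.
by move: hu; rewrite normal_form_cons => /and3P[].
Qed.

Lemma letter_invK : involutive letter_inv.
Proof. by case=> ? /=; rewrite invgK. Qed.

Lemma inv_normal u : normal_form u -> normal_form (rev (map letter_inv u)).
Proof.
rewrite /normal_form => /andP[ht hs]; rewrite all_rev all_map rev_sorted sorted_map.
apply/andP; split.
  by apply: sub_all ht; case=> ? /=; rewrite invg_eq1.
by apply: sub_sorted hs => -[?|?] [?|?].
Qed.

Lemma foldr_actV u : normal_form u ->
  foldr letter_act u (rev (map letter_inv u)) = [::].
Proof.
elim: u => //= x u IHu hu; rewrite rev_cons -cats1 foldr_cat /=.
have [nx hu'] : ~~ trivial_letter x /\ normal_form u.
  by move: hu; rewrite normal_form_cons => /and3P[].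
suff -> : letter_act (letter_inv x) (x :: u) = u by exact: IHu.
by case: x nx {hu} => a /= /negbTE ha; rewrite /letter_act /= invg_eq1 ha mulVg eqxx.
Qed.

End FreeProductWords.

(* The free product is realized as the set of normal forms. *)
Record free_product (A B : groupType) := FreeProduct {
  fp_word :> seq (A + B);
  fp_wordP : normal_form fp_word
}.

HB.instance Definition _ A B := [isSub for @fp_word A B].
HB.instance Definition _ A B := [Choice of free_product A B by <:].

Section FreeProductGroup.
Variables A B : groupType.
Local Notation F := (free_product A B).
Implicit Types u v w : F.

Definition fp_one : F := @FreeProduct A B [::] isT.
Definition fp_mul u v : F :=
  FreeProduct (foldr_act_normal (fp_word u) (fp_wordP v)).
Definition fp_inv u : F := FreeProduct (inv_normal (fp_wordP u)).

Lemma fp_mulA : associative fp_mul.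
Proof. by move=> u v w; apply: val_inj; rewrite /= foldr_actA ?fp_wordP. Qed.
Lemma fp_mul1 : left_id fp_one fp_mul.
Proof. by move=> u; apply: val_inj. Qed.
Lemma fp_1mul : right_id fp_one fp_mul.
Proof. by move=> u; apply: val_inj; rewrite /= foldr_act_id ?fp_wordP. Qed.
Lemma fp_mulV : left_inverse fp_one fp_inv fp_mul.
Proof. by move=> u; apply: val_inj; rewrite /= foldr_actV ?fp_wordP. Qed.
Lemma fp_Vmul : right_inverse fp_one fp_inv fp_mul.
Proof.
move=> u; apply: val_inj => /=.
have := foldr_actV (inv_normal (fp_wordP u)).
by rewrite map_rev revK (mapK (@letter_invK A B)).
Qed.

HB.instance Definition _ :=
  isGroup.Build F fp_mulA fp_mul1 fp_1mul fp_mulV fp_Vmul.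

Definition fp_letter (x : A + B) : F :=
  FreeProduct (letter_act_normal x (isT : normal_form [::])).

Lemma fp_word_prod u : u = \prod_(x <- fp_word u) fp_letter x.
Proof.
apply: val_inj => /=; elim: {u}(fp_word u) (fp_wordP u) => [|x w IHw] hw.
  by rewrite big_nil.
have hw' : normal_form w by move: hw; rewrite normal_form_cons => /and3P[].
rewrite big_cons /= -(IHw hw') foldr_letter_act //=.
by rewrite letter_act_cons.
Qed.

Lemma fp_letter_inlM (a b : A) :
  fp_letter (inl (a * b)) = fp_letter (inl a) * fp_letter (inl b).
Proof.
apply: val_inj => /=; rewrite foldr_letter_act //=.
  by rewrite letter_actM.
exact: letter_act_normal.
Qed.

Lemma fp_letter_inrM (a b : B) :
  fp_letter (inr (a * b)) = fp_letter (inr a) * fp_letter (inr b).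
Proof.
apply: val_inj => /=; rewrite foldr_letter_act //=.
  by rewrite letter_actM.
exact: letter_act_normal.
Qed.

End FreeProductGroup.

Section SmallCancellation.
Variables A B : groupType.
Local Notation F := (free_product A B).
Implicit Types (u v w r b c g : F) (rels : set F) (E : seq F).

Definition fp_length w : nat := size (fp_word w).

(* Vacuously true when [u] or [v] is trivial, as its word is then empty. *)
Definition semi_reduced u v : Prop :=
  forall s y x t, fp_word u = rcons s y -> fp_word v = x :: t ->
    fp_letter y * fp_letter x <> 1.

Definition weakly_cyclically_reduced w : Prop :=
  (fp_length w <= 1)%N \/
  (forall y1 s, fp_word w = y1 :: s ->
     fp_letter (last y1 s) * fp_letter y1 <> 1).

Definition symmetrized rels : Prop :=
  (forall r, rels r -> weakly_cyclically_reduced r) /\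
  (forall r, rels r -> forall g,
     (weakly_cyclically_reduced (r ^ g) -> rels (r ^ g)) /\
     (weakly_cyclically_reduced (r^-1 ^ g) -> rels (r^-1 ^ g))).

Definition fin_gen_symmetrized rels : Prop :=
  exists E, [/\ symmetrized rels, [set` E] `<=` rels
    & forall rels', symmetrized rels' -> [set` E] `<=` rels' -> rels `<=` rels'].

Definition piece rels b : Prop :=
  exists r1 r2 c1 c2,
    [/\ rels r1, rels r2, r1 <> r2,
        r1 = b * c1 /\ semi_reduced b c1
      & r2 = b * c2 /\ semi_reduced b c2].

Definition small_cancellation (lambda : real) rels : Prop :=
  [/\ rels !=set0,
      (forall r, rels r -> (lambda^-1 < (fp_length r)%:R)%R)
    & forall r b c, rels r -> r = b * c -> semi_reduced b c -> piece rels b ->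
        ((fp_length b)%:R < lambda * (fp_length r)%:R)%R].

End SmallCancellation.

Record simplicial_graph (V : eqType) := SimplicialGraph {
  adj :> rel V;
  adj_sym : symmetric adj;
  adj_irr : irreflexive adj
}.

Section TautLoops.
Variables (V : eqType) (Gam : simplicial_graph V).
Implicit Types (v : V) (p q : seq V).

(* The edge path v_0, ..., v_n is represented by v_0 and [:: v_1; ...; v_n]. *)
Definition edge_loop v p : bool := path Gam v p && (last v p == v).

(* For [cells] consisting of edge loops: homotopy relative to end points of edge
   paths (as vertex sequences) in the 2-complex with 1-skeleton [Gam] and one
   2-cell attached along each member of [cells], i.e. the equivalence relation
   generated by deleting a backtrack and by deleting the boundary of a 2-cell.
   Deleting a boundary read from another starting vertex, or backwards, is then
   a derived move. *)
Inductive edge_homotopic (cells : V -> seq V -> Prop) : seq V -> seq V -> Prop :=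
| eh_refl p : edge_homotopic cells p p
| eh_sym p q : edge_homotopic cells p q -> edge_homotopic cells q p
| eh_trans p q r : edge_homotopic cells p q -> edge_homotopic cells q r ->
    edge_homotopic cells p r
| eh_backtrack p q v w : Gam v w ->
    edge_homotopic cells (p ++ [:: v, w, v & q]) (p ++ v :: q)
| eh_cell p q v c : cells v c ->
    edge_homotopic cells (p ++ v :: c ++ q) (p ++ v :: q).

(* The 2-complex Gam_l has one 2-cell along each edge loop of length < l. *)
Definition short_cells (l : nat) v p : Prop := edge_loop v p /\ (size p < l)%N.

Definition null_homotopic (l : nat) v p : Prop :=
  edge_homotopic (short_cells l) (v :: p) [:: v].

Definition taut v p : Prop := edge_loop v p /\ ~ null_homotopic (size p) v p.

Definition taut_spectrum : set nat :=
  [set n | exists v p, size p = n /\ taut v p].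

End TautLoops.

Section Cayley.
Variables (G : groupType) (S : seq G).

Definition cayley_rel : rel G := fun g h =>
  (g != h) && ((g^-1 * h \in S) || (h^-1 * g \in S)).

Lemma cayley_sym : symmetric cayley_rel.
Proof. by move=> g h; rewrite /cayley_rel eq_sym orbC. Qed.

Lemma cayley_irr : irreflexive cayley_rel.
Proof. by move=> g; rewrite /cayley_rel eqxx. Qed.

Definition cayley_graph : simplicial_graph G :=
  SimplicialGraph cayley_sym cayley_irr.

Definition group_spectrum : set nat := taut_spectrum cayley_graph.

End Cayley.

Definition spectra_related (k : real) (H H' : set nat) : Prop :=
  forall l : nat, (k ^+ 2 + 2 * k + 2 <= l%:R)%R ->
    (H l -> exists2 l', H' l' & (l%:R / k <= l'%:R <= l%:R * k)%R) /\
    (H' l -> exists2 l', H l' & (l%:R / k <= l'%:R <= l%:R * k)%R).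

Definition spectra_equivalent (H H' : set nat) : Prop :=
  exists2 k : real, (0 < k)%R & spectra_related k H H'.

(* Main.v *)
Require Import Defs.
From HB Require Import structures.
From mathcomp Require Import all_boot all_order all_algebra zify.
From mathcomp Require Import generic_quotient boolp classical_sets Rstruct.

(** Say that a map [f] from [G] to a group [Q] kills relations of length [n] if
    every word of length at most [n] in the generators and their inverses that
    is trivial in [G] has trivial value under [f]. For [i] at least 2, there is
    no taut loop with length in the interval from [i] (excluded) to [j]
    (included) exactly when every [f] that kills relations of length [i] kills
    those of length [j]: a null-homotopy in the 2-complex with the shorter cells
    preserves the value of a path, and the group of words up to such homotopies
    gives the universal [f] ([no_taut_relations_extend],
    [relations_extend_no_taut]). In this form the spectrum is about maps out of
    the group, and gaps can be transferred.

    The quotient [G] of the free product is presented by finitely many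
    alternating cyclic words satisfying a small cancellation condition
    ([presentation_words]). Let [fA] and [fB] be maps from [A] and [B] to [Q],
    multiplicative on large balls, and killing these finitely many words. Then
    they also kill every word of the free product that is trivial in [G] and not
    too long ([lift_relation]). Indeed Dehn's algorithm solves the word problem
    for [G]: a trivial word is brought to the trivial one by replacing a subword
    by the shorter complementary part of a relator, so linearly many relators
    are used, all intermediate words stay in the balls where [fA] and [fB] are
    multiplicative, and each replacement preserves the value.

    Suppose that [A] and [B] both have a gap, and let [f] on [G] kill relations up
    to its lower end.  Writing the generators of [A] and [B] as words in those of
    [G] turns [f] into maps on [A] and [B] that kill short relations, hence long
    ones by the gaps; they extend to large balls multiplicatively, and
    [lift_relation] shows that [f] kills long relations of [G]
    ([relations_extend_quotient]).

    Conversely, suppose that [G] has a gap and let [f0] on [A] and [f1] on [B] kill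
    short relations.  Extend them to balls and form the maps sending [a] to the
    pair of [f0 a] and [a], and [b] to the pair of [f1 b] and [b].  The second
    coordinates are retained in the images of the relators, so these satisfy the
    small cancellation condition in the free product of [Q0 * A] and [Q1 * B];
    the factors therefore embed in the quotient [Q] by them.  The induced map from
    [G] to [Q] kills short relations by [lift_relation], hence long ones by the
    gap, and because the factors embed this says that [f0] and [f1] kill long
    relations ([relations_extend_factors]).

    The geometric input is that Dehn's algorithm is complete under the C'(1/6)
    condition ([dehn_trivial_step]).  It is proved without planar diagrams: only
    diagrams that are one cell thick occur, and a local confluence argument reduces
    everything to them.  To treat the letters of a free product and the relators
    uniformly, words are read as paths whose vertices carry labels in a group, so
    that lengths add up exactly under products. *)

Set Implicit Arguments.
Unset Strict Implicit.
Unset Printing Implicit Defensive.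

Import Order.TTheory GRing.Theory Num.Theory.
Local Open Scope group_scope.

(** * Words with an additive length and their reductions *)

(** The elements of length zero are invertible but need not be trivial: they play
    the role of labels at the vertices of a path.  The hypothesis [levi] compares
    two factorizations of one element, and [R] is the set of relators, closed under
    cyclic rotation and inversion. *)
Section DehnAlgorithm.
Variables (M : starMonoidType) (len : M -> nat).
Implicit Types (x y z w p q s t u a b T B : M).

Hypothesis lenM : forall x y, len (x * y) = (len x + len y)%N.
Hypothesis lenV : forall x, len x^-1 = len x.
Hypothesis unit_mulV : forall u, len u = 0 -> u * u^-1 = 1.
Hypothesis levi : forall x y z t, x * y = z * t -> (len x <= len z)%N ->
  exists s, z = x * s /\ y = s * t.
Hypothesis mulMI : forall x y z, x * y = x * z -> y = z.
Hypothesis cut : forall n x, (n <= len x)%N -> exists y z, x = y * z /\ len y = n.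

Variable R : M -> Prop.
Hypothesis R_rot : forall x y, R (x * y) -> R (y * x).
Hypothesis R_inv : forall x, R x -> R x^-1.
Hypothesis R_red : forall a x, R (a * a^-1 * x) -> len a = 0.
Hypothesis R_len : forall x, R x -> (6 < len x)%N.
Hypothesis R_piece : forall b x y, R (b * x) -> R (b * y) -> x <> y ->
  (6 * len b < len (b * x))%N.

Lemma len1 : len 1 = 0.
Proof. by have := lenM 1 1; rewrite mulg1; lia. Qed.

Lemma unit_Vmul u : len u = 0 -> u^-1 * u = 1.
Proof. by move=> h; have := @unit_mulV u^-1; rewrite invgK lenV; exact. Qed.

Lemma unitK u x : len u = 0 -> u^-1 * (u * x) = x.
Proof. by move=> h; rewrite mulgA unit_Vmul // mul1g. Qed.

Lemma unitVK u x : len u = 0 -> u * (u^-1 * x) = x.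
Proof. by move=> h; rewrite mulgA unit_mulV // mul1g. Qed.

Lemma mulIM x y z : y * x = z * x -> y = z.
Proof.
move=> h; apply: (can_inj (@invgK M)); apply: (@mulMI x^-1).
by rewrite -!invgM h.
Qed.

Lemma R_conj x y z : R (x * y) -> y * x = z -> R z.
Proof. by move=> /R_rot h <-. Qed.

(** The letter [a] is cancelled only against its formal inverse [a^-1]; in the
    other case [s] is more than half of a relator and [t] is the inverse of the
    rest. *)
Definition rule s t : Prop :=
  (exists2 a, len a = 1%N & s = a * a^-1 /\ t = 1) \/
  (R (s * t^-1) /\ (len t < len s)%N).

Definition step w w' : Prop :=
  exists x s t y, [/\ rule s t, w = x * s * y & w' = x * t * y].

Inductive reduces w : M -> Prop :=
| reduces_refl : reduces w w
| reduces_step w1 w2 : step w w1 -> reduces w1 w2 -> reduces w w2.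

Lemma reduces_trans w1 w2 w3 : reduces w1 w2 -> reduces w2 w3 -> reduces w1 w3.
Proof. by elim=> // w w' w'' hs _ IH /IH; exact: reduces_step. Qed.

Lemma step_reduces w w' : step w w' -> reduces w w'.
Proof. by move=> h; apply: reduces_step h _; exact: reduces_refl. Qed.

Lemma rule_len s t : rule s t -> (len t < len s)%N.
Proof. by case=> [[a ha [-> ->]]|[]] //; rewrite lenM lenV len1 ha. Qed.

Lemma rule_inv s t : rule s t -> rule s^-1 t^-1.
Proof.
case=> [[a ha [-> ->]]|[hR hl]].
  by left; exists a => //; rewrite invgM invgK invg1.
right; split; last by rewrite !lenV.
by rewrite invgK; have := R_inv hR; rewrite invgM invgK => /R_rot.
Qed.

Lemma step_len w w' : step w w' -> (len w' < len w)%N.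
Proof. by case=> x [s [t [y [/rule_len h -> ->]]]]; rewrite !lenM; lia. Qed.

Lemma reduces_len w w' : reduces w w' -> (len w' <= len w)%N.
Proof. by elim=> // {}w w1 w2 /step_len h _; lia. Qed.

Lemma reduces_cancel x a y : reduces (x * a * a^-1 * y) (x * y).
Proof.
have [n hn] := ubnP (len a); elim: n a hn => // n IHn a ha.
have [h|h] := posnP (len a).
  by rewrite -(mulgA x) unit_mulV // mulg1; exact: reduces_refl.
have [b [c [e hb]]] := @cut (len a).-1 a (leq_pred _).
have hc : len c = 1%N by move: h hb; rewrite e lenM; lia.
have /IHn hr : (len b < n)%N by lia.
apply: reduces_step hr; exists (x * b), (c * c^-1), 1, (b^-1 * y).
split; first by left; exists c.
  by rewrite e invgM !mulgA.
by rewrite mulg1 !mulgA.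
Qed.

(** * Ladders *)

(** A ladder is a diagram one cell thick, read from left to right, with [k] cells,
    top path [p] and bottom path [q].  The elements [sg] and the last argument are
    its left and right sides, read from the top to the bottom; a side equal to [1]
    means that top and bottom meet there.  In a gap they coincide. *)
Inductive ladder (C : M -> M -> M -> M -> Prop) (sg : M) : nat -> M -> M -> M -> Prop :=
| ladder_nil : ladder C sg 0 1 1 sg
| ladder_gap k p q g : ladder C sg k p q 1 -> ladder C sg k (p * g) (q * g) 1
| ladder_cell k p q tau T B tau' : ladder C sg k p q tau -> C tau T B tau' ->
    ladder C sg k.+1 (p * T) (q * B) tau'.

(** The word is the boundary of the cell read from the bottom left corner: up
    the left side, along the top, down the right side, and back along the bottom. *)
Definition cell sg T B tau : Prop := R (sg^-1 * T * tau * B^-1).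

Lemma cell_rev sg T B tau : cell sg T B tau -> cell tau T^-1 B^-1 sg.
Proof.
move=> /R_inv; rewrite /cell !invgM !invgK => h.
by apply: (R_conj h); rewrite !mulgA.
Qed.

Lemma cell_swap sg T B tau : cell sg T B tau -> cell sg^-1 B T tau^-1.
Proof.
move=> /R_inv; rewrite /cell !invgM !invgK !mulgA => h.
by apply: (R_conj h); rewrite !mulgA.
Qed.

Section LadderClosure.
Variable C : M -> M -> M -> M -> Prop.

Lemma ladder_cat s1 s2 s3 k k' p q p' q' :
  ladder C s1 k p q s2 -> ladder C s2 k' p' q' s3 ->
  ladder C s1 (k + k') (p * p') (q * q') s3.
Proof.
move=> h; elim=> [|{}k' {}p' {}q' g _ IH|{}k' {}p' {}q' tau T B tau' _ IH hC].
- by rewrite addn0 !mulg1.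
- by rewrite !mulgA; exact: ladder_gap.
- by rewrite !mulgA addnS; apply: ladder_cell hC.
Qed.

Lemma ladder_gap1 g : ladder C 1 0 g g 1.
Proof. by rewrite -[g]mul1g; apply: ladder_gap; exact: ladder_nil. Qed.

Lemma ladder_cell1 s1 s2 T B : C s1 T B s2 -> ladder C s1 1 T B s2.
Proof.
by move=> h; rewrite -[T]mul1g -[B]mul1g; apply: ladder_cell h; exact: ladder_nil.
Qed.

Lemma ladder_rev : (forall s1 T B s2, C s1 T B s2 -> C s2 T^-1 B^-1 s1) ->
  forall s1 k p q s2, ladder C s1 k p q s2 -> ladder C s2 k p^-1 q^-1 s1.
Proof.
move=> hC s1 k p q s2; elim=> [|{}k {}p {}q g _ IH|{}k {}p {}q tau T B tau' _ IH /hC h].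
- by rewrite invg1; exact: ladder_nil.
- by rewrite !invgM; apply: (ladder_cat (ladder_gap1 _) IH).
- by rewrite !invgM -add1n; apply: ladder_cat IH; exact: ladder_cell1.
Qed.

Lemma ladder_swap : (forall s1 T B s2, C s1 T B s2 -> C s1^-1 B T s2^-1) ->
  forall s1 k p q s2, ladder C s1 k p q s2 -> ladder C s1^-1 k q p s2^-1.
Proof.
move=> hC s1 k p q s2; elim=> [|{}k {}p {}q g _ IH|{}k {}p {}q tau T B tau' _ IH /hC h].
- exact: ladder_nil.
- by rewrite invg1 in IH *; exact: ladder_gap.
- exact: ladder_cell h.
Qed.

Lemma ladder_mono (C' : M -> M -> M -> M -> Prop) s1 k p q s2 :
  (forall s1 T B s2, C s1 T B s2 -> C' s1 T B s2) ->
  ladder C s1 k p q s2 -> ladder C' s1 k p q s2.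
Proof.
move=> hC; elim=> [|{}k {}p {}q g _ IH|{}k {}p {}q tau T B tau' _ IH /hC h].
- exact: ladder_nil.
- exact: ladder_gap.
- exact: ladder_cell h.
Qed.

Lemma ladder0 s1 p q s2 : ladder C s1 0 p q s2 -> [/\ p = q, s1 = s2 & s1 = 1 \/ p = 1].
Proof.
move e: 0 => k h; elim: h e => // [_|{}k {}p {}q g _ IH /IH[-> -> _]].
  by split=> //; right.
by split=> //; left.
Qed.

Lemma ladderS s1 k p q s2 : ladder C s1 k.+1 p q s2 ->
  exists P Pb t1 T B t2 Q Qb, [/\ ladder C s1 k P Pb t1, C t1 T B t2,
    ladder C t2 0 Q Qb s2, p = P * T * Q & q = Pb * B * Qb].
Proof.
move e: k.+1 => k' h; elim: h e => // [{}k' {}p {}q g _ IH /IH|].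
  move=> [P [Pb [t1 [T [B [t2 [Q [Qb [h1 h2 h3 -> ->]]]]]]]]].
  exists P, Pb, t1, T, B, t2, (Q * g), (Qb * g).
  by split=> //; [exact: ladder_gap | rewrite !mulgA | rewrite !mulgA].
move=> {}k' {}p {}q tau T B tau' h _ hC [->].
exists p, q, tau, T, B, tau', 1, 1.
by split=> //; [exact: ladder_nil | rewrite mulg1 | rewrite mulg1].
Qed.

(** Cutting a ladder below a given point of the top path: the point is either
    at a corner or in a gap, up to a vertex label [u], or strictly inside the top
    of some cell. *)
Lemma ladder_split s1 k p q s2 x y : ladder C s1 k p q s2 -> p = x * y ->
  (exists u k1 k2 qx qy t, [/\ len u = 0, k = (k1 + k2)%N, q = qx * qy,
     ladder C s1 k1 (x * u) qx t & ladder C t k2 (u^-1 * y) qy s2]) \/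
  (exists k1 k2 P Pb t1 T1 T2 B t2 Q Qb,
     [/\ ladder C s1 k1 P Pb t1, C t1 (T1 * T2) B t2, ladder C t2 k2 Q Qb s2,
       [/\ x = P * T1, y = T2 * Q, q = Pb * B * Qb & k = (k1 + k2).+1] &
       (0 < len T1)%N /\ (0 < len T2)%N]).
Proof.
move=> h; elim: h x y => [|{}k {}p {}q g hp IH|{}k {}p {}q tau T B tau' hp IH hC] x y e.
- left; exists x^-1, 0, 0, 1, 1, s1.
  have hx : len x = 0 by have := congr1 len e; rewrite lenM len1; lia.
  rewrite lenV invgK mulg1 unit_mulV // -e; split=> //; exact: ladder_nil.
- have [hl|hl] := leqP (len x) (len p).
    have [s [e1 e2]] := levi (esym e) hl.
    case: (IH x s e1) => [[u [k1 [k2 [qx [qy [t [h1 h2 h3 h4 h5]]]]]]]|].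
      left; exists u, k1, k2, qx, (qy * g), t; split=> //; first by rewrite h3 mulgA.
      by rewrite e2 mulgA; exact: ladder_gap.
    move=> [k1 [k2 [P [Pb [t1 [T1 [T2 [B [t2 [Q [Qb [h1 h2 h3 [h4 h5 h6 h7] h8]]]]]]]]]]]].
    right; exists k1, k2, P, Pb, t1, T1, T2, B, t2, (Q * g), (Qb * g).
    split=> //; first exact: ladder_gap.
    by split=> //; rewrite ?h6 ?e2 ?h5 ?mulgA.
  have [s [e1 e2]] := levi e (ltnW hl).
  left; exists 1, k, 0, (q * s), y, 1; split=> //; rewrite ?len1 ?addn0 //.
  + by rewrite e2 mulgA.
  + by rewrite mulg1 e1; exact: ladder_gap.
  + by rewrite invg1 mul1g; exact: ladder_gap1.
- have [hl|hl] := leqP (len x) (len p).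
    have [s [e1 e2]] := levi (esym e) hl.
    case: (IH x s e1) => [[u [k1 [k2 [qx [qy [t [h1 h2 h3 h4 h5]]]]]]]|].
      left; exists u, k1, k2.+1, qx, (qy * B), t; split=> //; first by rewrite h2 addnS.
      + by rewrite h3 mulgA.
      + by rewrite e2 mulgA; exact: ladder_cell hC.
    move=> [k1 [k2 [P [Pb [t1 [T1 [T2 [B' [t2 [Q [Qb [h1 h2 h3 [h4 h5 h6 h7] h8]]]]]]]]]]]].
    right; exists k1, k2.+1, P, Pb, t1, T1, T2, B', t2, (Q * T), (Qb * B).
    split=> //; first exact: ladder_cell hC.
    by split=> //; rewrite ?h6 ?e2 ?h5 ?h7 ?addnS ?mulgA.
  have [s [e1 e2]] := levi e (ltnW hl).
  have [hy|hy] := posnP (len y).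
    left; exists y, k.+1, 0, (q * B), 1, tau'; rewrite addn0 mulg1 unit_Vmul //.
    split=> //; last exact: ladder_nil.
    by rewrite -e; exact: ladder_cell hC.
  right; exists k, 0, p, q, tau, s, y, B, tau', 1, 1; rewrite !mulg1 addn0 -e2.
  split=> //; first exact: ladder_nil.
  by split=> //; move: hl; rewrite e1 lenM; lia.
Qed.

End LadderClosure.

Let cell_ladder_rev := ladder_rev cell_rev.
Let cell_ladder_swap := ladder_swap cell_swap.

(** The right side [a * b * c] of the last cell can be redistributed: the part
    [a] joins the top and the inverse of [c] joins the bottom. *)
Lemma ladder_close k p q s a b c : ladder cell 1 k p q s -> s <> 1 ->
  s = a * b * c -> ladder cell 1 k (p * a) (q * c^-1) b.
Proof.
move=> h; case: h => // {}k {}p {}q t T B {}s h hC _ e.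
rewrite -!mulgA; apply: (ladder_cell h); move: hC.
by rewrite /cell e invgM invgK !mulgA.
Qed.

(** The right side [a * b * c] of the last cell can be redistributed: the part
    [a] joins the top and the inverse of [c] joins the bottom. *)
Lemma ladder_close_top k p q s : ladder cell 1 k p q s -> ladder cell 1 k (p * s) q 1.
Proof.
move=> h; have [e|/eqP ne] := eqVneq s 1; first by rewrite e mulg1 -{2}e.
have := ladder_close (a := s) (b := 1) (c := 1) h ne.
by rewrite !mulg1 invg1 mulg1; exact.
Qed.

(** The right side [a * b * c] of the last cell can be redistributed: the part
    [a] joins the top and the inverse of [c] joins the bottom. *)
Lemma ladder_close_bottom k p q s :
  ladder cell 1 k p q s -> ladder cell 1 k p (q * s^-1) 1.
Proof.
move=> h; have [e|/eqP ne] := eqVneq s 1.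
  by rewrite e invg1 mulg1 -{2}e.
have := ladder_close (a := 1) (b := 1) (c := s) h ne.
by rewrite !mulg1 !mul1g; exact.
Qed.

Lemma ladder_open k p q s a b c : ladder cell s k p q 1 -> s <> 1 ->
  s = a * b * c -> ladder cell b k (a^-1 * p) (c * q) 1.
Proof.
move=> /cell_ladder_rev h ne e.
have /cell_ladder_rev := ladder_close h ne e.
by rewrite !invgM !invgK.
Qed.

Lemma ladder_open_top k p q s :
  ladder cell s k p q 1 -> ladder cell 1 k (s^-1 * p) q 1.
Proof.
by move=> /cell_ladder_rev/ladder_close_top/cell_ladder_rev; rewrite invgM !invgK.
Qed.

Lemma ladder_open_bottom k p q s :
  ladder cell s k p q 1 -> ladder cell 1 k p (s * q) 1.
Proof.
by move=> /cell_ladder_rev/ladder_close_bottom/cell_ladder_rev; rewrite invgM !invgK.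
Qed.

Lemma step_inv w w' : step w w' -> step w^-1 w'^-1.
Proof.
move=> [x [s [t [y [h -> ->]]]]]; exists y^-1, s^-1, t^-1, x^-1.
by split; rewrite ?invgM ?mulgA //; exact: rule_inv.
Qed.

Lemma reduces_inv w w' : reduces w w' -> reduces w^-1 w'^-1.
Proof.
elim=> [{}w|{}w w1 w2 /step_inv h _]; first exact: reduces_refl.
exact: reduces_step.
Qed.

(** * Ladders of minimal size *)

(** The length counts twice because [improves_arc] adds a cell, and this must be
    paid for by a top path shortened by at least one. *)
Definition improves k p q : Prop :=
  exists k' p' q', [/\ reduces p p', reduces q q', ladder cell 1 k' p' q' 1 &
    (2 * (len p' + len q') + k' < 2 * (len p + len q) + k)%N].

Lemma improves_rev k p q : improves k p^-1 q^-1 -> improves k p q.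
Proof.
move=> [k' [p' [q' [/reduces_inv h1 /reduces_inv h2 /cell_ladder_rev h3 h4]]]].
rewrite !invgK in h1 h2 h3; exists k', p'^-1, q'^-1.
by rewrite !lenV in h4 *.
Qed.

Lemma improves_swap k p q : improves k q p -> improves k p q.
Proof.
move=> [k' [p' [q' [h1 h2 /cell_ladder_swap h3 h4]]]].
rewrite !invg1 in h3; exists k', q', p'; split=> //; lia.
Qed.

(** A cell whose top is longer than the rest of its boundary is removed by one
    reduction, which makes the top path follow the rest. *)
Lemma improves_flip k1 k2 P Pb s T B t Q Qb :
  ladder cell 1 k1 P Pb s -> cell s T B t -> ladder cell t k2 Q Qb 1 ->
  (len s + len B + len t < len T)%N ->
  improves (k1 + k2).+1 (P * T * Q) (Pb * B * Qb).
Proof.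
move=> h1 hC h2 hl.
exists (k1 + k2)%N, (P * (s * B * t^-1) * Q), (Pb * B * Qb); split.
- apply: step_reduces; exists P, T, (s * B * t^-1), Q; split=> //.
  right; split; last by rewrite !lenM lenV.
  by move: hC; rewrite /cell -!mulgA => /R_rot; rewrite !invgM !invgK !mulgA.
- exact: reduces_refl.
- have h3 := ladder_close_top h1.
  have h4 := ladder_open_top h2.
  have := ladder_cat (ladder_gap B h3) h4.
  by rewrite !mulgA.
- by rewrite !lenM lenV; lia.
Qed.

(** A cell whose top is longer than the rest of its boundary is removed by one
    reduction, which makes the top path follow the rest. *)
Lemma improves_flip_bottom k1 k2 P Pb s T B t Q Qb :
  ladder cell 1 k1 P Pb s -> cell s T B t -> ladder cell t k2 Q Qb 1 ->
  (len s + len T + len t < len B)%N ->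
  improves (k1 + k2).+1 (P * T * Q) (Pb * B * Qb).
Proof.
move=> /cell_ladder_swap h1 /cell_swap hC /cell_ladder_swap h2 hl.
rewrite invg1 in h1 h2; apply: improves_swap.
by apply: improves_flip h1 hC h2 _; rewrite !lenV.
Qed.

(** If two neighbouring cells are mirror images across their common side, then
    gluing their outer sides together removes both, after free cancellations in
    the top and in the bottom.  The four cases compare the lengths of the parts
    that cancel: the outer sides may be glued along all of one of them, or only
    partially. *)
(** A common side occupying at least a sixth of one of its two cells is too long
    for a piece, so the two relators agree there: the cells are mirror images. *)
Lemma improves_mirror_le k1 k2 P Pb s T1 B1 T2 B2 t' Q Qb :
  ladder cell 1 k1 P Pb s -> ladder cell t' k2 Q Qb 1 ->
  B1^-1 * s^-1 * T1 = B2 * t'^-1 * T2^-1 -> (len T2 <= len T1)%N ->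
  improves (k1 + k2).+2 (P * T1 * T2 * Q) (Pb * B1 * B2 * Qb).
Proof.
move=> h1 h2 e hl.
have hl1 : (len (B1^-1 * s^-1) <= len (B2 * t'^-1))%N.
  by have := congr1 len e; rewrite !lenM !lenV; lia.
have [U [e1 eT1]] := levi e hl1.
have hp : reduces (P * T1 * T2 * Q) (P * U * Q).
  by have := reduces_cancel (P * U) T2^-1 Q; rewrite eT1 invgK !mulgA.
suff [q' hq hL] : exists2 q', reduces (Pb * B1 * B2 * Qb) q' &
    ladder cell 1 (k1 + k2) (P * U * Q) q' 1.
  exists (k1 + k2)%N, (P * U * Q), q'; split=> //.
  by have := reduces_len hq; have := reduces_len hp; lia.
have [hB|/ltnW hB] := leqP (len B2) (len B1).
  rewrite -mulgA in e1; have hB' : (len B2 <= len B1^-1)%N by rewrite lenV.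
  have [V [eB et]] := levi e1 hB'.
  have eB1 : B1 = V^-1 * B2^-1 by rewrite -[B1]invgK eB invgM.
  have et' : t' = U^-1 * s * V^-1 by rewrite -[t']invgK et !invgM !invgK.
  exists (Pb * V^-1 * Qb).
    by have := reduces_cancel (Pb * V^-1) B2^-1 Qb; rewrite eB1 invgK !mulgA.
  have [e1'|/eqP ne] := eqVneq t' 1; last first.
    have := ladder_cat h1 (ladder_open h2 ne et').
    by rewrite invgK !mulgA.
  have hl0 : len t' = 0 by rewrite e1' len1.
  have [hU hV] : len U = 0 /\ len V = 0 by move: hl0; rewrite et' !lenM !lenV; lia.
  have es : s = U * V.
    by apply: (@mulMI U^-1); apply: (@mulIM V^-1); rewrite -et' e1' unitK ?unit_mulV.
  have := ladder_cat (ladder_gap V^-1 (ladder_close_top h1)) (ladder_open_top h2).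
  by rewrite e1' invg1 mul1g es -!mulgA unitVK.
have hB' : (len B1^-1 <= len B2)%N by rewrite lenV.
rewrite -mulgA in e1; have [V [eB2 ev]] := levi (esym e1) hB'.
exists (Pb * V * Qb).
  by have := reduces_cancel Pb B1 (V * Qb); rewrite eB2 !mulgA.
have [hV|hV] := leqP (len s^-1) (len V).
  have [W [eV eU]] := levi ev hV.
  have := ladder_cat (ladder_gap W (ladder_close_bottom h1)) (ladder_open_top h2).
  by rewrite eU eV !mulgA.
have [W [es et]] := levi (esym ev) (ltnW hV).
have es' : s = 1 * W^-1 * V^-1 by rewrite -[s]invgK es invgM mul1g.
have et' : t' = U^-1 * W^-1 * 1 by rewrite -[t']invgK et invgM mulg1.
have hW : (0 < len W)%N by move: hV; rewrite es lenM; lia.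
have ne1 : s <> 1 by move=> h; move: hV; rewrite h invg1 len1.
have ne2 : t' <> 1 by move=> h; have := congr1 len et'; rewrite h !lenM !lenV len1; lia.
have := ladder_cat (ladder_close h1 ne1 es') (ladder_open h2 ne2 et').
by rewrite !invgK mulg1 mul1g !mulgA.
Qed.

(** A common side occupying at least a sixth of one of its two cells is too long
    for a piece, so the two relators agree there: the cells are mirror images. *)
Lemma improves_mirror k1 k2 P Pb s T1 B1 t T2 B2 t' Q Qb :
  ladder cell 1 k1 P Pb s -> cell s T1 B1 t -> cell t T2 B2 t' ->
  ladder cell t' k2 Q Qb 1 ->
  (len t + len B1 + len s + len T1 <= 6 * len t)%N \/
  (len t + len B2 + len t' + len T2 <= 6 * len t)%N ->
  improves (k1 + k2).+2 (P * T1 * T2 * Q) (Pb * B1 * B2 * Qb).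
Proof.
move=> h1 hC1 hC2 h2 hbig.
have R1 : R (t * (B1^-1 * s^-1 * T1)).
  by apply: (R_conj (x := s^-1 * T1) (y := t * B1^-1)); rewrite ?mulgA.
have R2 : R (t * (B2 * t'^-1 * T2^-1)).
  apply: (R_conj (x := B2 * t'^-1 * T2^-1) (y := t)); rewrite ?mulgA //.
  by have := R_inv hC2; rewrite !invgM !invgK !mulgA.
have e : B1^-1 * s^-1 * T1 = B2 * t'^-1 * T2^-1.
  have [->//|/eqP ne] := eqVneq (B1^-1 * s^-1 * T1) (B2 * t'^-1 * T2^-1).
  have := R_piece R1 R2 ne; have := R_piece R2 R1 (fun e => ne (esym e)).
  by rewrite !lenM !lenV; lia.
have [hl|/ltnW hl] := leqP (len T2) (len T1).
  exact: improves_mirror_le h1 h2 e hl.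
apply: improves_rev; rewrite !invgM !mulgA addnC.
move: h1 h2 => /cell_ladder_rev h1 /cell_ladder_rev h2.
by apply: (improves_mirror_le h2 h1); rewrite ?lenV ?invgK.
Qed.

(** The word is the boundary of the cell read from the bottom left corner: up
    the left side, along the top, down the right side, and back along the bottom. *)
Definition cell_len s T B t : nat := (len s + len T + len B + len t)%N.

(** In a good cell the top and the bottom both exceed a sixth of the boundary,
    see [good_cell_gt]: the sides take up less than a third and neither horizontal
    path more than half. *)
Definition good s T B t : Prop :=
  [/\ (2 * len T <= cell_len s T B t)%N, (2 * len B <= cell_len s T B t)%N,
      (6 * len s < cell_len s T B t)%N & (6 * len t < cell_len s T B t)%N].

(** In a good cell the top and the bottom both exceed a sixth of the boundary,
    see [good_cell_gt]: the sides take up less than a third and neither horizontal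
    path more than half. *)
Definition good_cell s T B t : Prop := cell s T B t /\ good s T B t.

Lemma cell_len_gt s T B t : cell s T B t -> (6 < cell_len s T B t)%N.
Proof. by move=> /R_len; rewrite !lenM !lenV /cell_len; lia. Qed.

Lemma good_cell_gt s T B t : good_cell s T B t ->
  (cell_len s T B t < 6 * len T)%N /\ (cell_len s T B t < 6 * len B)%N.
Proof. by move=> [/cell_len_gt h []]; rewrite /cell_len in h *; lia. Qed.

Lemma good_cell_rev s T B t : good_cell s T B t -> good_cell t T^-1 B^-1 s.
Proof.
by move=> [/cell_rev h1 h2]; split=> //; move: h2; rewrite /good /cell_len !lenV => -[*]; split; lia.
Qed.

Lemma ladder_good_cell s k p q t : ladder good_cell s k p q t -> ladder cell s k p q t.
Proof. by apply: ladder_mono => ? ? ? ? []. Qed.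

(** All ladders with the given paths and number of cells are considered, not
    one fixed ladder, because the arguments below recut ladders, moving letters
    between the top, the sides and the gaps. *)
Definition all_good k p q : Prop := forall k1 k2 P Pb s T B t Q Qb,
  ladder cell 1 k1 P Pb s -> cell s T B t -> ladder cell t k2 Q Qb 1 ->
  k = (k1 + k2).+1 -> p = P * T * Q -> q = Pb * B * Qb -> good s T B t.

Lemma all_good_rev k p q : all_good k p q -> all_good k p^-1 q^-1.
Proof.
move=> hg k1 k2 P Pb s T B t Q Qb /cell_ladder_rev h1 /cell_rev hC /cell_ladder_rev h2.
move=> ek /(congr1 (@monoid.inv M)) + /(congr1 (@monoid.inv M)); rewrite !invgK !invgM !mulgA => ep eq.
suff : good t T^-1 B^-1 s.
  by rewrite /good /cell_len !lenV; case; split; lia.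
by apply: (hg k2 k1 _ _ _ _ _ _ _ _ h2 hC h1) => //; rewrite ek addnC.
Qed.

Lemma all_good_swap k p q : all_good k p q -> all_good k q p.
Proof.
move=> hg k1 k2 P Pb s T B t Q Qb /cell_ladder_swap h1 /cell_swap hC /cell_ladder_swap h2.
rewrite !invg1 in h1 h2; move=> ek ep eq.
suff : good s^-1 B T t^-1.
  by rewrite /good /cell_len !lenV; case; split; lia.
exact: (hg k1 k2 _ _ _ _ _ _ _ _ h1 hC h2).
Qed.

Lemma all_good_left k1 k2 P Pb s Q Qb :
  ladder cell 1 k1 P Pb s -> ladder cell s k2 Q Qb 1 ->
  all_good (k1 + k2) (P * Q) (Pb * Qb) -> ladder good_cell 1 k1 P Pb s.
Proof.
move=> h; elim: h k2 Q Qb => [|k p q g h IH|k p q tau T B tau' h IH hC] k2 Q Qb h2 hg.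
- exact: ladder_nil.
- apply: ladder_gap; apply: (IH k2 (g * Q) (g * Qb)); last by rewrite !mulgA.
  exact: (ladder_cat (ladder_gap1 _ g) h2).
- apply: ladder_cell; last first.
    by split; [exact: hC | apply: (hg k k2 _ _ _ _ _ _ _ _ h hC h2)].
  apply: (IH k2.+1 (T * Q) (B * Qb)); last by rewrite !mulgA -addSnnS.
  by rewrite -add1n; apply: ladder_cat h2; exact: ladder_cell1.
Qed.

Lemma all_good_right k1 k2 P Pb s Q Qb :
  ladder cell 1 k1 P Pb s -> ladder cell s k2 Q Qb 1 ->
  all_good (k1 + k2) (P * Q) (Pb * Qb) -> ladder good_cell s k2 Q Qb 1.
Proof.
move=> /cell_ladder_rev h1 /cell_ladder_rev h2 /all_good_rev; rewrite !invgM addnC => hg.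
have := ladder_rev good_cell_rev (all_good_left h2 h1 hg).
by rewrite !invgK.
Qed.

Lemma ladder_last s k p q : ladder cell 1 k p q s -> s <> 1 ->
  exists k' p' q' t T B, [/\ k = k'.+1, p = p' * T, q = q' * B,
    ladder cell 1 k' p' q' t & cell t T B s].
Proof.
by case=> // {}k {}p {}q t T B {}s h hC _; exists k, p, q, t, T, B.
Qed.

Lemma ladder_first s k p q : ladder cell s k p q 1 -> s <> 1 ->
  exists k' T B t p' q', [/\ k = k'.+1, p = T * p', q = B * q', cell s T B t &
    ladder cell t k' p' q' 1].
Proof.
move=> /cell_ladder_rev/ladder_last h /h[k' [p' [q' [t [T [B [-> ep eq h' hC]]]]]]].
exists k', T^-1, B^-1, t, p'^-1, q'^-1; split=> //.
- by rewrite -[p]invgK ep invgM.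
- by rewrite -[q]invgK eq invgM.
- exact: cell_rev.
- exact: cell_ladder_rev.
Qed.

Lemma improves_or_good k p q : ~ improves k p q -> all_good k p q.
Proof.
move=> hn k1 k2 P Pb s T B t Q Qb h1 hC h2 ek ep eq.
have hl := cell_len_gt hC; rewrite /good /cell_len in hl *.
split; rewrite leqNgt; apply/negP => hlt; apply: hn; rewrite ep eq ek.
- by apply: improves_flip h1 hC h2 _; lia.
- by apply: improves_flip_bottom h1 hC h2 _; lia.
- have ne : s <> 1 by move=> e; move: hl hlt; rewrite e len1; lia.
  have [k' [p' [q' [t' [T' [B' [-> -> -> h1' hC']]]]]]] := ladder_last h1 ne.
  by rewrite addSn; apply: (improves_mirror h1' hC' hC h2); right; lia.
- have ne : t <> 1 by move=> e; move: hl hlt; rewrite e len1; lia.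
  have [k' [T' [B' [t' [p' [q' [-> -> -> hC' h3]]]]]]] := ladder_first h2 ne.
  by rewrite addnS !mulgA; apply: (improves_mirror h1 hC hC' h3); left; lia.
Qed.

(** Deleting the last letter [a] of the top path: a last cell gives [a] up to
    its right side, whereas in a gap the bottom path ends with [a] as well. *)
Lemma ladder_last_letter k x a q s : ladder good_cell 1 k (x * a) q s -> len a = 1%N ->
  ladder cell 1 k x q (a * s) \/
  (s = 1 /\ exists2 q1, q = q1 * a & ladder cell 1 k x q1 1).
Proof.
move e: (x * a) => p h.
elim: h x a e => [|{}k {}p {}q g h IH|{}k {}p {}q tau T B tau' h IH hC] x a e ha.
- by have := congr1 len e; rewrite lenM len1; lia.
- have [hg|hg] := posnP (len g); last first.
    right; split=> //.
    have hl : (len p <= len x)%N by have := congr1 len e; rewrite !lenM; lia.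
    have [d [-> ->]] := levi (esym e) hl.
    exists (q * d); first by rewrite mulgA.
    exact: ladder_gap (ladder_good_cell h).
  case: (IH x (a * g^-1)).
  + by rewrite mulgA e -mulgA unit_mulV // mulg1.
  + by rewrite lenM lenV; lia.
  + move=> h1; left.
    have ne : a * g^-1 * 1 <> 1 by move/(congr1 len); rewrite !lenM len1; lia.
    have := ladder_close (a := 1) (b := a * 1) (c := g^-1) h1 ne.
    by rewrite !mulg1 mul1g invgK; exact.
  + move=> [_ [q1 -> h1]]; right; split=> //; exists q1 => //.
    by rewrite -!mulgA unit_Vmul // mulg1.
- left; have [hT _] := good_cell_gt hC.
  have hl : (len p <= len x)%N by have := congr1 len e; rewrite !lenM; lia.
  have [d [-> eT]] := levi (esym e) hl.
  apply: ladder_cell (ladder_good_cell h) _.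
  by case: hC => + _; rewrite eT /cell !mulgA.
Qed.

Lemma ladder_first_letter k a y q s : ladder good_cell s k (a * y) q 1 -> len a = 1%N ->
  ladder cell (a^-1 * s) k y q 1 \/
  (s = 1 /\ exists2 q1, q = a * q1 & ladder cell 1 k y q1 1).
Proof.
move=> /(ladder_rev good_cell_rev); rewrite invgM => h ha.
have ha' : len a^-1 = 1%N by rewrite lenV.
case: (ladder_last_letter h ha') => [h1|[-> [q1 eq h1]]].
  by left; have := cell_ladder_rev h1; rewrite !invgK.
right; split=> //; exists q1^-1; first by rewrite -[q]invgK eq invgM invgK.
by have := cell_ladder_rev h1; rewrite !invgK.
Qed.

(** A backtrack of the top path straddling the point of division: the letter
    becomes part of the common side, or disappears from a gap, in which case the
    bottom path may backtrack too. *)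
Lemma absorb_backtrack k1 k2 x a y qx qy s :
  ladder good_cell 1 k1 (x * a) qx s -> ladder good_cell s k2 (a^-1 * y) qy 1 ->
  len a = 1%N ->
  exists2 q', reduces (qx * qy) q' & ladder cell 1 (k1 + k2) (x * y) q' 1.
Proof.
move=> h1 h2 ha; have ha' : len a^-1 = 1%N by rewrite lenV.
case: (ladder_last_letter h1 ha) => [g1|[es [q1 e1 g1]]];
  case: (ladder_first_letter h2 ha') => [g2|[es' [q2 e2 g2]]].
- exists (qx * qy); first exact: reduces_refl.
  by rewrite invgK in g2; exact: ladder_cat g1 g2.
- exists (qx * qy); first exact: reduces_refl.
  rewrite es' mulg1 in g1; have := ladder_cat (ladder_close_bottom g1) g2.
  by rewrite e2 !mulgA.
- exists (qx * qy); first exact: reduces_refl.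
  rewrite es mulg1 invgK in g2; have := ladder_cat g1 (ladder_open_bottom g2).
  by rewrite e1 !mulgA.
- exists (q1 * q2); last exact: ladder_cat g1 g2.
  by rewrite e1 e2 !mulgA; exact: reduces_cancel.
Qed.

(** The backtrack cannot lie within the top of one cell, as relators are
    reduced, so [absorb_backtrack] applies at its middle. *)
Lemma improves_backtrack k x a y q : len a = 1%N ->
  ladder cell 1 k (x * (a * a^-1) * y) q 1 -> all_good k (x * (a * a^-1) * y) q ->
  improves k (x * (a * a^-1) * y) q.
Proof.
move=> ha h hg.
suff [q' hq hL] : exists2 q', reduces q q' & ladder cell 1 k (x * y) q' 1.
  exists k, (x * y), q'; split=> //.
    by have := reduces_cancel x a y; rewrite !mulgA.
  by have := reduces_len hq; rewrite !lenM lenV; lia.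
have gap0 : ladder cell 1 0 1 1 1 by exact: ladder_nil.
have hG : ladder good_cell 1 k (x * (a * a^-1) * y) q 1.
  by apply: (all_good_left h gap0); rewrite addn0 !mulg1.
have e : x * (a * a^-1) * y = (x * a) * (a^-1 * y) by rewrite !mulgA.
case: (ladder_split hG e) => [[u [k1 [k2 [qx [qy [t [hu -> -> h1 h2]]]]]]]|].
  have h1' : ladder good_cell 1 k1 (x * (a * u)) qx t by rewrite mulgA.
  have h2' : ladder good_cell t k2 ((a * u)^-1 * y) qy 1 by rewrite invgM -mulgA.
  by apply: (absorb_backtrack h1' h2'); rewrite lenM; lia.
move=> [k1 [k2 [P [Pb [t1 [T1 [T2 [B [t2 [Q [Qb [h1 hC h2 [ex ey eq ek] [l1 l2]]]]]]]]]]]]].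
have hx : (len P <= len x)%N by have := congr1 len ex; rewrite !lenM; lia.
have [d [_ eT1]] := levi (esym ex) hx.
have hy : (len a^-1 <= len T2)%N by rewrite lenV; lia.
have [d' [eT2 _]] := levi ey hy.
have [hcell _] := hC; rewrite eT1 eT2 /cell in hcell.
have /R_red : R (a * a^-1 * (d' * t2 * B^-1 * t1^-1 * d)).
  apply: (R_conj (x := t1^-1 * d) (y := a * a^-1 * d' * t2 * B^-1)).
    by move: hcell; rewrite !mulgA.
  by rewrite !mulgA.
by rewrite ha.
Qed.

Definition no_backtrack q : Prop := forall x a y, len a = 1%N -> q <> x * (a * a^-1) * y.

(** An arc [s1 * w * s2] of the top path, completed to a relator by [t], shares
    [w] with the top of a cell, and from [w] on both relators read the same way:
    gluing the relator of the arc onto the ladder would fold it onto that cell. *)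
Definition runs_along_cell k p q x s1 w s2 t y : Prop :=
  exists k1 k2 P Pb sg T1 T2 B tau Q Qb,
  [/\ ladder cell 1 k1 P Pb sg, cell sg (T1 * w * T2) B tau,
    ladder cell tau k2 Q Qb 1,
    [/\ k = (k1 + k2).+1, p = P * (T1 * w * T2) * Q & q = Pb * B * Qb] &
    [/\ P * T1 = x * s1, T2 * Q = s2 * y &
      T2 * tau * B^-1 * sg^-1 * T1 = s2 * t^-1 * s1]].

Definition never_along_cell n : Prop := forall k p q x s1 w s2 t y,
  (len s1 + len s2 < n)%N -> all_good k p q -> no_backtrack q ->
  (len t < len (s1 * w * s2))%N -> ~ runs_along_cell k p q x s1 w s2 t y.

(** The common part [w] is prolonged to the right by the next letter [c] of the
    arc.  If [c] does not lie in the top of the cell, then the cell ends there.  A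
    right side of positive length would begin with [c], and so would the top of
    the next cell, whose relator would not be reduced.  Otherwise the bottom of the
    cell, read backwards, begins with [c], and the cell can be recut with [c] in
    its top, unless the bottom path backtracks there. *)
Lemma never_along_cell_step n : never_along_cell n ->
  forall k p q x s1 w s2 t y, (0 < len s2)%N ->
  (len s1 + len s2 < n.+1)%N -> all_good k p q -> no_backtrack q ->
  (len t < len (s1 * w * s2))%N -> ~ runs_along_cell k p q x s1 w s2 t y.
Proof.
move=> IH k p q x s1 w s2 t y hs2 hn hg hq ht.
move=> [k1 [k2 [P [Pb [sg [T1 [T2 [B [tau [Q [Qb [h1 hC h2 [ek ep eq] [eP eQ eR]]]]]]]]]]]]].
have hgood := hg _ _ _ _ _ _ _ _ _ _ h1 hC h2 ek ep eq.
have [c [s2' [es2 hc]]] := cut hs2.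
have hn' : (len s1 + len s2' < n)%N by move: hn; rewrite es2 lenM hc; lia.
have ht' : (len t < len (s1 * (w * c) * s2'))%N.
  by move: ht; rewrite es2 !lenM; lia.
(* When the cell extends beyond [w] along the top, [c] is read from [T2]. *)
have [hT2|hT2] := posnP (len T2); last first.
  have hl : (len c <= len T2)%N by rewrite hc.
  have eQ' : c * (s2' * y) = T2 * Q by rewrite eQ es2 ?mulgA.
  have [T2' [eT2 eQ2]] := levi eQ' hl.
  apply: (IH k p q x s1 (w * c) s2' t y) => //.
  exists k1, k2, P, Pb, sg, T1, T2', B, tau, Q, Qb.
  have -> : T1 * (w * c) * T2' = T1 * w * T2 by rewrite eT2 ?mulgA.
  split=> //; split=> //.
  by apply: (@mulMI c); move: eR; rewrite eT2 es2 ?mulgA.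
pose e := T2^-1 * c.
have he : len e = 1%N by rewrite lenM lenV hT2 hc.
have eR' : e * (s2' * t^-1 * s1) = tau * (B^-1 * sg^-1 * T1).
  apply: (@mulMI T2); rewrite /e ?mulgA unit_mulV // mul1g.
  by move: eR; rewrite es2 ?mulgA.
have eQ' : Q = e * (s2' * y).
  by apply: (@mulMI T2); rewrite eQ es2 /e ?mulgA unit_mulV // mul1g.
have hL := ladder_cell h1 hC.
(* The label [T2] moves to the next letter, which becomes [e]. *)
have [htau|htau] := posnP (len tau); last first.
  have ne : tau <> 1 by move=> e1; move: htau; rewrite e1 len1.
  have [k' [T [B' [t' [p' [q' [ek' eQ2 eQb hC' h3]]]]]]] := ladder_first h2 ne.
  have /cell_len_gt hl := hC'.
  have [_ g2 g3 g4] : good tau T B' t'.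
    apply: (hg _ _ _ _ _ _ _ _ _ _ hL hC' h3).
    - by rewrite ek ek'; lia.
    - by rewrite ep eQ2 ?mulgA.
    - by rewrite eq eQb ?mulgA.
  have hT : (len e <= len T)%N by rewrite he; move: g2 g3 g4; rewrite /cell_len; lia.
  have htau' : (len e <= len tau)%N by rewrite he.
  rewrite eQ' in eQ2; have [T' [eT _]] := levi eQ2 hT.
  have [tau' [etau _]] := levi eR' htau'.
  have hR := hC'; rewrite /cell eT etau invgM in hR.
  have /R_red : R (e^-1 * e^-1^-1 * (T' * t' * B'^-1 * tau'^-1)).
    rewrite invgK; apply: (R_conj (x := tau'^-1) (y := e^-1 * e * T' * t' * B'^-1)).
      by move: hR; rewrite ?mulgA.
    by rewrite ?mulgA.
  by rewrite lenV he.
(* The side [tau] is a mere label; recut the cell with [c] in its top. *)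
pose c1 := tau^-1 * e.
have hc1 : len c1 = 1%N by rewrite lenM lenV htau he.
have eB : c1 * (s2' * t^-1 * s1) = B^-1 * (sg^-1 * T1).
  by rewrite -mulgA eR' unitK // ?mulgA.
have /cell_len_gt hl := hC.
have hB : (len c1 <= len B^-1)%N.
  by rewrite hc1 lenV; move: hgood => -[]; rewrite /cell_len in hl *; lia.
have [B1 [eB1 eR1]] := levi eB hB.
have eB2 : B = B1^-1 * c1^-1 by rewrite -[B]invgK eB1 invgM.
have hL' := ladder_close_top hL; have hR' := ladder_open_top h2.
have hRg : ladder good_cell 1 k2 (c1 * (s2' * y)) Qb 1.
  have -> : c1 * (s2' * y) = tau^-1 * Q by rewrite eQ' /c1 ?mulgA.
  apply: (all_good_right hL' hR').
  have -> : P * (T1 * w * T2) * tau * (tau^-1 * Q) = p.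
    by rewrite ep -[_ * tau * _]mulgA unitVK.
  by rewrite -eq addSn -ek.
case: (ladder_first_letter hRg hc1) => [h3|[_ [q1 eq1 _]]]; last first.
  have hc1' : len c1^-1 = 1%N by rewrite lenV.
  apply: (hq (Pb * B1^-1) c1^-1 q1 hc1').
  by rewrite eq eB2 eq1 invgK ?mulgA.
rewrite mulg1 in h3.
apply: (IH k p q x s1 (w * c) s2' t y) => //.
exists k1, k2, P, Pb, sg, T1, 1, B1^-1, 1, (s2' * y), (c1^-1 * Qb).
split=> //.
- move: hC; rewrite /cell eB1 invgK /c1 /e !mulg1 => hR.
  suff <- : sg^-1 * (T1 * w * T2) * tau * (tau^-1 * (T2^-1 * c) * B1) =
            sg^-1 * (T1 * (w * c)) * B1 by [].
  rewrite -?mulgA; do 3 congr (_ * _).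
  by rewrite unitVK // unitVK.
- exact: ladder_open_bottom.
- split=> //.
  + by rewrite ep -?mulgA eQ es2 mul1g ?mulgA.
  + by rewrite eq eB2 ?mulgA.
- by rewrite !mul1g invgK -mulgA eR1.
Qed.

(** Prolonging [w] in both directions, [w] becomes the whole arc, which is more
    than half of its relator; but the top of a good cell is at most half of it. *)
Lemma never_along_cellP n : never_along_cell n.
Proof.
elim: n => // n IH k p q x s1 w s2 t y hn hg hq ht.
have [hs2|hs2] := posnP (len s2); last exact: (never_along_cell_step IH hs2 hn hg hq ht).
have [hs1|hs1] := posnP (len s1).
  move=> [k1 [k2 [P [Pb [sg [T1 [T2 [B [tau [Q [Qb [h1 hC h2 [ek ep eq] [eP eQ eR]]]]]]]]]]]]].
  have [+ _ _ _] := hg _ _ _ _ _ _ _ _ _ _ h1 hC h2 ek ep eq.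
  by have := congr1 len eR; move: ht; rewrite /cell_len !lenM !lenV; lia.
move=> [k1 [k2 [P [Pb [sg [T1 [T2 [B [tau [Q [Qb [h1 hC h2 [ek ep eq] [eP eQ eR]]]]]]]]]]]]].
have hs1' : (0 < len s1^-1)%N by rewrite lenV.
apply: (never_along_cell_step IH hs1' _ (all_good_rev hg) (x := y^-1)
  (s1 := s2^-1) (w := w^-1) (t := t^-1) (y := x^-1)).
- by rewrite !lenV; lia.
- move=> a b c hb e; apply: (hq c^-1 b a^-1) => //.
  by rewrite -[q]invgK e !invgM invgK ?mulgA.
- by move: ht; rewrite !lenM !lenV; lia.
exists k2, k1, Q^-1, Qb^-1, tau, T2^-1, T1^-1, B^-1, sg, P^-1, Pb^-1.
split; first exact: cell_ladder_rev.
- by have := cell_rev hC; rewrite !invgM ?mulgA.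
- exact: cell_ladder_rev.
- by split; [lia | rewrite ep !invgM ?mulgA | rewrite eq !invgM ?mulgA].
split; [by rewrite -!invgM eQ | by rewrite -!invgM eP |].
by have := congr1 (@monoid.inv M) eR; rewrite !invgM !invgK ?mulgA.
Qed.

(** In this section [s] is an arc of the top path that is more than half of a
    relator.  The aim is to apply the rule replacing [s] by [t] to the top path and
    to keep a ladder, by inserting the relator of [s] as a new cell. *)
Section ArcInLadder.
Variables (k : nat) (p q x s t y : M).
Hypotheses (hg : all_good k p q) (hq : no_backtrack q).
Hypotheses (hR : R (s * t^-1)) (ht : (len t < len s)%N).

(** By [never_along_cellP] the relators of the arc and of the cell differ, so
    their overlap is a piece of both. *)
Lemma overlap_short k1 k2 P Pb sg T1 w T2 B tau Q Qb s1 s2 :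
  ladder cell 1 k1 P Pb sg -> cell sg (T1 * w * T2) B tau ->
  ladder cell tau k2 Q Qb 1 ->
  k = (k1 + k2).+1 -> p = P * (T1 * w * T2) * Q -> q = Pb * B * Qb ->
  s = s1 * w * s2 -> P * T1 = x * s1 -> T2 * Q = s2 * y ->
  (6 * len w < len s + len t)%N /\ (6 * len w < cell_len sg (T1 * w * T2) B tau)%N.
Proof.
move=> h1 hC h2 ek ep eq es e1 e2.
(* Both relators are rotated so that they begin with the overlap. *)
have R1 : R (w * (T2 * tau * B^-1 * sg^-1 * T1)).
  apply: (R_conj (x := sg^-1 * T1) (y := w * T2 * tau * B^-1)).
    by move: hC; rewrite /cell ?mulgA.
  by rewrite ?mulgA.
have R2 : R (w * (s2 * t^-1 * s1)).
  apply: (R_conj (x := s1) (y := w * s2 * t^-1)); last by rewrite ?mulgA.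
  by move: hR; rewrite es ?mulgA.
have ne : T2 * tau * B^-1 * sg^-1 * T1 <> s2 * t^-1 * s1.
  move=> e; have ht' : (len t < len (s1 * w * s2))%N by rewrite -es.
  apply: (never_along_cellP (ltnSn _) hg hq ht' (x := x) (y := y)).
  by exists k1, k2, P, Pb, sg, T1, T2, B, tau, Q, Qb.
have := R_piece R2 R1 (fun e => ne (esym e)); have := R_piece R1 R2 ne.
by rewrite /cell_len es !lenM !lenV; lia.
Qed.

Lemma no_cell_inside k1 k2 P Pb sg T B tau Q Qb s1 s2 :
  ladder cell 1 k1 P Pb sg -> cell sg T B tau -> ladder cell tau k2 Q Qb 1 ->
  k = (k1 + k2).+1 -> p = P * T * Q -> q = Pb * B * Qb ->
  s = s1 * T * s2 -> P = x * s1 -> Q = s2 * y -> False.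
Proof.
move=> h1 hC h2 ek ep eq es e1 e2.
have := @overlap_short k1 k2 P Pb sg 1 T 1 B tau Q Qb s1 s2 h1.
rewrite !mul1g !mulg1 => /(_ hC h2 ek ep eq es e1 e2)[_ hl].
have [] := good_cell_gt (conj hC (hg h1 hC h2 ek ep eq)); lia.
Qed.

(** To the right of a point where the arc meets a corner or a gap, the arc can
    only run through a gap and then through a part [o] of the next cell, because
    whole cells do not fit.  If the ladder does not pinch at the point, there is no
    gap, and the remainder [s'] is an overlap with one cell. *)
Lemma arc_right_end k1 k2 X qx rho s0 s' qy :
  ladder cell 1 k1 X qx rho -> ladder cell rho k2 (s' * y) qy 1 ->
  k = (k1 + k2)%N -> p = X * (s' * y) -> q = qx * qy -> X = x * s0 -> s = s0 * s' ->
  (rho = 1 /\ exists g o q2, [/\ s' = g * o, qy = g * q2 & ladder cell o^-1 k2 y q2 1]) \/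
  (6 * len s' < len s + len t)%N.
Proof.
move=> h1 h2 ek ep eq eX es.
case: (ladder_split h2 erefl) => [[u [ka [kb [qa [qb [tau [hu eka eqy h3 h4]]]]]]]|].
  case: ka => [|ka] in eka h3.
    have [eqa etau] := ladder0 h3; case=> [erho|eu]; last first.
      by right; have := congr1 len eu; rewrite lenM len1; have := R_len hR; lia.
    left; split=> //; exists s', 1, (u * qb); split.
    - by rewrite mulg1.
    - by rewrite eqy -eqa mulgA.
    - rewrite invg1 eka; rewrite -etau erho in h4.
      by have := ladder_cat (ladder_gap1 _ u) h4; rewrite unitVK.
  have [P [Pb [t1 [T [B [t2 [Q [Qb [g1 gC g2 eP ePb]]]]]]]]] := ladderS h3.
  exfalso; apply: (no_cell_inside (ladder_cat h1 g1) gC (ladder_cat g2 h4)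
    (s1 := s0 * P) (s2 := Q * u^-1)).
  - by rewrite ek eka; lia.
  - rewrite ep -{1}[s']mulg1 -(unit_mulV hu) (mulgA s') eP ?mulgA.
    by rewrite -?mulgA.
  - by rewrite eq eqy ePb ?mulgA.
  - rewrite es -{1}[s']mulg1 -(unit_mulV hu) (mulgA s') eP ?mulgA.
    by rewrite -?mulgA.
  - by rewrite eX mulgA.
  - by rewrite mulgA.
move=> [ka [kb [P [Pb [t1 [T1 [T2 [B [t2 [Q [Qb [g1 gC g2 [es' ey eqy ek2] [l1 l2]]]]]]]]]]]]].
case: ka => [|ka] in ek2 g1; last first.
  have [P' [Pb' [t1' [T' [B' [t2' [Q' [Qb' [g1' gC' g2' eP ePb]]]]]]]]] := ladderS g1.
  exfalso; apply: (no_cell_inside (ladder_cat h1 g1') gC'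
    (ladder_cat g2' (ladder_cat (ladder_cell1 gC) g2)) (s1 := s0 * P') (s2 := Q' * T1)).
  - by rewrite ek ek2; lia.
  - by rewrite ep es' eP ey ?mulgA.
  - by rewrite eq eqy ePb ?mulgA.
  - by rewrite es es' eP ?mulgA.
  - by rewrite eX mulgA.
  - by rewrite ey ?mulgA.
have [ePb et1 hP] := ladder0 g1.
have [hl _] : (6 * len T1 < len s + len t)%N /\
              (6 * len T1 < cell_len t1 (1 * T1 * T2) B t2)%N.
  apply: (overlap_short (ladder_cat h1 g1) _ g2 (s1 := s0 * P) (s2 := 1)).
  - by rewrite mul1g.
  - by rewrite ek ek2; lia.
  - by rewrite ep es' ey mul1g ?mulgA.
  - by rewrite eq eqy ?mulgA.
  - by rewrite es es' mulg1 mulgA.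
  - by rewrite mulg1 eX mulgA.
  - by rewrite mul1g ey.
case: hP => [erho|eP]; last by right; rewrite es' eP mul1g.
left; split=> //; exists P, T1, (B * Qb); split=> //.
  by rewrite eqy ePb ?mulgA.
rewrite ek2 add0n -add1n ey; apply: ladder_cat g2; apply: ladder_cell1.
by move: gC; rewrite /cell -et1 erho invg1 mul1g invgK.
Qed.

(** The arc is more than half of its relator, and each overlap with a cell is
    less than a sixth of the sum of [len s] and [len t]; hence it cannot be covered
    by two overlaps.  So it meets a gap, at which the new cell has a bottom of its
    own, with the overlaps as its sides. *)
Lemma improves_arc : ladder cell 1 k p q 1 -> p = x * s * y -> improves k p q.
Proof.
move=> h ep; have ep' : p = x * (s * y) by rewrite mulgA.
suff [p' hp hL] : exists2 p', p' = x * t * y & ladder cell 1 k.+1 p' q 1.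
  exists k.+1, p', q; split=> //; last by rewrite hp ep !lenM; lia.
    rewrite hp ep; apply: step_reduces; exists x, s, t, y; split=> //.
    by right.
  exact: reduces_refl.
case: (ladder_split h ep') => [[u [k1 [k2 [qx [qy [rho [hu ek eq h1 h2]]]]]]]|].
  have h2' : ladder cell rho k2 ((u^-1 * s) * y) qy 1 by rewrite -mulgA.
  case: (arc_right_end h1 h2' ek _ eq erefl).
  - by rewrite ep' -?mulgA unitVK.
  - by rewrite unitVK.
  - move=> [erho [g [o [q2 [es' eqy h3]]]]]; exists (x * t * y) => //.
    have es : s = u * g * o by rewrite -mulgA -es' unitVK.
    rewrite erho in h1.
    have hC : cell 1 (u^-1 * t) g o^-1.
      have := R_inv hR; rewrite /cell es !invgM !invgK invg1 mul1g => hR'.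
      apply: (R_conj (x := t * o^-1 * g^-1) (y := u^-1)); last by rewrite ?mulgA.
      by move: hR'; rewrite ?mulgA.
    have := ladder_cat (ladder_cell h1 hC) h3.
    by rewrite ek eq eqy ?mulgA -(mulgA x u) unit_mulV // mulg1 addSn.
  - by rewrite lenM lenV; lia.
move=> [k1 [k2 [P [Pb [t1 [T1 [T2 [B [t2 [Q [Qb [h1 hC h2 [ex ey eq ek] [l1 l2]]]]]]]]]]]]].
have [hl|/ltnW hl] := leqP (len s) (len T2).
  have [d [eT2 ed]] := levi ey hl.
  have [] : (6 * len s < len s + len t)%N /\
            (6 * len s < cell_len t1 (T1 * s * d) B t2)%N; last by lia.
  have eT : T1 * s * d = T1 * T2 by rewrite eT2 mulgA.
  apply: (overlap_short h1 _ h2 ek _ eq (s1 := 1) (s2 := 1)).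
  - by rewrite eT.
  - by rewrite eT ep' ey ex ?mulgA.
  - by rewrite mul1g mulg1.
  - by rewrite mulg1.
  - by rewrite mul1g.
have [s' [es eQ]] := levi (esym ey) hl.
have [hb _] : (6 * len T2 < len s + len t)%N /\
            (6 * len T2 < cell_len t1 (T1 * T2 * 1) B t2)%N.
  apply: (overlap_short h1 _ h2 ek _ eq (s1 := 1) (s2 := s')).
  - by rewrite mulg1.
  - by rewrite mulg1 ep' ey ex ?mulgA.
  - by rewrite mul1g.
  - by rewrite mulg1.
  - by rewrite mul1g.
have h2' : ladder cell t2 k2 (s' * y) Qb 1 by rewrite -eQ.
case: (arc_right_end (ladder_cell h1 hC) h2' (s0 := T2)) => //.
- by rewrite ep' es ex ?mulgA.
- by rewrite ex mulgA.
- move=> [et2 [g [o [q2 [es' eqy h3]]]]]; exists (x * t * y) => //.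
  have hC1 : cell t1 T1 B T2 by move: hC; rewrite /cell et2 mulg1 ?mulgA.
  have hC2 : cell T2 t g o^-1.
    have := R_inv hR; rewrite /cell es es' !invgM !invgK => hR'.
    apply: (R_conj (x := t * o^-1 * g^-1) (y := T2^-1)); last by rewrite ?mulgA.
    by move: hR'; rewrite ?mulgA.
  have := ladder_cat (ladder_cell (ladder_cell h1 hC1) hC2) h3.
  by rewrite ek eq eqy ex ?mulgA !addSn.
- by move: ht; rewrite es lenM; move: hb; rewrite es lenM; lia.
Qed.

End ArcInLadder.

(** A ladder that cannot be improved has irreducible paths; when one of them is
    trivial there is no cell, since the top and the bottom of a good cell are not
    empty. *)
Lemma ladder_progress k p q : ladder cell 1 k p q 1 -> improves k p q \/
  [/\ forall w, ~ step p w, forall w, ~ step q w & p = 1 <-> q = 1].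
Proof.
move=> h; have [hi|hn] := pselect (improves k p q); [by left | right].
have hn' : ~ improves k q p by move=> hi; exact/hn/improves_swap.
have hg := improves_or_good hn; have hg' := all_good_swap hg.
have h' : ladder cell 1 k q p 1 by have := cell_ladder_swap h; rewrite invg1.
have hp : no_backtrack p.
  by move=> x a y ha e; rewrite e in h hg hn; exact: (hn (improves_backtrack ha h hg)).
have hq : no_backtrack q.
  by move=> x a y ha e; rewrite e in h' hg' hn';
     exact: (hn' (improves_backtrack ha h' hg')).
split.
- move=> w [x [s [t [y [[[a ha [es et]]|[hR hl]] ep _]]]]].
    by apply: (hp x a y ha); rewrite ep es.
  exact: (hn (improves_arc hg hq hR hl h ep)).
- move=> w [x [s [t [y [[[a ha [es et]]|[hR hl]] ep _]]]]].
    by apply: (hq x a y ha); rewrite ep es.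
  exact: (hn' (improves_arc hg' hp hR hl h' ep)).
- case: k h hg {hn hn' hg' h'} => [|k] h hg; first by have [-> _ _] := ladder0 h.
  have [P [Pb [t1 [T [B [t2 [Q [Qb [h1 hC h2 ep eq]]]]]]]]] := ladderS h.
  have [hT hB] := good_cell_gt (conj hC (hg _ _ _ _ _ _ _ _ _ _ h1 hC h2
    (esym (congr1 S (addn0 k))) ep eq)).
  by split=> /(congr1 len); rewrite ?ep ?eq !lenM len1; lia.
Qed.

(** * Confluence of Dehn's algorithm *)
Definition joined w1 w2 : Prop := exists w1' w2' k,
  [/\ reduces w1 w1', reduces w2 w2' & ladder cell 1 k w1' w2' 1].

Lemma joined_sym w1 w2 : joined w1 w2 -> joined w2 w1.
Proof.
move=> [w1' [w2' [k [h1 h2 /cell_ladder_swap h]]]].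
by exists w2', w1', k; rewrite invg1 in h.
Qed.

Lemma joined_ladder k w1 w2 : ladder cell 1 k w1 w2 1 -> joined w1 w2.
Proof. by exists w1, w2, k; split=> //; exact: reduces_refl. Qed.

Lemma joined_reduces w1 w2 w : reduces w1 w -> reduces w2 w -> joined w1 w2.
Proof. by move=> h1 h2; exists w, w, 0; split=> //; exact: ladder_gap1. Qed.

Lemma backtrack_split a d o : len a = 1%N -> a * a^-1 = d * o -> len d = 1%N ->
  o = d^-1.
Proof.
move=> ha e hd; have hl : (len d <= len a)%N by lia.
have [v [ea ->]] := levi (esym e) hl.
have hv : len v = 0 by have := congr1 len ea; rewrite lenM; lia.
by rewrite ea invgM mulgA unit_mulV // mul1g.
Qed.

(** Two overlapping redexes give a ladder with at most two cells: the common
    part [o] becomes the side between them.  Overlaps of a cancellation with a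
    relator amount to a single cell. *)
Lemma joined_overlap x d o b y t1 t2 : (0 < len o)%N ->
  rule (d * o) t1 -> rule (o * b) t2 -> joined (x * t1 * (b * y)) (x * d * t2 * y).
Proof.
move=> ho [[a ha [ea ->]]|[hR1 hl1]] [[c hc [ec ->]]|[hR2 hl2]].
- suff -> : b = d.
    by apply: (@joined_reduces _ _ (x * d * y)); rewrite !mulg1 ?mulgA; exact: reduces_refl.
  have ld := congr1 len ea; rewrite !lenM lenV ha in ld.
  have lc := congr1 len ec; rewrite !lenM lenV hc in lc.
  have [ho1|ho1] := eqVneq (len o) 1%N.
    have hd : len d = 1%N by lia.
    rewrite (backtrack_split ha (esym ea) hd) in ec.
    have hd' : len d^-1 = 1%N by rewrite lenV.
    by rewrite (backtrack_split hc (esym ec) hd') invgK.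
  have hd : (len d <= len a)%N by move: ho1 => /eqP; lia.
  have [v [eav eo]] := levi ea hd.
  have hv : len v = 1%N by have := congr1 len eav; rewrite lenM; move: ho1 => /eqP; lia.
  have hu : (len v <= len c)%N by lia.
  rewrite eo -mulgA in ec; have [z [ecz e]] := levi ec hu.
  have hz : len z = 0 by have := congr1 len ecz; rewrite lenM; lia.
  rewrite eav ecz !invgM (mulgA z) unit_mulV // mul1g in e.
  apply: (@mulMI d^-1); rewrite [d^-1 * d]unit_Vmul; last by lia.
  by apply: (@mulMI v^-1); rewrite mulg1 mulgA.
- have ld := congr1 len ea; rewrite !lenM lenV ha in ld.
  have [ho1|ho1] := eqVneq (len o) 1%N.
    have hd : len d = 1%N by lia.
    have eo := backtrack_split ha (esym ea) hd.
    have hC : cell 1 b (d * t2) 1.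
      rewrite /cell invg1 mul1g mulg1 invgM ?mulgA.
      apply: (R_conj (x := d^-1) (y := b * t2^-1)); last by [].
      by move: hR2; rewrite eo ?mulgA.
    have := ladder_gap y (ladder_cell (ladder_gap1 _ x) hC).
    by rewrite ?mulgA mulg1 => /joined_ladder.
  have hd : len d = 0 by move: ho1 => /eqP; lia.
  have eo : o = d^-1 * (a * a^-1) by rewrite -ea unitK.
  have /R_red : R (a * a^-1 * (b * t2^-1 * d^-1)); last by rewrite ha.
  apply: (R_conj (x := d^-1) (y := a * a^-1 * b * t2^-1)); last by rewrite ?mulgA.
  by move: hR2; rewrite eo ?mulgA.
- have lc := congr1 len ec; rewrite !lenM lenV hc in lc.
  have [ho1|ho1] := eqVneq (len o) 1%N.
    have eb := backtrack_split hc (esym ec) ho1.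
    have hC : cell 1 (t1 * b) d 1.
      rewrite /cell invg1 mul1g mulg1 eb.
      by have := R_inv hR1; rewrite !invgM !invgK ?mulgA.
    have := ladder_gap y (ladder_cell (ladder_gap1 _ x) hC).
    by rewrite ?mulgA mulg1 => /joined_ladder.
  have hb : len b = 0 by move: ho1 => /eqP; lia.
  have eo : o = c * c^-1 * b^-1 by rewrite -ec -mulgA unit_mulV // mulg1.
  have /R_red : R (c * c^-1 * (b^-1 * t1^-1 * d)); last by rewrite hc.
  apply: (R_conj (x := d) (y := c * c^-1 * b^-1 * t1^-1)); last by rewrite ?mulgA.
  by move: hR1; rewrite eo ?mulgA.
- have hC1 : cell 1 t1 d o^-1.
    rewrite /cell invg1 mul1g.
    by have := R_inv hR1; rewrite !invgM !invgK ?mulgA.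
  have hC2 : cell o^-1 b t2 1 by rewrite /cell invgK mulg1.
  have := ladder_gap y (ladder_cell (ladder_cell (ladder_gap1 _ x) hC1) hC2).
  by rewrite ?mulgA => /joined_ladder.
Qed.

(** A redex strictly inside another one is common to both relators and more than
    half of its own, too long for a piece; so the relators are equal, and the two
    results agree up to cancellations. *)
Lemma rule_nested d s b t1 t2 : rule (d * s * b) t1 -> rule s t2 ->
  (0 < len d + len b)%N -> R (s * t2^-1) /\ t2 = d^-1 * t1 * b^-1.
Proof.
move=> [[a ha [ea ->]]|[hR1 hl1]] [[c hc [ec ->]]|[hR2 hl2]] hdb.
- by have := congr1 len ea; rewrite ec !lenM !lenV ha hc; lia.
- have := congr1 len ea; have := R_len hR2; rewrite !lenM !lenV ha; lia.
- have /R_red : R (c * c^-1 * (b * t1^-1 * d)); last by rewrite hc.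
  apply: (R_conj (x := d) (y := c * c^-1 * b * t1^-1)); last by rewrite ?mulgA.
  by move: hR1; rewrite ec ?mulgA.
- split=> //; have R1 : R (s * (b * t1^-1 * d)).
    apply: (R_conj (x := d) (y := s * b * t1^-1)); last by rewrite ?mulgA.
    by move: hR1; rewrite ?mulgA.
  have [e|/eqP ne] := eqVneq t2^-1 (b * t1^-1 * d).
    by rewrite -[t2]invgK e !invgM invgK mulgA.
  by have := R_piece hR2 R1 ne; rewrite lenM lenV; lia.
Qed.

Lemma joined_le x1 s1 y1 t1 x2 s2 y2 t2 : x1 * s1 * y1 = x2 * s2 * y2 ->
  rule s1 t1 -> rule s2 t2 -> (len x1 <= len x2)%N ->
  joined (x1 * t1 * y1) (x2 * t2 * y2).
Proof.
move=> e r1 r2 hx; rewrite -?mulgA in e; have [d [ex2 e1]] := levi e hx.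
have [hd|/ltnW hd] := leqP (len s1) (len d).
  have [f [ed ey1]] := levi e1 hd.
  apply: (@joined_reduces _ _ (x1 * t1 * f * t2 * y2)); apply: step_reduces.
    by exists (x1 * t1 * f), s2, t2, y2; rewrite ey1 ?mulgA.
  by exists x1, s1, t1, (f * t2 * y2); rewrite ex2 ed ?mulgA.
have [o [es1 e2]] := levi (esym e1) hd.
have [ho|ho] := posnP (len o).
  apply: (@joined_reduces _ _ (x1 * t1 * (o^-1 * t2 * y2))); apply: step_reduces.
    exists (x1 * t1 * o^-1), s2, t2, y2; split=> //; last by rewrite ?mulgA.
    by rewrite -[in LHS](unitK y1 ho) -e2 ?mulgA.
  exists x1, s1, t1, (o^-1 * t2 * y2); split=> //.
  by rewrite ex2 es1 -?mulgA unitVK.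
have [hs|/ltnW hs] := leqP (len o) (len s2).
  have [b [es2 ey1]] := levi (esym e2) hs.
  rewrite ey1 ex2; rewrite es1 in r1; rewrite es2 in r2.
  exact: (joined_overlap x1 y2 ho r1 r2).
have [b [eo ey2]] := levi e2 hs.
(* Equal redexes up to labels count as overlapping, others as nested. *)
have [hdb|hdb] := posnP (len d + len b).
  have r1' := r1; rewrite es1 eo in r1'.
  rewrite ex2 ey2; have hb : len b = 0 by lia.
  have e3 : s2 * b = o * 1 by rewrite mulg1.
  rewrite es1 in r1; have := @joined_overlap x1 d o b^-1 (b * y1) t1 t2 ho r1.
  by rewrite {1}eo -mulgA unit_mulV // mulg1 unitK //; exact.
rewrite es1 eo mulgA in r1; have [_ et2] := rule_nested r1 r2 hdb.
apply: (@joined_reduces _ _ (x1 * t1 * y1)); first exact: reduces_refl.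
rewrite ex2 ey2 et2.
apply: (reduces_trans (w2 := x1 * t1 * b^-1 * b * y1)).
  have := reduces_cancel x1 d (t1 * b^-1 * b * y1); by rewrite ?mulgA.
have := reduces_cancel (x1 * t1) b^-1 y1; by rewrite invgK.
Qed.

Lemma joined_steps w w1 w2 : step w w1 -> step w w2 -> joined w1 w2.
Proof.
move=> [x1 [s1 [t1 [y1 [r1 e1 ->]]]]] [x2 [s2 [t2 [y2 [r2 e2 ->]]]]].
rewrite e1 in e2; have [h|/ltnW h] := leqP (len x1) (len x2).
  exact: joined_le r1 r2 h.
by apply/joined_sym/(joined_le _ r2 r1 h).
Qed.

Definition dehn_trivial w := reduces w 1.

Definition confluent_below m : Prop := forall w w', (len w < m)%N -> step w w' ->
  dehn_trivial w -> dehn_trivial w'.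

Lemma confluent_reduces m w w' : confluent_below m -> reduces w w' ->
  (len w < m)%N -> dehn_trivial w <-> dehn_trivial w'.
Proof.
move=> hm; elim=> // {}w w1 w2 hs h IH hl.
have hl1 : (len w1 < m)%N by have := step_len hs; lia.
rewrite -(IH hl1); split; first exact: hm.
by move=> h1; exact: reduces_step h1.
Qed.

(** Induction on the size of the ladder: improving it reduces both paths, which
    preserves triviality below [m], and a ladder that cannot be improved joins
    irreducible elements. *)
Lemma confluent_ladder m k p q : confluent_below m -> (len p < m)%N -> (len q < m)%N ->
  ladder cell 1 k p q 1 -> dehn_trivial p <-> dehn_trivial q.
Proof.
move=> hm; have [n] := ubnP (2 * (len p + len q) + k)%N.
elim: n => // n IH in k p q * => hn hp hq h.
case: (ladder_progress h) => [[k' [p' [q' [h1 h2 h3 h4]]]]|[hpi hqi hpq]].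
  rewrite (confluent_reduces hm h1 hp) (confluent_reduces hm h2 hq).
  apply: (IH k') h3; first by lia.
    by have := reduces_len h1; lia.
  by have := reduces_len h2; lia.
have irr w : (forall w', ~ step w w') -> dehn_trivial w <-> w = 1.
  move=> hw; split=> [|->]; last exact: reduces_refl.
  by move e: 1 => v h'; case: h' e => // w1 w2 /hw.
by rewrite (irr p) // (irr q).
Qed.

(** Reducibility to [1] is invariant under every step, so it is the triviality in
    the monoid presented by the rules.  The proof is by induction on the length: the
    first step of a reduction to [1] and the given step form a local peak, whose
    two ends reduce to the two paths of a ladder. *)
Theorem dehn_trivial_step w w' : step w w' -> dehn_trivial w <-> dehn_trivial w'.
Proof.
move=> hs; split; last by move=> h; exact: reduces_step h.
suff h m : confluent_below m by exact: (h (len w).+1).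
elim: m {w w' hs} => // m IH w w2 hl hs2 hw.
have [w1 hs1 h1] : exists2 w1, step w w1 & dehn_trivial w1.
  move: hw hl hs2; rewrite /dehn_trivial; move e: 1 => v h.
  case: h e => [<- _ /step_len|w1 {}v hs1 h1 e _ _]; first by rewrite len1.
  by exists w1; rewrite // e.
have [w1' [w2' [k [r1 r2 hL]]]] := joined_steps hs1 hs2.
have l1 : (len w1 < m)%N by have := step_len hs1; lia.
have l2 : (len w2 < m)%N by have := step_len hs2; lia.
apply/(confluent_reduces IH r2 l2).
apply/(confluent_ladder IH _ _ hL).
- by have := reduces_len r1; lia.
- by have := reduces_len r2; lia.
- by apply/(confluent_reduces IH r1 l1).
Qed.
End DehnAlgorithm.

(** * Paths with labels in a group *)

(** The pair of [:: u0; ...; un'] and [u] is the product [u0 e u1 e ... un' e u] of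
    labels in [U] and of a formal edge [e] with [e^-1 = e] but without the relation
    [e * e = 1].  So edges are counted exactly, and the labels of two paths are
    multiplied at the vertex where the paths are joined. *)
Definition gpath (U : groupType) : Type := (seq U * U)%type.

Section PathMonoid.
Variable U : groupType.
Implicit Types (s t : seq U) (u v : U).
Local Notation P := (gpath U).
HB.instance Definition _ := Choice.on P.

Definition gpath_mul (x y : P) : P :=
  if y.1 is c :: t then (x.1 ++ x.2 * c :: t, y.2) else (x.1, x.2 * y.2).

Definition gpath_one : P := ([::], 1).

Definition gpath_inv (x : P) : P :=
  if x.1 is c :: s then (x.2^-1 :: rev (map (@monoid.inv U) s), c^-1) else ([::], x.2^-1).

Lemma gpath_mulA : associative gpath_mul.
Proof.
move=> [s u] [[|c t] v] [[|d r] w]; rewrite /gpath_mul /= ?mulgA //.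
by rewrite -catA.
Qed.

Lemma gpath_mul1 : left_id gpath_one gpath_mul.
Proof. by move=> [[|c t] v]; rewrite /gpath_mul /= mul1g. Qed.

Lemma gpath_invK : involutive gpath_inv.
Proof.
move=> [[|c s] u]; rewrite /gpath_inv /= ?invgK //.
by rewrite map_rev revK mapK //; exact: invgK.
Qed.

Lemma gpath_invM : {morph gpath_inv : x y / gpath_mul x y >-> gpath_mul y x}.
Proof.
move=> [[|c s] u] [[|d t] v]; rewrite /gpath_inv /gpath_mul /= ?invgM //.
by rewrite map_cat rev_cat /= rev_cons invgM cat_rcons.
Qed.

HB.instance Definition _ := isStarMonoid.Build P
  gpath_mulA gpath_mul1 gpath_invK gpath_invM.

Definition gpath_len (x : P) : nat := size x.1.
Definition vtx u : P := ([::], u).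
Definition edge : P := ([:: 1], 1).
Definition loop s : P := (belast 1 s, last 1 s).

Lemma gpath_mulE (x y : P) : x * y = gpath_mul x y. Proof. by []. Qed.
Lemma gpath_invE (x : P) : x^-1 = gpath_inv x. Proof. by []. Qed.

Lemma gpath_lenM (x y : P) : gpath_len (x * y) = (gpath_len x + gpath_len y)%N.
Proof.
by case: x y => [s u] [[|c t] v]; rewrite gpath_mulE /gpath_mul /gpath_len /= ?addn0 // size_cat.
Qed.

Lemma gpath_lenV (x : P) : gpath_len x^-1 = gpath_len x.
Proof.
by case: x => [[|c s] u]; rewrite gpath_invE /gpath_inv /gpath_len //= size_rev size_map.
Qed.

Lemma vtxM u v : vtx (u * v) = vtx u * vtx v. Proof. by []. Qed.
Lemma vtxV u : vtx u^-1 = (vtx u)^-1. Proof. by []. Qed.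
Lemma vtx1 : vtx 1 = 1. Proof. by []. Qed.
Lemma edgeV : edge^-1 = edge. Proof. by rewrite gpath_invE /gpath_inv /= invg1. Qed.

Lemma gpath_unit (x : P) : gpath_len x = 0 -> x = vtx x.2.
Proof. by case: x => [[|c s] u]. Qed.

Lemma gpath_unit_mulV (x : P) : gpath_len x = 0 -> x * x^-1 = 1.
Proof. by move=> /gpath_unit ->; rewrite -vtxV -vtxM mulgV. Qed.

Lemma gpath_mulI (x y z : P) : x * y = x * z -> y = z.
Proof.
case: x y z => [s u] [[|c t] v] [[|d r] w]; rewrite !gpath_mulE /gpath_mul /=.
- by case=> /mulgI ->.
- by move=> [/(congr1 size)]; rewrite size_cat /=; lia.
- by move=> [/(congr1 size)]; rewrite size_cat /=; lia.
- by move=> [/eqP]; rewrite eqseq_cat // eqxx /= eqseq_cons => /andP[/eqP/mulgI-> /eqP->] ->.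
Qed.

Lemma gpath_take (x y : P) : take (gpath_len x) (x * y).1 = x.1.
Proof.
case: x y => [s u] [[|c t] v]; rewrite gpath_mulE /gpath_mul /gpath_len /= ?take_size //.
by rewrite take_size_cat.
Qed.

Lemma gpath_levi (x y z t : P) : x * y = z * t -> (gpath_len x <= gpath_len z)%N ->
  exists r, z = x * r /\ y = r * t.
Proof.
move=> e hl; suff [r er] : exists r, z = x * r.
  by exists r; split=> //; apply: (@gpath_mulI x); rewrite e er mulgA.
have e1 : z.1 = x.1 ++ drop (size x.1) z.1.
  rewrite -{1}[z.1](cat_take_drop (size x.1)); congr (_ ++ _).
  rewrite -[RHS](gpath_take x y) e -[in LHS](gpath_take z t) take_takel //.
case: z e1 {e hl} => [s2 u2] /=; case: (drop _ _) => [|d r] e1.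
  exists ([::], x.2^-1 * u2); rewrite gpath_mulE /gpath_mul /= mulVKg.
  by rewrite e1 cats0.
by exists (x.2^-1 * d :: r, u2); rewrite gpath_mulE /gpath_mul /= mulVKg -e1.
Qed.

Lemma gpath_cut n (x : P) : (n <= gpath_len x)%N ->
  exists y z, x = y * z /\ gpath_len y = n.
Proof.
case: x => [s u] hn; exists (take n s, 1), (drop n s, u); split; last first.
  by rewrite /gpath_len /= size_takel.
rewrite gpath_mulE /gpath_mul /=; case e: (drop n s) => [|c t]; rewrite !mul1g.
  by rewrite -[in LHS](cat_take_drop n s) e cats0.
by rewrite -e cat_take_drop.
Qed.

Lemma loop_cons u s : loop (u :: s) = edge * vtx u * loop s.
Proof.
by case: s => [|c s]; rewrite !gpath_mulE /gpath_mul /loop /= !mul1g ?mulg1.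
Qed.

Lemma loop_cat s t : loop (s ++ t) = loop s * loop t.
Proof. by elim: s => [|u s IH]; rewrite ?mul1g //= !loop_cons IH !mulgA. Qed.

Lemma loop_len s : gpath_len (loop s) = size s.
Proof. by rewrite /gpath_len /= size_belast. Qed.

Lemma loop_inv u s :
  (loop (rcons s u))^-1 = vtx u^-1 * loop (rcons (rev (map (@monoid.inv U) s)) u^-1) * vtx u.
Proof.
have h t : edge * (loop t)^-1 = loop (rev (map (@monoid.inv U) t)) * edge.
  elim: t => [|v t IH]; first by rewrite invg1 mul1g mulg1.
  rewrite loop_cons !invgM edgeV -vtxV /= rev_cons -cats1 loop_cat mulgA IH.
  by rewrite loop_cons mulg1 -!mulgA.
rewrite -!cats1 !loop_cat !loop_cons !mulg1 !invgM edgeV -vtxV -!mulgA -vtxM mulVg.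
by rewrite mulg1 h.
Qed.

End PathMonoid.

(** * Small cancellation for relators among paths *)
Section PathRelators.
Variables (U : groupType) (cyc : seq U -> Prop).
Local Notation P := (gpath U).
Implicit Types (Y s t : seq U) (u v : U) (x y w r : P).

(** The relators are the loops spelled by words of [cyc], started at an
    arbitrary point of the first vertex: the label there may be split between the
    beginning and the end. *)
Definition gpath_rel r : Prop := exists Y u, cyc Y /\ r = vtx u * loop Y * vtx u^-1.

(** In the last condition, an overlap with [n.+1] edges determines only the [n]
    labels strictly between them, as the first and the last label may be split
    differently; hence the successor. *)
Definition cyclic_small_cancellation : Prop :=
  [/\ forall s t, cyc (s ++ t) -> cyc (t ++ s),
      forall s, cyc s -> cyc (rev (map (@monoid.inv U) s)),
      forall s, cyc s -> 1 \notin s,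
      forall s, cyc s -> (6 < size s)%N &
      forall s t t', cyc (s ++ t) -> cyc (s ++ t') -> t <> t' ->
        t <> [::] -> t' <> [::] -> (6 * (size s).+1 < size (s ++ t))%N].

Hypothesis cycSC : cyclic_small_cancellation.

Lemma gpath_rel_rot x y : gpath_rel (x * y) -> gpath_rel (y * x).
Proof.
move=> [Y [u [hY e]]]; have [hrot _ _ _ _] := cycSC.
pose x' := vtx u^-1 * x; pose y' := y * vtx u.
have e' : x' * y' = loop Y.
  rewrite /x' /y' -mulgA (mulgA x) e !mulgA -vtxM mulVg mul1g.
  by rewrite -mulgA -vtxM mulVg mulg1.
have hl : (gpath_len x' <= size Y)%N by rewrite -loop_len -e' gpath_lenM leq_addr.
have {}e' : x' * y' = loop (take (gpath_len x') Y) * loop (drop (gpath_len x') Y).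
  by rewrite -loop_cat cat_take_drop.
have hl' : (gpath_len x' <= gpath_len (loop (take (gpath_len x') Y)))%N.
  by rewrite loop_len size_takel.
have [r [e1 e2]] := gpath_levi e' hl'.
have hr : gpath_len r = 0.
  by have := congr1 (@gpath_len U) e1; rewrite gpath_lenM loop_len size_takel //; lia.
have er := gpath_unit hr; set v := r.2 in er.
exists (drop (gpath_len x') Y ++ take (gpath_len x') Y), v; split.
  by apply: hrot; rewrite cat_take_drop.
have ex : x = vtx u * loop (take (gpath_len x') Y) * vtx v^-1.
  rewrite e1 er -!mulgA -vtxM mulgV mulg1 /x'.
  by rewrite mulgA -vtxM mulgV mul1g.
have ey : y = vtx v * loop (drop (gpath_len x') Y) * vtx u^-1.
  by rewrite -er -e2 /y' -mulgA -vtxM mulgV mulg1.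
rewrite {1}ey {1}ex loop_cat -!mulgA; do 2 congr (_ * _).
by rewrite mulgA -vtxM mulVg mul1g.
Qed.

Lemma gpath_rel_inv x : gpath_rel x -> gpath_rel x^-1.
Proof.
move=> [Y [u [hY ->]]]; have [hrot hinv _ hlen _] := cycSC.
case/lastP: Y hY => [/hlen //|Y z] hY.
exists (rcons (rev (map (@monoid.inv U) Y)) z^-1), (u * z^-1); split.
  rewrite -cats1; apply: hrot; rewrite /= -rev_rcons -map_rcons; exact: hinv.
rewrite !invgM loop_inv -!vtxV !invgK.
by rewrite !vtxM !mulgA.
Qed.

Lemma gpath_rel_fst Y u : (vtx u * loop Y * vtx u^-1).1 = belast u Y.
Proof.
by case: Y => [|c Y]; rewrite !gpath_mulE /gpath_mul /loop /= ?mulg1.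
Qed.

Lemma gpath_conj_len Y u : gpath_len (vtx u * loop Y * vtx u^-1) = size Y.
Proof. by rewrite /gpath_len gpath_rel_fst size_belast. Qed.

Lemma gpath_rel_len x : gpath_rel x -> (6 < gpath_len x)%N.
Proof.
move=> [Y [u [hY ->]]]; have [_ _ _ hlen _] := cycSC.
by rewrite gpath_conj_len; exact: hlen.
Qed.

Lemma gpath_rel_red a x : gpath_rel (a * a^-1 * x) -> gpath_len a = 0.
Proof.
move=> h; have [_ _ hnt hlen _] := cycSC.
have [//|ha] := posnP (gpath_len a).
have [b [c [ea hb]]] := @gpath_cut U (gpath_len a).-1 a (leq_pred _).
have hc : gpath_len c = 1%N by move: ha hb; rewrite ea gpath_lenM; lia.
have {}h : gpath_rel (c * c^-1 * (b^-1 * x * b)).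
  have := @gpath_rel_rot b (c * c^-1 * (b^-1 * x)); rewrite !mulgA; apply.
  by move: h; rewrite ea invgM !mulgA.
case: c hc h {ea} => [[|d [|d' s]] v] // _ [Y [u [hY e]]].
have := congr1 (take 2) (congr1 fst e); rewrite gpath_rel_fst.
have -> : ((d :: [::], v) : P) * ((d :: [::], v) : P)^-1 = ([:: d; 1], d^-1).
  by rewrite gpath_mulE /gpath_mul /gpath_inv /= mulgV.
have := gpath_take (([:: d; 1], d^-1) : P) (b^-1 * x * b); rewrite /gpath_len /= => ->.
have := hnt _ hY; have := hlen _ hY.
case: Y {hY e} => [|y1 [|y2 Y]] //= _; rewrite inE negb_or => /andP[/eqP h1 _] [_ e1].
by case: h1.
Qed.

Lemma gpath_rel_piece (b x y : P) : gpath_rel (b * x) -> gpath_rel (b * y) -> x <> y ->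
  (6 * gpath_len b < gpath_len (b * x)%g)%N.
Proof.
move=> hx hy ne; have hl := gpath_rel_len hx; have [_ _ _ _ hpiece] := cycSC.
have [hb|hb] := posnP (gpath_len b); first by lia.
case: hx hy => [Y [u [hY e1]]] [Z [v [hZ e2]]].
have eb1 := gpath_take b x; have eb2 := gpath_take b y.
have l1 : (gpath_len b <= size Y)%N.
  by have := congr1 (@gpath_len U) e1; rewrite gpath_lenM gpath_conj_len; lia.
have l2 : (gpath_len b <= size Z)%N.
  by have := congr1 (@gpath_len U) e2; rewrite gpath_lenM gpath_conj_len; lia.
have hbl s c n : (n.+1 <= size s)%N -> take n.+1 (belast c s) = c :: take n s.
  case: s => // d s /= hn; congr cons.
  by elim: s d n hn {hl hb l1 l2 eb1 eb2} => [|d' s IH] d [|n] //= hn; rewrite IH.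
move: eb1 eb2; rewrite e1 e2 !gpath_rel_fst.
case: (gpath_len b) hb l1 l2 => // n _ l1 l2; rewrite !hbl // => <- [euv etk].
rewrite -e1 e1 gpath_conj_len.
rewrite -(cat_take_drop n Y) in hY *; rewrite -(cat_take_drop n Z) etk in hZ.
have sn : size (take n Y) = n by rewrite size_takel // ltnW.
rewrite -{1}sn; apply: hpiece hY hZ _ _ _.
- move=> ed; apply: ne; apply: (@gpath_mulI U b); rewrite e1 e2 euv.
  by rewrite -(cat_take_drop n Y) -(cat_take_drop n Z) etk ed.
- by move/(congr1 size); rewrite size_drop /=; lia.
- by move/(congr1 size); rewrite size_drop /=; lia.
Qed.

Definition path_step : P -> P -> Prop := step (@gpath_len U) gpath_rel.
Definition path_trivial : P -> Prop := dehn_trivial (@gpath_len U) gpath_rel.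

Lemma path_stepE w w' : path_step w w' -> exists x s t y : P,
  [/\ (exists2 a : P, gpath_len a = 1%N & s = a * a^-1 /\ t = 1) \/
     (gpath_rel (s * t^-1) /\ (gpath_len t < gpath_len s)%N),
   w = x * s * y & w' = x * t * y].
Proof. by []. Qed.

Lemma path_trivial_step w w' : path_step w w' -> path_trivial w <-> path_trivial w'.
Proof.
apply: (@dehn_trivial_step P (@gpath_len U)).
- exact: gpath_lenM.
- exact: gpath_lenV.
- exact: gpath_unit_mulV.
- exact: gpath_levi.
- exact: gpath_mulI.
- exact: gpath_cut.
- exact: gpath_rel_rot.
- exact: gpath_rel_inv.
- exact: gpath_rel_red.
- exact: gpath_rel_len.
- exact: gpath_rel_piece.
Qed.

(** The congruence of the quotient by the rules, expressed through triviality
    in all contexts; this makes compatibility with products immediate. *)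
Definition path_eqv w w' : Prop :=
  forall x y, path_trivial (x * w * y) <-> path_trivial (x * w' * y).

Lemma path_eqv_sym w w' : path_eqv w w' -> path_eqv w' w.
Proof. by move=> h x y; split=> /h. Qed.

Lemma path_eqv_trans w2 w1 w3 : path_eqv w1 w2 -> path_eqv w2 w3 -> path_eqv w1 w3.
Proof. by move=> h1 h2 x y; rewrite h1. Qed.

Lemma path_eqvM w1 w1' w2 w2' :
  path_eqv w1 w1' -> path_eqv w2 w2' -> path_eqv (w1 * w2) (w1' * w2').
Proof.
move=> h1 h2 x y; have e (v1 v2 : P) : x * (v1 * v2) * y = x * v1 * (v2 * y).
  by rewrite !mulgA.
by rewrite e h1 mulgA h2 -mulgA e.
Qed.

Lemma path_eqv_rule (s t : P) : rule (@gpath_len U) gpath_rel s t -> path_eqv s t.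
Proof. by move=> h x y; apply: path_trivial_step; exists x, s, t, y. Qed.

Lemma path_eqv_edge : path_eqv (edge U * edge U) 1.
Proof. by apply: path_eqv_rule; left; exists (edge U); rewrite ?edgeV. Qed.

Lemma path_eqv_loop Y : cyc Y -> path_eqv (loop Y) 1.
Proof.
move=> hY; apply: path_eqv_rule; right; rewrite invg1 mulg1 loop_len; split.
  by exists Y, 1; rewrite invg1 vtx1 mul1g mulg1.
by have [_ _ _ hlen _] := cycSC; apply: leq_trans (hlen _ hY).
Qed.

Lemma path_eqv_trivial w : path_eqv w 1 -> path_trivial w.
Proof. by move=> /(_ 1 1); rewrite !mul1g !mulg1 => ->; exact: reduces_refl. Qed.

Lemma path_trivial_vtx u : path_trivial (vtx u) -> u = 1.
Proof.
rewrite /path_trivial /dehn_trivial; move e1: (vtx u) => v; move e2: 1 => v' h.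
case: h e1 e2 => [<- [] //|w w' hs _ e1 _].
have := @step_len P (@gpath_len U) (@gpath_lenM U) (@gpath_lenV U) _ _ _ hs.
by rewrite -e1.
Qed.

End PathRelators.

(** * Free products as groups of paths *)

(** Labels in the direct product accommodate both factors.  A letter of [A] is a
    label at the base vertex and a letter of [B] is conjugated by the edge
    ([letter_path]), so that an alternating word is a path whose labels are its
    letters, alternately at the two ends of the edge. *)
Definition factor_pair (A B : groupType) : Type := (A * B)%type.

Section FactorPair.
Variables A B : groupType.
Local Notation U := (factor_pair A B).
HB.instance Definition _ := Choice.on U.
Definition pair_mul (u v : U) : U := (u.1 * v.1, u.2 * v.2).
Definition pair_inv (u : U) : U := (u.1^-1, u.2^-1).
Lemma pair_mulA : associative pair_mul.
Proof. by move=> u v w; rewrite /pair_mul /= !mulgA. Qed.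
Lemma pair_mul1 : left_id (1, 1) pair_mul.
Proof. by move=> [a b]; rewrite /pair_mul /= !mul1g. Qed.
Lemma pair_1mul : right_id (1, 1) pair_mul.
Proof. by move=> [a b]; rewrite /pair_mul /= !mulg1. Qed.
Lemma pair_mulV : left_inverse (1, 1) pair_inv pair_mul.
Proof. by move=> [a b]; rewrite /pair_mul /= !mulVg. Qed.
Lemma pair_Vmul : right_inverse (1, 1) pair_inv pair_mul.
Proof. by move=> [a b]; rewrite /pair_mul /= !mulgV. Qed.
HB.instance Definition _ :=
  isGroup.Build U pair_mulA pair_mul1 pair_1mul pair_mulV pair_Vmul.
End FactorPair.

Section FreeProductWords.
Variables A B : groupType.
Local Notation L := (A + B)%type.
Local Notation F := (free_product A B).
Implicit Types (x : L) (c w Y s t : seq L) (C : seq (seq L)).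

Definition winv w : seq L := rev (map (@letter_inv A B) w).
Definition wprod w : F := \prod_(x <- w) fp_letter x.

Lemma winvK : involutive winv.
Proof. by move=> w; rewrite /winv map_rev revK (mapK (@letter_invK A B)). Qed.

Definition cyclic_words C Y : Prop :=
  exists2 c, c \in C & exists n, Y = rot n c \/ Y = rot n (winv c).

Definition relator_set C : set F := fun g => exists2 c, c \in C & g = wprod c.

Definition word_small_cancellation C : Prop :=
  [/\ forall Y, cyclic_words C Y -> cycle (fun x y => ~~ same_factor x y) Y,
      forall Y, cyclic_words C Y -> all (fun x => ~~ trivial_letter x) Y,
      forall Y, cyclic_words C Y -> (6 < size Y)%N &
      forall s t t', cyclic_words C (s ++ t) -> cyclic_words C (s ++ t') -> t <> t' ->
        t <> [::] -> t' <> [::] -> (6 * (size s).+1 < size (s ++ t))%N].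

Lemma path_parity x w : path (fun x y => ~~ same_factor x y) x w ->
  same_factor x (last x w) = ~~ odd (size w).
Proof.
elim: w x => [|y w IH] x; first by case: x.
move=> /= /andP[hxy /IH]; rewrite negbK.
by case: x y (last y w) hxy => [?|?] [?|?] [?|?] //= _ h; rewrite -[RHS]negbK -h.
Qed.

Lemma cycle_even w : cycle (fun x y => ~~ same_factor x y) w -> ~~ odd (size w).
Proof.
case: w => // x w /path_parity; rewrite last_rcons size_rcons /= negbK => <-.
by case: x.
Qed.

Lemma rot_rot n m (T : Type) (w : seq T) : exists k, rot m (rot n w) = rot k w.
Proof.
have h j : exists2 i, (i <= size w)%N & rot j w = rot i w.
  have [hj|hj] := leqP j (size w); [by exists j | by exists 0; rewrite // rot0 rot_oversize // ltnW].
have h' j : exists2 i, (i <= size w)%N & rot j (rot n w) = rot i (rot n w).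
  have [hj|hj] := leqP j (size w); [by exists j |].
  by exists 0; rewrite // rot0 rot_oversize // size_rot ltnW.
have [i hi ->] := h' m; have [j hj ->] := h n.
by rewrite rot_add_mod //; eexists.
Qed.

Lemma cyclic_words_rot C s t : cyclic_words C (s ++ t) -> cyclic_words C (t ++ s).
Proof.
move=> [c hc [n h]]; exists c => //; rewrite -(rot_size_cat s t).
by case: h => ->; [have [k ->] := rot_rot n (size s) c | have [k ->] := rot_rot n (size s) (winv c)];
  exists k; [left | right].
Qed.

Lemma winv_rot n w : exists m, winv (rot n w) = rot m (winv w).
Proof.
by rewrite /winv map_rot rev_rot /rotr; eexists.
Qed.

Lemma cyclic_words_inv C Y : cyclic_words C Y -> cyclic_words C (winv Y).
Proof.
move=> [c hc [n [->|->]]]; exists c => //.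
  by have [m ->] := winv_rot n c; exists m; right.
by have [m ->] := winv_rot n (winv c); rewrite winvK; exists m; left.
Qed.

Definition letter_pair x : factor_pair A B :=
  match x with inl a => (a, 1) | inr b => (1, b) end.

Lemma letter_pairV x : letter_pair (letter_inv x) = (letter_pair x)^-1.
Proof.
have -> : (letter_pair x)^-1 = pair_inv (letter_pair x) by [].
by case: x => a; rewrite /pair_inv /= invg1.
Qed.

Lemma letter_pair_inj x y : ~~ trivial_letter x -> letter_pair x = letter_pair y -> x = y.
Proof.
case: x y => [a|b] [a'|b'] //= h [].
- by move=> ->.
- by move=> e _; rewrite e eqxx in h.
- by move=> _ e; rewrite e eqxx in h.
- by move=> ->.
Qed.

Lemma map_letter_pair_inj s t : all (fun x => ~~ trivial_letter x) s ->
  map letter_pair s = map letter_pair t -> s = t.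
Proof.
elim: s t => [|x s IH] [|y t] //= /andP[hx hs] [/(letter_pair_inj hx)-> /(IH _ hs)->] //.
Qed.

Definition pair_words C (Y : seq (factor_pair A B)) : Prop :=
  exists2 w, cyclic_words C w & Y = map letter_pair w.

(** A nontrivial letter is recovered from its label, so common parts of label
    sequences come from common parts of words. *)
Lemma pair_words_small_cancellation C :
  word_small_cancellation C -> cyclic_small_cancellation (pair_words C).
Proof.
move=> [halt hnt hlen hpiece]; split.
- move=> s t [w hw e]; have es := congr1 (take (size s)) e.
  have et := congr1 (drop (size s)) e.
  rewrite take_size_cat // -map_take in es; rewrite drop_size_cat // -map_drop in et.
  exists (drop (size s) w ++ take (size s) w); last by rewrite map_cat -es -et.
  by apply: cyclic_words_rot; rewrite cat_take_drop.
- move=> s [w hw ->]; exists (winv w); first exact: cyclic_words_inv.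
  rewrite /winv map_rev -!map_comp; congr rev; apply: eq_map => x /=.
  by rewrite letter_pairV.
- move=> s [w /hnt hw ->]; apply/mapP => -[x /(allP hw)].
  by case: x => a /= h [e]; rewrite -e eqxx in h.
- by move=> s [w /hlen hw ->]; rewrite size_map.
- move=> s t t' [w hw e] [w' hw' e'] ne ne1 ne2.
  have hs : take (size s) w = take (size s) w'.
    apply: map_letter_pair_inj.
      by have := hnt _ hw; rewrite -{1}(cat_take_drop (size s) w) all_cat => /andP[].
    by rewrite !map_take -e -e' !take_size_cat.
  have ed := congr1 (drop (size s)) e; rewrite drop_size_cat // -map_drop in ed.
  have ed' := congr1 (drop (size s)) e'; rewrite drop_size_cat // -map_drop in ed'.
  rewrite -(cat_take_drop (size s) w) in hw; rewrite -(cat_take_drop (size s) w') -hs in hw'.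
  have sz : size (take (size s) w) = size s.
    by rewrite -(size_map letter_pair) map_take -e take_size_cat.
  have := hpiece _ _ _ hw hw'; rewrite sz cat_take_drop e size_map; apply.
  + by move=> h; apply: ne; rewrite ed ed' h.
  + by move=> h; apply: ne1; rewrite ed h.
  + by move=> h; apply: ne2; rewrite ed' h.
Qed.

Local Notation U := (factor_pair A B).
Local Notation P := (gpath U).
Local Notation e := (edge U).

Definition letter_path x : P :=
  match x with inl _ => vtx (letter_pair x) | inr _ => e * vtx (letter_pair x) * e end.

Definition word_path w : P := \prod_(x <- w) letter_path x.

Lemma word_path_cat s t : word_path (s ++ t) = word_path s * word_path t.
Proof. by rewrite /word_path big_cat. Qed.

Section Quotient.
Variable C : seq (seq L).
Hypothesis hC : word_small_cancellation C.
Let cyc := pair_words C.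
Let SC : cyclic_small_cancellation cyc := pair_words_small_cancellation hC.
Local Notation "x === y" := (path_eqv cyc x y) (at level 70).

Let eqv_trans := @path_eqv_trans U cyc.
Let eqv_sym := @path_eqv_sym U cyc.
Let eqvM := @path_eqvM U cyc.
Let eqv_edge : e * e === 1 := path_eqv_edge SC.

Lemma eqv_edge_mul (x y : P) : x * e * e * y === x * y.
Proof.
have -> : x * e * e * y = x * (e * e) * y by rewrite !mulgA.
by rewrite -{2}[x]mulg1; do 2 apply: eqvM => //.
Qed.

Lemma letter_path_trivial x : trivial_letter x -> letter_path x === 1.
Proof. by case: x => a /eqP -> /=; rewrite ?vtx1 ?mulg1 //; exact: eqv_edge. Qed.

Lemma letter_pathM x y : same_factor x y ->
  letter_path (letter_mul x y) === letter_path x * letter_path y.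
Proof.
case: x y => [a|b] [a'|b'] //= _.
  by rewrite -vtxM; have -> : ((a, 1) : U) * ((a', 1) : U) = (a * a', 1 * 1) by []; rewrite mul1g.
apply: eqv_sym; apply: (eqv_trans (w2 := e * vtx (1, b) * (vtx (1, b') * e))).
  by have := eqv_edge_mul (e * vtx (1, b)) (vtx (1, b') * e); rewrite !mulgA.
rewrite -mulgA (mulgA (vtx _)) -vtxM !mulgA.
by have -> : ((1, b) : U) * ((1, b') : U) = (1 * 1, b * b') by []; rewrite mul1g.
Qed.

(** The relation [e * e = 1] and the group laws in each factor are all that is
    needed for letters to act on normal forms. *)
Lemma word_path_act x w : word_path (letter_act x w) === letter_path x * word_path w.
Proof.
rewrite /letter_act; case: ifP => [tx|_].
  by rewrite -{1}[word_path w]mul1g; apply: eqvM => //; apply/eqv_sym/letter_path_trivial.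
case: w => [|y w]; first by rewrite /word_path big_seq1 big_nil mulg1.
case: ifP => [sxy|_]; last by rewrite /word_path !big_cons.
have hm := letter_pathM sxy; rewrite {2}/word_path big_cons mulgA.
case: ifP => [txy|_].
  rewrite -[X in X === _]mul1g; apply: eqvM => //.
  by apply: eqv_trans hm; apply/eqv_sym/letter_path_trivial.
by rewrite /word_path big_cons; apply: eqvM.
Qed.

Lemma word_path_prod w : word_path (wprod w) === word_path w.
Proof.
elim: w => [|x w IH]; first by rewrite /wprod big_nil.
rewrite /wprod big_cons -/(wprod w) {2}/word_path big_cons -/(word_path w).
have -> : fp_word (fp_letter x * wprod w) = letter_act x (wprod w).
  by rewrite /= foldr_letter_act // fp_wordP.
by apply: eqv_trans (word_path_act x _) _; apply: eqvM.
Qed.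

Lemma wprod_word (g : F) : wprod g = g.
Proof. by rewrite [RHS]fp_word_prod. Qed.

Lemma word_path_mul (g h : F) : word_path (g * h)%g === word_path g * word_path h.
Proof.
rewrite -{1}(wprod_word g) -{1}(wprod_word h) /wprod -big_cat -word_path_cat.
exact: word_path_prod.
Qed.

Lemma loop_relator c : c \in C -> loop (map letter_pair c) === 1.
Proof.
by move=> hc; apply: path_eqv_loop => //; exists c => //; exists c => //; exists 0; left; rewrite rot0.
Qed.

(** The loop starts with an edge before its first label, and in a word beginning
    in [B] this edge is already part of the path of its first letter; a word
    beginning in [A] has to be conjugated.  Even length makes the edges at the end
    match. *)
Lemma word_path_alternating w : ~~ odd (size w) ->
  sorted (fun x y => ~~ same_factor x y) w ->
  (if w is inl _ :: _ then e * word_path w = loop (map letter_pair w) * e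
   else word_path w = loop (map letter_pair w)).
Proof.
have [n] := ubnP (size w); elim: n w => // n IH [|x [|y w]] // hn; rewrite /= ?negbK.
  by move=> _ _; rewrite /word_path big_nil.
move=> ho /andP[hxy hp]; have hs : sorted (fun x y => ~~ same_factor x y) w.
  by apply: path_sorted hp.
have hn' : (size w < n)%N by move: hn => /=; lia.
have := IH w hn' ho hs.
rewrite /word_path !big_cons -/(word_path w) !loop_cons.
case: x y hxy hp {hn hs IH ho hn'} => [a|b] [a'|b'] //= _ hp hw.
- have {hp}hw : e * word_path w = loop (map letter_pair w) * e.
    case: w hp hw => [|[a1|b1] w] //= _ _.
    by rewrite /word_path big_nil mulg1 mul1g.
  by rewrite -!mulgA -hw !mulgA.
- have {hp}hw : word_path w = loop (map letter_pair w).
    by case: w hp hw => [|[a1|b1] w].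
  by rewrite hw !mulgA.
Qed.

Lemma word_path_relator c : c \in C -> word_path c === 1.
Proof.
move=> hc; have [halt hnt hlen _] := hC.
have cw : cyclic_words C c by exists c => //; exists 0; left; rewrite rot0.
have := halt _ cw => hcyc.
have hs : sorted (fun x y => ~~ same_factor x y) c.
  by case: c hcyc {hc cw} => //= x c; rewrite rcons_path => /andP[].
have ho := cycle_even hcyc.
have := word_path_alternating ho hs; have := loop_relator hc.
case: c {hc cw hcyc hs ho} => [|[a|b] c] h hl; rewrite ?hl //.
apply: (eqv_trans (w2 := e * (e * word_path (inl a :: c)))).
  by apply: eqv_sym; have := eqv_edge_mul 1 (word_path (inl a :: c)); rewrite !mul1g !mulgA.
rewrite hl mulgA; apply: (eqv_trans (w2 := e * e)) => //.
by apply: eqvM => //; rewrite -{2}[e]mulg1; exact: eqvM.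
Qed.

(** The elements whose path is equivalent to [1] form a normal subgroup
    containing the relators. *)
Theorem normal_closure_path_trivial w :
  normal_closure (relator_set C) (wprod w) -> word_path w === 1.
Proof.
pose N : set F := fun g => word_path (fp_word g) === 1.
have N1 : N 1 by rewrite /N /= /word_path big_nil.
have NM g h : N g -> N h -> N (g * h).
  move=> hg hh; apply: eqv_trans (word_path_mul g h) _.
  by rewrite -[1]mulg1; exact: eqvM.
have inv_eq (g : F) : word_path (g^-1 : F) * word_path g === 1.
  by apply: eqv_trans (eqv_sym (word_path_mul _ _)) _; rewrite mulVg.
have NJ g h : N g -> N (g ^ h).
  move=> hg; apply: eqv_trans (word_path_mul _ _) _.
  apply: eqv_trans (inv_eq h); apply: eqvM => //.
  apply: eqv_trans (word_path_mul _ _) _.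
  by rewrite -[X in _ === X]mul1g; exact: eqvM.
have NV g : N g -> N g^-1.
  move=> hg; apply: eqv_trans (inv_eq g).
  by rewrite -[X in X === _]mulg1; apply: eqvM => //; apply: eqv_sym.
have hN : normal_subgroup N by split=> //; split=> // g h hg /NV; exact: NM.
move=> /(_ N) h; apply: eqv_trans (eqv_sym (word_path_prod w)) _; apply: h.
split=> // g [c hc ->].
exact: eqv_trans (word_path_prod c) (word_path_relator hc).
Qed.

(** The path of a letter of [A] has no edge, so no rule applies to it. *)
Theorem left_factor_embeds a :
  normal_closure (relator_set C) (fp_letter (inl a)) -> a = 1.
Proof.
have -> : fp_letter (inl a) = wprod [:: inl a] by rewrite /wprod big_seq1.
move=> /normal_closure_path_trivial/path_eqv_trivial.
by rewrite /word_path big_seq1 => /path_trivial_vtx[].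
Qed.

Theorem right_factor_embeds b :
  normal_closure (relator_set C) (fp_letter (inr b)) -> b = 1.
Proof.
have -> : fp_letter (inr b) = wprod [:: inr b] by rewrite /wprod big_seq1.
move=> /normal_closure_path_trivial; rewrite /word_path big_seq1 /= => h.
suff /path_eqv_trivial/path_trivial_vtx[] : vtx (letter_pair (inr b)) === 1 by [].
set v := vtx _ in h *.
apply: (eqv_trans (w2 := e * (e * v * e) * e)).
  apply: eqv_sym; rewrite !mulgA -[X in _ === X]mul1g.
  apply: (eqv_trans (w2 := 1 * e * e * v)); last exact: eqv_edge_mul.
  by have := eqv_edge_mul (e * e * v) 1; rewrite !mulg1 mul1g.
apply: (eqv_trans (w2 := e * 1 * e)); last by rewrite mulg1.
by do 2 apply: eqvM => //.
Qed.

End Quotient.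
End FreeProductWords.

(** * Values of paths under partial homomorphisms *)

(** The map [fU s] is multiplicative only when the lengths of the factors add up to
    at most [J].  The Boolean [s] is the parity of the number of edges passed, which
    tells the two ends of the edge, and hence the two factors, apart. *)
Section PathValue.
Variables (U Q : groupType) (J : nat) (lU : U -> nat) (fU : bool -> U -> Q).
Hypothesis lU1 : lU 1 = 0.
Hypothesis lUM : forall u v, (lU (u * v)%g <= lU u + lU v)%N.
Hypothesis lUV : forall u, lU u^-1 = lU u.
Hypothesis fU1 : forall s, fU s 1 = 1.
Hypothesis fUM : forall s u v, (lU u + lU v <= J)%N -> fU s (u * v) = fU s u * fU s v.
Local Notation P := (gpath U).
Implicit Types (x y z : P) (u v : U) (s : bool).

Definition path_weight x : nat := (\sum_(u <- x.1) lU u + lU x.2)%N.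

Fixpoint phase_value s (l : seq U) : Q :=
  if l is u :: l' then fU s u * phase_value (~~ s) l' else 1.

Definition path_value s x := phase_value s (rcons x.1 x.2).

Lemma label_valueV s u : (2 * lU u <= J)%N -> fU s u^-1 = (fU s u)^-1.
Proof.
move=> h; have := @fUM s u^-1 u; rewrite lUV mulVg fU1 => e.
by apply: (@mulIg _ (fU s u)); rewrite mulVg -e //; lia.
Qed.

Lemma path_weightM x y : (path_weight (x * y)%g <= path_weight x + path_weight y)%N.
Proof.
case: x y => [s u] [[|c t] v]; rewrite gpath_mulE /gpath_mul /path_weight /=.
  by rewrite big_nil; have := lUM u v; lia.
by rewrite big_cat !big_cons /=; have := lUM u c; lia.
Qed.

Lemma path_weight_mul1 x y : x.2 = 1 -> path_weight (x * y) = (path_weight x + path_weight y)%N.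
Proof.
case: x y => [s u] [[|c t] v] /= ->; rewrite gpath_mulE /gpath_mul /path_weight /=.
  by rewrite big_nil mul1g lU1; lia.
by rewrite big_cat !big_cons /= mul1g lU1; lia.
Qed.

Lemma path_weight_1mul x y t v : y = (1 :: t, v) -> path_weight (x * y) = (path_weight x + path_weight y)%N.
Proof.
move=> ->; case: x => [s u]; rewrite gpath_mulE /gpath_mul /path_weight /=.
by rewrite big_cat !big_cons /= mulg1 lU1; lia.
Qed.

Lemma path_weightV x : path_weight x^-1 = path_weight x.
Proof.
case: x => [[|c l] u]; rewrite gpath_invE /gpath_inv /path_weight /=.
  by rewrite lUV.
have e : (\sum_(v <- rev (map (@monoid.inv U) l)) lU v = \sum_(v <- l) lU v)%N.
  rewrite (perm_big (map (@monoid.inv U) l)) ?perm_rev // big_map.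
  by apply: eq_bigr => v _; rewrite lUV.
by rewrite !big_cons e !lUV; lia.
Qed.

Lemma path_valueM s x y : (path_weight x + path_weight y <= J)%N ->
  path_value s (x * y) = path_value s x * path_value (s (+) odd (gpath_len x)) y.
Proof.
case: x => [l u]; elim: l s => [|c l IH] s.
  rewrite addbF; case: y => [[|d t] v]; rewrite /path_weight /path_value gpath_mulE /gpath_mul /= !big_nil.
    by move=> h; rewrite !mulg1 fUM //; lia.
  by rewrite big_cons => h; rewrite fUM ?mulg1 ?mulgA //; lia.
have -> : ((c :: l, u) : P) * y = ((c :: (((l, u) : P) * y).1, (((l, u) : P) * y).2) : P).
  by rewrite !gpath_mulE /gpath_mul /=; case: y.1.
move=> h; rewrite /path_value /= -/(path_value (~~ s) (((l, u) : P) * y)) -/(path_value (~~ s) (l, u)) IH.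
  rewrite mulgA; congr (_ * path_value _ y).
  by rewrite /gpath_len /=; case: s (odd _) => [] [].
by move: h; rewrite /path_weight /= big_cons; lia.
Qed.

Lemma path_valueV s x : (2 * path_weight x <= J)%N ->
  path_value (s (+) odd (gpath_len x)) x^-1 = (path_value s x)^-1.
Proof.
case: x => [l u]; elim: l s => [|c l IH] s.
  rewrite addbF /path_weight /path_value gpath_invE /gpath_inv /= big_nil !mulg1 => h.
  by rewrite label_valueV //; lia.
have -> : ((c :: l, u) : P) = vtx c * edge U * ((l, u) : P).
  by rewrite !gpath_mulE /gpath_mul /=; case: l {IH} => [|d l]; rewrite /= ?mul1g ?mulg1.
have hv : path_weight (vtx c) = lU c by rewrite /path_weight big_nil.
have he : path_weight (edge U) = 0 by rewrite /path_weight big_seq1 /= lU1.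
have hc : path_weight (vtx c * edge U) = lU c by rewrite (path_weight_1mul _ (t := [::]) (v := 1)) // hv he addn0.
have hw : path_weight (vtx c * edge U * ((l, u) : P)) = (lU c + path_weight ((l, u) : P))%N by rewrite path_weight_mul1 // hc.
move=> h; rewrite hw in h.
set w := vtx c * edge U in hc hw *; set x' : P := (l, u) in IH h hw *.
have h1 : path_value s (w * x') = path_value s w * path_value (~~ s) x'.
  rewrite path_valueM; last by rewrite hc; lia.
  by rewrite /w gpath_lenM /= addbT.
have h2 b : path_value b (w * x')^-1 = path_value b x'^-1 * path_value (b (+) odd (gpath_len x')) w^-1.
  by rewrite invgM path_valueM ?gpath_lenV // !path_weightV hc; lia.
have h3 b : path_value (~~ b) w^-1 = (path_value b w)^-1.
  have ew : w^-1 = edge U * vtx c^-1 by rewrite invgM edgeV.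
  have hcv : path_weight (vtx c^-1) = lU c by rewrite /path_weight big_nil /= lUV.
  rewrite ew path_valueM; last by rewrite he hcv; lia.
  rewrite /w path_valueM; last by rewrite hv he; lia.
  by rewrite /path_value /= !fU1 !mulg1 mul1g addbT negbK label_valueV //; lia.
have ho : s (+) odd (gpath_len (w * x')) = ~~ s (+) odd (gpath_len x').
  by rewrite gpath_lenM oddD /w gpath_lenM /=; case: (s) (odd _) => [] [].
rewrite h1 ho h2 [in RHS]invgM IH; last by lia.
by rewrite -addbA addbb addbF h3.
Qed.

Lemma path_weight_loop Y : path_weight (loop Y) = \sum_(u <- Y) lU u.
Proof.
have -> z : path_weight z = \sum_(u <- rcons z.1 z.2) lU u.
  by rewrite -cats1 big_cat big_seq1.
by rewrite /= -lastI big_cons lU1.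
Qed.

(** A loop begins with an edge, so its labels start in the other phase. *)
Lemma path_value_loop s Y : path_value s (loop Y) = phase_value (~~ s) Y.
Proof. by rewrite /path_value /= -lastI /= fU1 mul1g. Qed.

Lemma path_weight_edge : path_weight (edge U) = 0. Proof. by rewrite /path_weight big_seq1 /= lU1. Qed.
Lemma path_value_edge s : path_value s (edge U) = 1. Proof. by rewrite /path_value /= !fU1 !mulg1. Qed.

Section Rule.
Variables (cyc : seq U -> Prop) (m : nat).
Hypothesis cycSC : cyclic_small_cancellation cyc.
Hypothesis cyc_even : forall Y, cyc Y -> ~~ odd (size Y).
Hypothesis cyc_wt : forall Y, cyc Y -> (\sum_(u <- Y) lU u <= m)%N.
Hypothesis cyc_value : forall s Y, cyc Y -> phase_value s Y = 1.

(** A rule replaces part of a path by something of weight at most [m], and the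
    relators have even length, so the phase of what follows does not change.  The
    labels at the two ends of the replaced part are first moved out of it, since the
    rule may split them arbitrarily, into factors of large weight. *)
Lemma path_step_value w w' : path_step cyc w w' -> (path_weight w + 2 * m <= J)%N ->
  (path_weight w' <= path_weight w + m)%N /\ path_value true w' = path_value true w.
Proof.
move=> /path_stepE[x [s [t [y [[[a ha [es et]]|[hR hlt]] ew ew']]]]] hJ.
  case: a ha es => [[|c [|d l]] u] // _ es.
  (* Cancelling [u e e u^-1]: the labels around the two edges go to [x0], [y0]. *)
  pose x0 := x * vtx c; pose y0 := vtx c^-1 * y.
  have ew1 : w = x0 * edge U * (edge U * y0).
    have es' : s = vtx c * edge U * edge U * vtx c^-1.
      rewrite es gpath_invE !gpath_mulE /gpath_inv /gpath_mul /=.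
      by rewrite mulgV !mul1g !mulg1.
    by rewrite ew es' /x0 /y0 !mulgA.
  have ew2 : w' = x0 * y0.
    rewrite ew' et mulg1 /x0 /y0 -mulgA; congr (_ * _).
    by rewrite mulgA -vtxM mulgV mul1g.
  have hw : path_weight w = (path_weight x0 + path_weight y0)%N.
    have hey : path_weight (edge U * y0) = path_weight y0 by rewrite path_weight_mul1 // path_weight_edge.
    have hex : path_weight (x0 * edge U) = path_weight x0.
      by rewrite (@path_weight_1mul _ _ [::] 1) // path_weight_edge addn0.
    by rewrite ew1 path_weight_mul1 ?hey ?hex // gpath_mulE /gpath_mul /=.
  split; first by rewrite ew2 hw; apply: leq_trans (path_weightM _ _) (leq_addr _ _).
  have hey : path_weight (edge U * y0) = path_weight y0 by rewrite path_weight_mul1 // path_weight_edge.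
  have hex : path_weight (x0 * edge U) = path_weight x0.
    by rewrite (@path_weight_1mul _ _ [::] 1) // path_weight_edge addn0.
  have e1 : path_value true (x0 * edge U) = path_value true x0.
    by rewrite path_valueM ?path_value_edge ?mulg1 // path_weight_edge; lia.
  have e2 b : path_value b (edge U * y0) = path_value (~~ b) y0.
    by rewrite path_valueM ?path_value_edge ?mul1g ?addbT // path_weight_edge; lia.
  rewrite ew2 ew1 path_valueM; last by lia.
  rewrite path_valueM; last by rewrite hey hex; lia.
  by rewrite e1 e2 gpath_lenM oddD /=; case: (odd (gpath_len x0)).
have [c [l [v es]]] : exists c l v, s = vtx c * ((1 :: l, 1) : P) * vtx v.
  case: s hlt {hR ew} => [[|c l] v] // _; exists c, l, v.
  by rewrite !gpath_mulE /gpath_mul /= mulg1 mul1g.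
set s0 : P := (1 :: l, 1) in es.
pose t0 : P := vtx c^-1 * t * vtx v^-1; pose x0 : P := x * vtx c; pose y0 : P := vtx v * y.
have et : t = vtx c * t0 * vtx v.
  by rewrite /t0 !mulgA -vtxM mulgV mul1g -mulgA -vtxM mulVg mulg1.
have ew1 : w = x0 * s0 * y0 by rewrite ew es /x0 /y0 !mulgA.
have ew2 : w' = x0 * t0 * y0 by rewrite ew' et /x0 /y0 !mulgA.
have [Y hY eY] : exists2 Y, cyc Y & s0 * t0^-1 = loop Y.
  have /(gpath_rel_rot cycSC) : gpath_rel cyc (vtx c * (s0 * t0^-1 * vtx c^-1)).
    move: hR; rewrite es et !invgM -vtxV -vtxV !mulgA.
    by rewrite -(mulgA _ (vtx v)) -vtxM mulgV mulg1.
  rewrite -!mulgA -vtxM mulVg mulg1 => -[Y [u [hY e]]]; exists Y => //.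
  have hs := congr1 (take 1) (congr1 fst e).
  rewrite gpath_rel_fst in hs.
  have := gpath_take s0 t0^-1; rewrite /gpath_len /= => e2.
  have eu : u = 1.
    have := congr1 (take 1) e2; rewrite take_takel // hs /=.
    have [_ _ _ hlen _] := cycSC; have := hlen _ hY.
    by case: (Y) => // y1 Y' _ [].
  by rewrite e eu invg1 vtx1 mul1g mulg1.
have hwY : (path_weight s0 + path_weight t0 <= m)%N.
  by rewrite -(path_weightV t0) -path_weight_mul1 // eY path_weight_loop; exact: cyc_wt.
have hw : path_weight w = (path_weight x0 + path_weight s0 + path_weight y0)%N.
  by rewrite ew1 path_weight_mul1 ?(@path_weight_1mul _ s0 l 1) // gpath_mulE /gpath_mul /=.
have ht : odd (gpath_len s0) = odd (gpath_len t0).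
  have := cyc_even hY; rewrite -loop_len -eY gpath_lenM gpath_lenV oddD.
  by case: (odd (gpath_len s0)) (odd (gpath_len t0)) => [] [].
have hs0 : (path_weight (x0 * s0)%g <= path_weight x0 + path_weight s0)%N by exact: path_weightM.
have ht0 : (path_weight (x0 * t0)%g <= path_weight x0 + path_weight t0)%N by exact: path_weightM.
split.
  have : (path_weight w' <= path_weight (x0 * t0)%g + path_weight y0)%N by rewrite ew2; exact: path_weightM.
  by rewrite hw; lia.
have hev b : path_value b s0 = path_value b t0.
  apply: (@mulIg _ (path_value b t0)^-1); rewrite mulgV -path_valueV; last by lia.
  by rewrite -ht -path_valueM ?path_weightV ?eY ?path_value_loop ?cyc_value //; lia.
have hE (r : P) : (path_weight x0 + path_weight r + path_weight y0 <= J)%N -> path_value true (x0 * r * y0) =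
    path_value true x0 * path_value (true (+) odd (gpath_len x0)) r *
    path_value (true (+) odd (gpath_len x0) (+) odd (gpath_len r)) y0.
  move=> h; have hr : (path_weight (x0 * r)%g <= path_weight x0 + path_weight r)%N by exact: path_weightM.
  rewrite path_valueM; last by lia.
  rewrite path_valueM; last by lia.
  by rewrite gpath_lenM oddD addbA.
by rewrite ew1 ew2 !hE ?ht ?hev //; lia.
Qed.

(** Each step shortens the path by at least one edge and adds at most [m] to its
    weight, so the weight stays within [J] up to the end of the reduction. *)
Lemma path_trivial_value w : path_trivial cyc w ->
  (path_weight w + m * (gpath_len w + 2) <= J)%N -> path_value true w = 1.
Proof.
rewrite /path_trivial /dehn_trivial; move e1: 1 => v h; elim: h e1 => [{}w <- _|].
  by rewrite /path_value /= fU1 mulg1.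
move=> {}w w1 {}v hs _ IH e1 hJ.
have hl := @step_len P (@gpath_len U) (@gpath_lenM U) (@gpath_lenV U) _ _ _ hs.
have hJ' : (path_weight w + 2 * m <= J)%N.
  by move: hJ; rewrite mulnDr; have := leq0n (m * gpath_len w); lia.
have [h1 <-] := path_step_value hs hJ'; apply: IH => //.
have : (m * (gpath_len w1).+1 <= m * gpath_len w)%N by rewrite leq_mul2l hl orbT.
by move: hJ; rewrite !mulnDr mulnS; lia.
Qed.

End Rule.
End PathValue.

(** * Partial homomorphisms on the factors *)
Section PartialMorphisms.
Variables A B : groupType.
Local Notation L := (A + B)%type.
Local Notation U := (factor_pair A B).
Variables (lA : A -> nat) (lB : B -> nat).
Hypothesis lA1 : lA 1 = 0.
Hypothesis lAM : forall a b, (lA (a * b)%g <= lA a + lA b)%N.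
Hypothesis lAV : forall a, lA a^-1 = lA a.
Hypothesis lB1 : lB 1 = 0.
Hypothesis lBM : forall a b, (lB (a * b)%g <= lB a + lB b)%N.
Hypothesis lBV : forall a, lB a^-1 = lB a.
Variables (Q : groupType) (fA : A -> Q) (fB : B -> Q) (J : nat).
Hypothesis fA1 : fA 1 = 1.
Hypothesis fAM : forall a b, (lA a + lA b <= J)%N -> fA (a * b) = fA a * fA b.
Hypothesis fB1 : fB 1 = 1.
Hypothesis fBM : forall a b, (lB a + lB b <= J)%N -> fB (a * b) = fB a * fB b.
Implicit Types (w Y : seq L).

Definition letter_len (x : L) : nat := match x with inl a => lA a | inr b => lB b end.
Definition letter_value (x : L) : Q := match x with inl a => fA a | inr b => fB b end.
Definition word_len w : nat := (\sum_(x <- w) letter_len x)%N.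
Definition word_value w : Q := \prod_(x <- w) letter_value x.

Definition pair_len (u : U) : nat := (lA u.1 + lB u.2)%N.
Definition pair_value (s : bool) (u : U) : Q := if s then fA u.1 else fB u.2.

Lemma pair_len1 : pair_len 1 = 0. Proof. by rewrite /pair_len lA1 lB1. Qed.

Lemma pair_lenM u v : (pair_len (u * v)%g <= pair_len u + pair_len v)%N.
Proof.
by apply: leq_trans (leq_add (lAM u.1 v.1) (lBM u.2 v.2)) _; rewrite /pair_len; lia.
Qed.

Lemma pair_lenV u : pair_len u^-1 = pair_len u.
Proof. by rewrite /pair_len /= lAV lBV. Qed.

Lemma pair_value1 s : pair_value s 1 = 1. Proof. by case: s => /=. Qed.

Lemma pair_valueM s u v : (pair_len u + pair_len v <= J)%N ->
  pair_value s (u * v) = pair_value s u * pair_value s v.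
Proof. by rewrite /pair_len => h; case: s; rewrite /= ?fAM ?fBM //; lia. Qed.

Lemma letter_valueV (x : L) : (2 * letter_len x <= J)%N ->
  letter_value (letter_inv x) = (letter_value x)^-1.
Proof.
case: x => a /= h.
- apply: (@mulIg _ (fA a)); rewrite mulVg -fAM ?mulVg // lAV; lia.
- apply: (@mulIg _ (fB a)); rewrite mulVg -fBM ?mulVg // lBV; lia.
Qed.

Lemma word_len_winv w : word_len (winv w) = word_len w.
Proof.
rewrite /word_len /winv (perm_big (map (@letter_inv A B) w)) ?perm_rev // big_map.
by apply: eq_bigr => -[a|b] _ /=; rewrite ?lAV ?lBV.
Qed.

Lemma word_value_winv w : (2 * word_len w <= J)%N -> word_value (winv w) = (word_value w)^-1.
Proof.
rewrite /word_value; elim: w => [|x w IH]; first by rewrite !big_nil invg1.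
rewrite /word_len big_cons -/(word_len w) => h.
rewrite /winv /= rev_cons -cats1 big_cat big_seq1 /= -/(winv w) IH; last by lia.
by rewrite big_cons invgM letter_valueV //; lia.
Qed.

Lemma word_value_rot n w : word_value w = 1 -> word_value (rot n w) = 1.
Proof.
rewrite -{1}(cat_take_drop n w) /word_value /rot !big_cat /= => h.
by rewrite -[X in X * _](mulKg (\prod_(x <- take n w) letter_value x)) h mulg1 mulVg.
Qed.

Section Relators.
Variable C : seq (seq L).
Hypothesis hC : word_small_cancellation C.
Variable m : nat.
Hypothesis hm : forall c, c \in C -> (word_len c <= m)%N.
Hypothesis hmJ : (2 * m <= J)%N.
Hypothesis fC : forall c, c \in C -> word_value c = 1.

Lemma cyclic_word_len Y : cyclic_words C Y -> (word_len Y <= m)%N.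
Proof.
have hrot n w : word_len (rot n w) = word_len w.
  by rewrite /word_len (perm_big w) // perm_rot.
by move=> [c hc [n [->|->]]]; rewrite hrot ?word_len_winv; exact: hm.
Qed.

Lemma cyclic_word_value Y : cyclic_words C Y -> word_value Y = 1.
Proof.
move=> [c hc [n [->|->]]]; apply: word_value_rot; first exact: fC.
by rewrite word_value_winv ?fC ?invg1 //; have := hm hc; lia.
Qed.

(** A label coming from the factor that is not read in the current phase is
    trivial in the coordinate that is read.  So the value of an alternating word is
    found in one of the two phases, and it is [1] in the other. *)
Lemma phase_value_alternating s w : sorted (fun x y => ~~ same_factor x y) w ->
  phase_value pair_value s (map (@letter_pair A B) w) =
  if w is x :: _ then
    if s == (if x is inl _ then true else false) then word_value w else 1
  else 1.
Proof.
elim: w s => // x [|y w] IH s hs.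
  by rewrite /word_value big_seq1 /= mulg1; case: x s {hs} => a [] /=.
have /andP[hxy hp] : ~~ same_factor x y && path (fun x y => ~~ same_factor x y) y w by [].
have := IH (~~ s) hp; rewrite [map _ (x :: _)]/= => e.
rewrite [LHS](_ : _ = pair_value s (letter_pair x) *
  phase_value pair_value (~~ s) (map (@letter_pair A B) (y :: w))) // e.
have -> : word_value (x :: y :: w) = letter_value x * word_value (y :: w).
  by rewrite /word_value big_cons.
by case: x y s hxy {IH hs hp e} => [a|b] [a'|b'] [] //= _; rewrite ?mulg1 ?fA1 ?fB1 ?mul1g.
Qed.

Lemma phase_value_relator s (Y : seq U) : pair_words C Y -> phase_value pair_value s Y = 1.
Proof.
move=> [w hw ->]; have [halt _ _ _] := hC.
rewrite phase_value_alternating; last first.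
  by case: w hw => // x w /halt; rewrite /= rcons_path => /andP[].
case: w hw => // x w hw; case: ifP => // _; exact: cyclic_word_value.
Qed.

Lemma letter_path_size (x : L) : [/\ (path_weight pair_len (letter_path x) <= letter_len x)%N,
  (gpath_len (letter_path x) <= 2)%N & ~~ odd (gpath_len (letter_path x))].
Proof.
case: x => a; rewrite /path_weight /letter_path.
  by rewrite big_nil /pair_len /= lB1; split=> //; lia.
have -> : edge U * vtx (letter_pair (inr a)) * edge U = ([:: 1; (1, a)], 1).
  by rewrite !gpath_mulE /gpath_mul /= mul1g mulg1.
by rewrite !big_cons big_nil pair_len1 /pair_len /= lA1; split=> //; lia.
Qed.

Lemma word_path_size w : (path_weight pair_len (word_path w) <= word_len w)%N /\
  (gpath_len (word_path w) <= 2 * size w)%N.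
Proof.
rewrite /word_len; elim: w => [|x w [IH1 IH2]].
  by rewrite /word_path !big_nil /path_weight big_nil pair_len1.
rewrite /word_path !big_cons -/(word_path w) /=.
have [h1 h2 _] := letter_path_size x.
split.
  have h := path_weightM pair_len1 pair_lenM (letter_path x) (word_path w).
  by apply: leq_trans h _; apply: leq_add.
by rewrite gpath_lenM; lia.
Qed.

Lemma word_path_value w : (word_len w <= J)%N ->
  path_value pair_value true (word_path w) = word_value w.
Proof.
elim: w => [|x w IH] hJ.
  by rewrite /word_path /word_value !big_nil /path_value /= fA1 mulg1.
have {hJ}hJ : (letter_len x + word_len w <= J)%N by move: hJ; rewrite /word_len big_cons.
have [h1 _ h3] := letter_path_size x; have [h4 _] := word_path_size w.
rewrite /word_path /word_value !big_cons -/(word_path w) -/(word_value w).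
rewrite (path_valueM pair_len1 pair_valueM); last by lia.
rewrite (negbTE h3) /= IH; last by lia.
congr (_ * _); case: x {hJ h1 h3} => a; first by rewrite /path_value /= mulg1.
have -> : letter_path (inr a) = ([:: 1; (1, a)], 1) :> gpath U.
  by rewrite /letter_path !gpath_mulE /gpath_mul /= mul1g mulg1.
by rewrite /path_value /= fA1 !mulg1 mul1g.
Qed.

(** The word becomes a path of at most [2 * size w] edges, which
    Dehn's algorithm reduces to [1] without changing its value. *)
Theorem lift_relation w : normal_closure (relator_set C) (wprod w) ->
  (word_len w + m * (2 * size w + 2) <= J)%N -> word_value w = 1.
Proof.
move=> /(normal_closure_path_trivial hC)/path_eqv_trivial htriv hJ.
have [hwt hlen] := word_path_size w.
rewrite -word_path_value; last by lia.
apply: (path_trivial_value pair_len1 pair_lenM pair_lenV pair_value1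
  pair_valueM (pair_words_small_cancellation hC) _ _ _ htriv).
- by move=> Y [v hY ->]; have [halt _ _ _] := hC; rewrite size_map; apply/cycle_even/halt.
- move=> Y [v hY ->]; rewrite big_map; apply: leq_trans (cyclic_word_len hY).
  rewrite leq_eqVlt; apply/orP; left; apply/eqP; apply: eq_bigr => -[a|b] _.
    by rewrite /pair_len /= lB1 addn0.
  by rewrite /pair_len /= lA1.
- by move=> s Y; exact: phase_value_relator.
- apply: leq_trans hJ; apply: leq_add hwt _.
  by rewrite leq_mul2l leq_add2r hlen orbT.
Qed.

End Relators.
End PartialMorphisms.

(** * Presentation by finitely many alternating cyclic words *)
Section Presentation.
Variables A B : groupType.
Local Notation L := (A + B)%type.
Local Notation F := (free_product A B).
Local Notation alt := (fun x y : L => ~~ same_factor x y).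
Local Notation nontriv := (fun x : L => ~~ trivial_letter x).
Implicit Types (x y z : L) (c w Y s t u v : seq L).

Lemma fp_word_wprod w : normal_form w -> fp_word (wprod w) = w.
Proof. by move=> hw; rewrite /wprod -(fp_word_prod (FreeProduct hw)). Qed.

Lemma wprod_cat s t : wprod (s ++ t) = wprod s * wprod t.
Proof. by rewrite /wprod big_cat. Qed.

Lemma wprod_cons x t : wprod (x :: t) = fp_letter x * wprod t.
Proof. by rewrite /wprod big_cons. Qed.

Lemma wprod1 x : wprod [:: x] = fp_letter x.
Proof. by rewrite /wprod big_seq1. Qed.

Lemma fp_letter1l : fp_letter (inl 1) = 1 :> F.
Proof. by apply: val_inj; rewrite /= /letter_act /= eqxx. Qed.

Lemma fp_letter1r : fp_letter (inr 1) = 1 :> F.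
Proof. by apply: val_inj; rewrite /= /letter_act /= eqxx. Qed.

Lemma fp_letterV x : fp_letter (letter_inv x) = (fp_letter x)^-1.
Proof.
case: x => a /=.
- by apply: (@mulIg _ (fp_letter (inl a))); rewrite -fp_letter_inlM !mulVg fp_letter1l.
- by apply: (@mulIg _ (fp_letter (inr a))); rewrite -fp_letter_inrM !mulVg fp_letter1r.
Qed.

Lemma wprod_winv w : wprod (winv w) = (wprod w)^-1.
Proof.
elim: w => [|x w IH]; first by rewrite /wprod /winv big_nil invg1.
by rewrite /winv /= rev_cons -cats1 wprod_cat wprod1 -/(winv w) IH wprod_cons invgM fp_letterV.
Qed.

Lemma fp_letter_neq1 x : nontriv x -> fp_letter x <> 1.
Proof.
by move=> /negbTE hx /(congr1 (@fp_word A B)) /=; rewrite /letter_act hx.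
Qed.

Lemma fp_letter_mul x y : same_factor x y ->
  fp_letter (letter_mul x y) = fp_letter x * fp_letter y.
Proof. by case: x y => [a|a] [b|b] //= _; [exact: fp_letter_inlM | exact: fp_letter_inrM]. Qed.

Lemma alt_mul_neq1 x y : nontriv x -> nontriv y -> alt x y -> fp_letter x * fp_letter y <> 1.
Proof.
move=> hx hy hxy; have hn : normal_form [:: x; y] by rewrite /normal_form /= hx hy hxy.
rewrite -(wprod1 y) -wprod_cons => /(congr1 (@fp_word A B)).
by rewrite fp_word_wprod.
Qed.

Lemma cycle_normal Y : cycle alt Y -> all nontriv Y -> normal_form Y.
Proof.
move=> hc ha; rewrite /normal_form ha /=.
by case: Y hc {ha} => // x Y; rewrite /= rcons_path => /andP[].
Qed.

Lemma cycle_weakly_reduced Y : cycle alt Y -> all nontriv Y ->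
  weakly_cyclically_reduced (wprod Y).
Proof.
move=> hc ha; right => y1 s; rewrite fp_word_wprod; last exact: cycle_normal.
move=> eY; rewrite eY in hc ha; apply: alt_mul_neq1.
- by have /allP := ha; apply; exact: mem_last.
- by have /andP[] := ha.
- by move: hc; rewrite /= rcons_path => /andP[].
Qed.

Lemma alt_winv Y : cycle alt Y -> cycle alt (winv Y).
Proof.
rewrite /winv rev_cycle cycle_map => h.
by apply: sub_cycle h => x y /=; case: x y => [?|?] [?|?].
Qed.

Lemma nontriv_winv Y : all nontriv Y -> all nontriv (winv Y).
Proof.
by rewrite /winv all_rev all_map; apply: sub_all; case=> a /=; rewrite invg_eq1.
Qed.

(** For a weakly cyclically reduced word only the first and the last letter can
    lie in one factor; they are then merged into one letter. *)
Definition cyclic_reduction w : seq L :=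
  if w is x :: s then
    if rev s is y :: s' then
      if same_factor y x then letter_mul y x :: rev s' else w
    else w
  else w.

Lemma cyclic_reductionP (r : F) : weakly_cyclically_reduced r -> (1 < fp_length r)%N ->
  [/\ cycle alt (cyclic_reduction r), all nontriv (cyclic_reduction r) &
    exists g, wprod (cyclic_reduction r) = r ^ g].
Proof.
move=> [|hwcr] hl; first by lia.
move: hwcr hl (fp_wordP r) (wprod_word r); rewrite /fp_length.
move: (fp_word r) => w; case: w => [|x s] //= hw.
case/lastP: s hw => [|s y] // hw _ hn er.
have {hw}hw : fp_letter y * fp_letter x <> 1 by have := hw _ _ erefl; rewrite last_rcons.
move: hn; rewrite /normal_form /= all_rcons rcons_path => /andP[/and3P[hx hy hs] /andP[hp hl]].
rewrite rev_rcons revK; case: ifP => hf.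
  have hm : nontriv (letter_mul y x).
    apply/negP => ht; apply: hw; rewrite -fp_letter_mul //.
    by apply: val_inj; rewrite /= /letter_act ht.
  split.
  - case: s hp hl {hs er} => [|z s] /=; last first.
      move=> /andP[h1 h2] h3; rewrite rcons_path h2 /=; apply/andP; split.
        by case: x y z hf h1 {hx hy hw hm h2 h3} => [?|?] [?|?] [?|?].
      by move: (last z s) h3 => u h3; case: x y u hf h3 {hx hy hw hm h1 h2} => [?|?] [?|?] [?|?].
    by move=> _ h; case: x y hf h {hx hy hw hm} => [?|?] [?|?].
  - by apply/andP; split; [exact: hm | exact: hs].
  - exists (fp_letter y)^-1; rewrite -er wprod_cons fp_letter_mul // /conjg invgK.
    by rewrite wprod_cons -cats1 wprod_cat wprod1 !mulgA mulgK.
split.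
- rewrite /= !rcons_path hp hl last_rcons /= hf //.
- by rewrite /= all_rcons hx hy hs.
- by exists 1; rewrite conjg1 er.
Qed.

Lemma normal_closure_sub (G : groupType) (X Z : set G) :
  (forall g, X g -> normal_closure Z g) -> forall g, normal_closure X g -> normal_closure Z g.
Proof. by move=> h g; apply; split; [exact: normal_closure_normal | exact: h]. Qed.

Lemma normal_closure_gen (G : groupType) (X : set G) (x : G) : X x -> normal_closure X x.
Proof. by move=> h N [_]; apply. Qed.

Lemma normal_closureJ (G : groupType) (X : set G) (x g : G) :
  normal_closure X x -> normal_closure X (x ^ g).
Proof. by have [_ h] := normal_closure_normal X; exact: h. Qed.

Lemma normal_cat u v : normal_form (u ++ v) -> normal_form u /\ normal_form v.
Proof.
rewrite /normal_form all_cat => /andP[/andP[-> ->] h] /=.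
case: u h => [|x u] //=; rewrite cat_path => /andP[-> h]; split=> //.
exact: path_sorted h.
Qed.

Lemma semi_reduced_cat u v : normal_form (u ++ v) -> semi_reduced (wprod u) (wprod v).
Proof.
move=> hn s y x t; have [hu hv] := normal_cat hn.
rewrite !fp_word_wprod // => eu ev; move: hn; rewrite eu ev cat_rcons /normal_form.
rewrite all_cat /= => /andP[/and4P[_ hy hx _] h]; apply: alt_mul_neq1 => //.
case: s h {eu} => [|z s] /=; first by case/andP.
by rewrite cat_path /= => /and4P[].
Qed.

Section Relators.
Variable rels : set F.
Hypothesis hfin : fin_gen_symmetrized rels.
Hypothesis hsc : small_cancellation (1 / 6%:R)%R rels.

Lemma rels_length (r : F) : rels r -> (6 < fp_length r)%N.
Proof.
by have [_ h _] := hsc; move=> /h; rewrite GRing.div1r GRing.invrK Num.Theory.ltr_nat.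
Qed.

Lemma rels_piece (r b c : F) : rels r -> r = b * c -> semi_reduced b c -> piece rels b ->
  (6 * fp_length b < fp_length r)%N.
Proof.
have [_ _ h] := hsc; move=> h1 h2 h3 h4; have := h _ _ _ h1 h2 h3 h4.
rewrite GRing.div1r Num.Theory.ltr_pdivlMl; last by rewrite Num.Theory.ltr0n.
by rewrite -GRing.natrM Num.Theory.ltr_nat.
Qed.

(** The words are the cyclic reductions of a finite set generating the
    symmetrized set.  For the overlap condition let [s] be a common part of two
    distinct cyclic words, preceded in them by the letters [y0] and [z0].  These lie
    in the same factor.  Conjugating the second relator by [z0 * y0^-1] splits
    [z0], and yields a weakly cyclically reduced relator that begins with [y0].  So
    [y0 :: s] is a piece, and this is why one more letter than in [s] is
    counted. *)
Lemma presentation_words : exists C : seq (seq L), word_small_cancellation C /\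
  (forall g, normal_closure rels g <-> normal_closure (relator_set C) g).
Proof.
have [E [hsym hE hmin]] := hfin; have [hwcr hconj] := hsym.
pose C := [seq cyclic_reduction (fp_word e) | e <- E].
have hred e : e \in E -> [/\ cycle alt (cyclic_reduction e), all nontriv (cyclic_reduction e) &
    exists g, wprod (cyclic_reduction e) = e ^ g].
  by move=> /hE he; apply: cyclic_reductionP; [exact: hwcr | have := rels_length he; lia].
have hcyc Y : cyclic_words C Y -> [/\ cycle alt Y, all nontriv Y & rels (wprod Y)].
  move=> [c /mapP[e he ->] [n hY]].
  have [hc ha [g hg]] := hred e he.
  have hYc : cycle alt Y /\ all nontriv Y.
    case: hY => ->.
      by rewrite rot_cycle (perm_all _ (permEl (perm_rot _ _))).
    by rewrite rot_cycle (perm_all _ (permEl (perm_rot _ _))); split;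
      [exact: alt_winv | exact: nontriv_winv].
  have [hcY haY] := hYc; split=> //.
  have hw := cycle_weakly_reduced hcY haY.
  have rotE w : wprod (rot n w) = wprod w ^ wprod (take n w).
    rewrite -{2}(cat_take_drop n w) /rot !wprod_cat /conjg.
    by rewrite !mulgA mulVg mul1g.
  case: hY hw => ->; rewrite rotE ?wprod_winv hg; last rewrite -conjVg; rewrite -conjgM.
    by have [h _] := hconj _ (hE _ he) (g * wprod (take n (cyclic_reduction e))); exact: h.
  by set k := _ * _; have [_ h] := hconj _ (hE _ he) k; exact: h.
have hlen Y : cyclic_words C Y -> (6 < size Y)%N.
  move=> /hcyc[hc ha /rels_length]; rewrite /fp_length fp_word_wprod //.
  exact: cycle_normal.
exists C; split; first split.
- by move=> Y /hcyc[].
- by move=> Y /hcyc[].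
- exact: hlen.
- move=> s t t' hY hZ ne n1 n2.
  case: s hY hZ => [|x0 s0] hY hZ; first by rewrite muln1; exact: hlen.
  move es: (x0 :: s0) hY hZ => s hY hZ.
  case/lastP: t hY ne n1 => [//|t y0] hY ne _.
  case/lastP: t' hZ ne n2 => [//|t' z0] hZ ne _.
  have hY1 : cyclic_words C (y0 :: s ++ t).
    by apply: (@cyclic_words_rot _ _ _ (s ++ t) [:: y0]); rewrite -catA cats1.
  have hZ1 : cyclic_words C (z0 :: s ++ t').
    by apply: (@cyclic_words_rot _ _ _ (s ++ t') [:: z0]); rewrite -catA cats1.
  have [cY aY rY] := hcyc _ hY1; have [cZ aZ rZ] := hcyc _ hZ1.
  have nY := cycle_normal cY aY; have nZ := cycle_normal cZ aZ.
  have hyz : same_factor y0 z0.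
    move: cY cZ; rewrite -es /= => /andP[h _] /andP[h' _].
    by case: x0 y0 z0 h h' {es hY1 hZ1 aY aZ rY rZ nY nZ ne hY hZ} => [?|?] [?|?] [?|?].
  suff hp : piece rels (wprod (y0 :: s)).
    have eY : wprod (y0 :: s ++ t) = wprod (y0 :: s) * wprod t.
      by rewrite -wprod_cat.
    have := rels_piece rY eY (@semi_reduced_cat (y0 :: s) t nY) hp.
    have [nys _] := @normal_cat (y0 :: s) t nY.
    by rewrite /fp_length !fp_word_wprod //= !size_cat ?size_rcons; clear; lia.
  have [eyz|/eqP nyz] := eqVneq z0 y0.
    rewrite eyz in nZ rZ ne.
    exists (wprod (y0 :: s ++ t)), (wprod (y0 :: s ++ t')), (wprod t), (wprod t').
    split=> //.
    + move=> /(congr1 (@fp_word A B)); rewrite !fp_word_wprod // => -[/eqP].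
      by rewrite eqseq_cat // eqxx /= => /eqP et; apply: ne; rewrite et.
    + by split; [rewrite -wprod_cat | exact: (@semi_reduced_cat (y0 :: s))].
    + by split; [rewrite -wprod_cat | exact: (@semi_reduced_cat (y0 :: s))].
  (* The letter by which the second relator is conjugated, so as to begin with [y0]. *)
pose d := letter_mul z0 (letter_inv y0).
  have hdz : same_factor d z0 /\ same_factor z0 d.
    by rewrite /d; case: (z0) (y0) hyz => [?|?] [?|?].
  have hnd : nontriv d.
    rewrite /d; case: (z0) (y0) hyz nyz => [a|a] [b|b] //= _ h; apply/negP => /eqP e.
      by apply: h; congr inl; rewrite -[a](mulgVK b) e mul1g.
    by apply: h; congr inr; rewrite -[a](mulgVK b) e mul1g.
  have ed : fp_letter d = fp_letter z0 * (fp_letter y0)^-1.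
    rewrite /d fp_letter_mul ?fp_letterV //.
    by case: (z0) (y0) hyz => [?|?] [?|?].
  have hy0 : nontriv y0 by have /andP[] := aY.
  have nW : normal_form (y0 :: s ++ rcons t' d).
    move: cZ aZ; rewrite /normal_form -rcons_cat /= all_rcons hy0 hnd /= => cZ /andP[_ ->] /=.
    move: cZ; rewrite !rcons_path => /andP[h1 h2]; apply/andP; split.
      move: h1; rewrite -es /= => /andP[h ->]; rewrite andbT.
      by case: (x0) (y0) (z0) h hyz => [?|?] [?|?] [?|?].
    move: h2; rewrite -es /=; move: (last x0 _) (z0) (d) hdz => u1 u2 u3.
    by case: u1 u2 u3 => [?|?] [?|?] [?|?] [].
  have eW : wprod (y0 :: s ++ rcons t' d) = wprod (z0 :: s ++ t') ^ fp_letter d.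
    rewrite -rcons_cat -cats1 wprod_cons wprod_cat wprod1 wprod_cons /conjg ed.
    by rewrite invgM invgK !mulgA mulgVK.
  have rW : rels (wprod (y0 :: s ++ rcons t' d)).
    have [h _] := hconj _ rZ (fp_letter d); rewrite eW; apply: h; rewrite -eW.
    right => y1 w; rewrite fp_word_wprod // => -[<- <-].
    rewrite last_cat last_rcons ed mulgVK.
    by apply: fp_letter_neq1; have /andP[] := aZ.
  exists (wprod (y0 :: s ++ t)), (wprod (y0 :: s ++ rcons t' d)), (wprod t), (wprod (rcons t' d)).
  split=> //.
  + move=> /(congr1 (@fp_word A B)); rewrite !fp_word_wprod // => /(congr1 (@size L)).
    move: (cycle_even cY) (cycle_even cZ); rewrite /= !size_cat size_rcons => h1 h2 h3.
    (* Both cyclic words have even length, and splitting a letter makes one of them odd. *)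
  have e : size t = (size t').+1 by move: h3; clear; lia.
    by move: h1 h2; rewrite e addnS /=; case: (odd _).
  + by split; [rewrite -wprod_cat | exact: (@semi_reduced_cat (y0 :: s))].
  + by split; [rewrite -wprod_cat | exact: (@semi_reduced_cat (y0 :: s))].
move=> x; split; apply: normal_closure_sub => {x} x; last first.
  move=> [c hc ->]; apply: normal_closure_gen.
  by have [] : [/\ cycle alt c, all nontriv c & rels (wprod c)];
    first by apply: hcyc; exists c => //; exists 0; left; rewrite rot0.
(* By minimality it suffices to find a symmetrized set inside the closure of [C]. *)
pose rels' : set F := fun r => normal_closure (relator_set C) r /\ weakly_cyclically_reduced r.
move=> hx; suff [] : rels' x by [].
apply: hmin hx; first split.
- by move=> r [].
- move=> r [h1 h2] g; split=> hw; split=> //; first exact: normal_closureJ.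
  by apply: normal_closureJ; exact: normal_closureV.
- move=> e he; split; last by apply: hwcr; exact: hE.
  have [_ _ [g hg]] := hred e he.
  have -> : e = wprod (cyclic_reduction e) ^ g^-1 by rewrite hg conjgK.
  apply: normal_closureJ; apply: normal_closure_gen.
  by exists (cyclic_reduction e) => //; apply/mapP; exists e.
Qed.

End Relators.
End Presentation.

(** * Taut loops and maps that kill relations *)
Section CayleyWords.
Variables (G : groupType) (S : seq G).
Implicit Types (x y g v : G) (w p q c : seq G).
Local Notation Gam := (cayley_graph S).

(** The labels of the edges of the Cayley graph: as the graph is simplicial, the
    neutral element is left out. *)
Definition gen x : bool := (x != 1) && ((x \in S) || (x^-1 \in S)).
Definition trace v w : seq G := scanl (fun a b => a * b) v w.
Definition increments v p : seq G := pairmap (fun a b => a^-1 * b) v p.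

Lemma cayleyE g h : Gam g h = gen (g^-1 * h).
Proof.
rewrite /= /cayley_rel /gen invgM invgK; congr (~~ _ && _).
by apply/eqP/eqP => [->|e]; [rewrite mulVg | rewrite -[h](mulVKg g) e mulg1].
Qed.

Lemma genV x : gen x^-1 = gen x.
Proof. by rewrite /gen invgK invg_eq1 orbC. Qed.

Lemma increments_trace v w : increments v (trace v w) = w.
Proof. by apply: scanlK => a; exact: mulKg. Qed.

Lemma trace_increments v p : trace v (increments v p) = p.
Proof. by apply: pairmapK => a; exact: mulVKg. Qed.

Lemma path_increments v p : path Gam v p = all gen (increments v p).
Proof. by elim: p v => //= w p IH v; rewrite IH -cayleyE. Qed.

Lemma path_trace v w : path Gam v (trace v w) = all gen w.
Proof. by rewrite path_increments increments_trace. Qed.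

Lemma last_trace v w : last v (trace v w) = v * \prod_(x <- w) x.
Proof.
elim: w v => [|x w IH] v /=; first by rewrite big_nil mulg1.
by rewrite IH big_cons mulgA.
Qed.

Lemma edge_loop_trace v w : edge_loop Gam v (trace v w) =
  all gen w && (\prod_(x <- w) x == 1).
Proof.
rewrite /edge_loop path_trace last_trace; congr (_ && _).
by apply/eqP/eqP => [e|->]; [rewrite -[LHS](mulKg v) e mulVg | rewrite mulg1].
Qed.

Lemma edge_loop_increments v p : edge_loop Gam v p =
  all gen (increments v p) && (\prod_(x <- increments v p) x == 1).
Proof. by rewrite -(edge_loop_trace v) trace_increments. Qed.

Definition kills (Q : groupType) (n : nat) (f : G -> Q) : Prop :=
  forall w, all gen w -> (size w <= n)%N -> \prod_(x <- w) x = 1 ->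
  \prod_(x <- w) f x = 1.

Definition relations_extend i j : Prop :=
  forall (Q : groupType) (f : G -> Q), kills i f -> kills j f.

Lemma killsW (Q : groupType) n m (f : G -> Q) : (m <= n)%N -> kills n f -> kills m f.
Proof. by move=> h hf w h1 h2; apply: hf => //; exact: leq_trans h. Qed.

Section WalkValue.
Variables (Q : groupType) (f : G -> Q).

Definition walk_value p : Q :=
  if p is v :: q then \prod_(x <- increments v q) f x else 1.

Lemma walk_value_cat p v q :
  walk_value (p ++ v :: q) = walk_value (rcons p v) * walk_value (v :: q).
Proof.
case: p => [|u p] /=; first by rewrite big_nil mul1g.
rewrite -cat_rcons /increments pairmap_cat big_cat last_rcons.
by rewrite -cats1.
Qed.

(** Killing relations of length 2 takes care of backtracks, and killing those of
    length less than [n] takes care of the cells. *)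
Lemma walk_value_homotopic n p q : kills 2 f -> kills n.-1 f ->
  edge_homotopic Gam (short_cells Gam n) p q -> walk_value p = walk_value q.
Proof.
move=> h2 hn; elim=> // [{}p {}q r _ -> _ -> //|{}p {}q v w hvw|{}p {}q v c [hc hl]].
- rewrite walk_value_cat [RHS]walk_value_cat; congr (_ * _).
  rewrite /= !big_cons mulgA -[RHS]mul1g; congr (_ * _).
  have := @h2 [:: v^-1 * w; w^-1 * v]; rewrite !big_cons !big_nil !mulg1; apply=> //.
    by rewrite /= -!cayleyE hvw adj_sym hvw.
  by rewrite mulgA -(mulgA _ w) mulgV mulg1 mulVg.
- rewrite walk_value_cat [RHS]walk_value_cat; congr (_ * _).
  rewrite /= /increments pairmap_cat big_cat /=.
  have := hc; rewrite edge_loop_increments => /andP[h1 /eqP h3].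
  have /andP[_ /eqP->] := hc; rewrite -[RHS]mul1g; congr (_ * _).
  by apply: hn => //; rewrite size_pairmap -ltnS (ltn_predK hl).
Qed.

End WalkValue.

(** Induction on the length: a relation of length [n.+1] is a loop that is not
    taut, hence null-homotopic through shorter cells, and its value is preserved by
    the homotopy. *)
Lemma no_taut_relations_extend i j : (2 <= i)%N ->
  (forall n, (i < n <= j)%N -> ~ group_spectrum S n) -> relations_extend i j.
Proof.
move=> hi hn Q f hf.
suff h n : (n <= j)%N -> kills n f by exact: h.
elim: n => [|n IH] hnj; first exact: killsW hf.
have [hle|hlt] := leqP n.+1 i; first exact: killsW hf.
move=> w hw; rewrite leq_eqVlt => /orP[/eqP hs|hs] e; last exact: (IH (ltnW hnj)).
have hloop : edge_loop Gam 1 (trace 1 w) by rewrite edge_loop_trace hw e eqxx.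
have hsz : size (trace 1 w) = n.+1 by rewrite size_scanl.
have hnull : null_homotopic Gam n.+1 1 (trace 1 w).
  have [//|hnn] := pselect (null_homotopic Gam n.+1 1 (trace 1 w)).
  have /hn [] : (i < n.+1 <= j)%N by rewrite hlt.
  by exists 1, (trace 1 w); split=> //; split; rewrite ?hsz.
have h2 : kills 2 f by exact: killsW hf.
have := @walk_value_homotopic _ f n.+1 _ _ h2 (IH (ltnW hnj)) hnull.
by rewrite /= big_nil increments_trace.
Qed.

(** The universal map killing the relations of length less than [n]: words in all
    elements of the group, with letters that are not generators ignored, up to
    homotopy of the corresponding paths from the neutral element.  Translation in
    the Cayley graph makes concatenation compatible with homotopy. *)
Section WordGroup.
Variable n : nat.
Local Notation hom := (edge_homotopic Gam (short_cells Gam n)).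

Lemma hom_prefix u p q : hom p q -> hom (u ++ p) (u ++ q).
Proof.
elim=> [{}p|{}p {}q _|{}p {}q r _ h1 _ h2|{}p {}q v w h|{}p {}q v c h].
- exact: eh_refl.
- exact: eh_sym.
- exact: eh_trans h1 h2.
- by rewrite !catA; exact: eh_backtrack.
- by rewrite !catA; exact: eh_cell.
Qed.

Lemma hom_suffix u p q : hom p q -> hom (p ++ u) (q ++ u).
Proof.
elim=> [{}p|{}p {}q _|{}p {}q r _ h1 _ h2|{}p {}q v w h|{}p {}q v c h].
- exact: eh_refl.
- exact: eh_sym.
- exact: eh_trans h1 h2.
- by rewrite -!catA; exact: eh_backtrack.
- by rewrite -!catA /= -catA; exact: eh_cell.
Qed.

Lemma edge_loop_mul g v p : edge_loop Gam v p ->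
  edge_loop Gam (g * v) (map (fun x => g * x) p).
Proof.
rewrite !edge_loop_increments; suff -> : increments (g * v) (map (fun x => g * x) p) = increments v p by [].
elim: p v => //= w p IH v; rewrite -/(increments _ _) IH; congr cons.
by rewrite invgM -mulgA mulKg.
Qed.

Lemma hom_mul g p q : hom p q -> hom (map (fun x => g * x) p) (map (fun x => g * x) q).
Proof.
elim=> [{}p|{}p {}q _|{}p {}q r _ h1 _ h2|{}p {}q v w h|{}p {}q v c [h hs]].
- exact: eh_refl.
- exact: eh_sym.
- exact: eh_trans h1 h2.
- rewrite !map_cat; apply: eh_backtrack.
  by rewrite cayleyE invgM -mulgA mulKg -cayleyE.
- rewrite !map_cat /= map_cat; apply: eh_cell.
  by split; [exact: edge_loop_mul | rewrite size_map].
Qed.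

Lemma hom_last p q d : hom p q -> last d p = last d q.
Proof.
elim=> // [{}p {}q r _ -> _ -> //|{}p {}q v w h|{}p {}q v c [/andP[_ /eqP h] _]].
  by rewrite !last_cat.
by rewrite !last_cat /= last_cat h.
Qed.

Definition word_walk w : seq G := 1 :: trace 1 (filter gen w).
Definition word_eqv : rel (seq G) := fun w w' => `[< hom (word_walk w) (word_walk w') >].

Lemma word_eqv_refl : reflexive word_eqv.
Proof. by move=> w; apply/asboolP; exact: eh_refl. Qed.
Lemma word_eqv_sym : symmetric word_eqv.
Proof. by move=> w w'; apply/asboolP/asboolP; exact: eh_sym. Qed.
Lemma word_eqv_trans : transitive word_eqv.
Proof. by move=> w2 w1 w3 /asboolP h1 /asboolP h2; apply/asboolP; exact: eh_trans h1 h2. Qed.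

Lemma trace_mul v w : trace v w = map (fun x => v * x) (trace 1 w).
Proof.
suff h g : trace (v * g) w = map (fun x => v * x) (trace g w) by rewrite -h mulg1.
by elim: w g => //= x w IH g; rewrite -mulgA IH.
Qed.

Lemma trace_cat v w w' : trace v (w ++ w') = trace v w ++ trace (last v (trace v w)) w'.
Proof. by elim: w v => //= x w IH v; rewrite IH. Qed.

Lemma word_walk_cat w w' : word_walk (w ++ w') =
  word_walk w ++ trace (last 1 (word_walk w)) (filter gen w').
Proof. by rewrite /word_walk filter_cat trace_cat. Qed.

Lemma word_eqv_cat w1 w2 w1' w2' : word_eqv w1 w1' -> word_eqv w2 w2' ->
  word_eqv (w1 ++ w2) (w1' ++ w2').
Proof.
move=> /asboolP h1 /asboolP h2; apply/asboolP; apply: (@eh_trans _ _ _ _ (word_walk (w1 ++ w2'))).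
  have [u [g eu]] : exists u g, word_walk w1 = rcons u g.
    by rewrite /word_walk lastI; eexists; eexists.
  rewrite !word_walk_cat eu last_rcons !cat_rcons; apply: hom_prefix.
  rewrite (trace_mul g) (trace_mul g (filter _ w2')).
  by have := hom_mul g h2; rewrite /= mulg1.
by rewrite !word_walk_cat (hom_last _ h1); exact: hom_suffix.
Qed.

Definition word_inv w : seq G := rev (map (@monoid.inv G) w).

Lemma word_eqv_cancel w : word_eqv (w ++ word_inv w) [::].
Proof.
elim: w => [|x w IH]; first exact: word_eqv_refl.
rewrite /word_inv /= rev_cons -cats1 -/(word_inv w) catA.
apply: (@word_eqv_trans ([:: x] ++ [:: x^-1])).
  have := word_eqv_cat (word_eqv_refl [:: x]) (word_eqv_cat IH (word_eqv_refl [:: x^-1])).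
  by rewrite catA.
apply/asboolP; rewrite /word_walk /= genV; case hx: (gen x); last exact: eh_refl.
rewrite /= mul1g mulgV; apply: (@eh_backtrack _ _ _ [::] [::]).
by rewrite cayleyE invg1 mul1g.
Qed.

Lemma word_eqv_cancelV w : word_eqv (word_inv w ++ w) [::].
Proof.
have := word_eqv_cancel (word_inv w).
by rewrite {2}/word_inv map_rev revK -map_comp map_id_in // => x _ /=; rewrite invgK.
Qed.

Lemma word_eqv_inv w w' : word_eqv w w' -> word_eqv (word_inv w) (word_inv w').
Proof.
move=> h; apply: (@word_eqv_trans (word_inv w ++ (w' ++ word_inv w'))).
  rewrite -{1}[word_inv w]cats0; apply: word_eqv_cat; first exact: word_eqv_refl.
  by rewrite word_eqv_sym; exact: word_eqv_cancel.
rewrite catA -{2}[word_inv w']cat0s; apply: word_eqv_cat; last exact: word_eqv_refl.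
apply: word_eqv_trans (word_eqv_cancelV w); apply: word_eqv_cat; first exact: word_eqv_refl.
by rewrite word_eqv_sym.
Qed.

Canonical word_equiv := EquivRel word_eqv word_eqv_refl word_eqv_sym word_eqv_trans.
Definition word_group := {eq_quot word_equiv}%qT.
HB.instance Definition _ := Choice.on word_group.
HB.instance Definition _ := EqQuotient.on word_group.
Local Open Scope quotient_scope.

Definition wg_one : word_group := \pi_word_group [::].
Definition wg_mul (p q : word_group) : word_group := \pi_word_group (repr p ++ repr q).
Definition wg_inv (p : word_group) : word_group := \pi_word_group (word_inv (repr p)).

Lemma wg_piP w w' : \pi_word_group w = \pi_word_group w' <-> word_eqv w w'.
Proof.
have E : (\pi_word_group w == \pi_word_group w') = word_eqv w w' by exact: (@eqquotE _ _ word_group).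
by split=> [/eqP|h]; [rewrite E | apply/eqP; rewrite E].
Qed.

Lemma wg_repr w : word_eqv (repr (\pi_word_group w)) w.
Proof. by apply/wg_piP; rewrite reprK. Qed.

Lemma wg_piM w w' : wg_mul (\pi_word_group w) (\pi_word_group w') = \pi_word_group (w ++ w').
Proof. by apply/wg_piP/word_eqv_cat; exact: wg_repr. Qed.

Lemma wg_piV w : wg_inv (\pi_word_group w) = \pi_word_group (word_inv w).
Proof. by apply/wg_piP/word_eqv_inv; exact: wg_repr. Qed.

Lemma wg_mulA : associative wg_mul.
Proof.
move=> p q r; rewrite -[p]reprK -[q]reprK -[r]reprK.
by rewrite (wg_piM (repr q)) (wg_piM (repr p) (repr q)) !wg_piM catA.
Qed.
Lemma wg_mul1 : left_id wg_one wg_mul.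
Proof. by move=> p; rewrite -[p]reprK (wg_piM [::]). Qed.
Lemma wg_1mul : right_id wg_one wg_mul.
Proof. by move=> p; rewrite -[p]reprK (wg_piM _ [::]) cats0. Qed.
Lemma wg_mulV : left_inverse wg_one wg_inv wg_mul.
Proof. by move=> p; rewrite -[p]reprK wg_piV wg_piM; apply/wg_piP; exact: word_eqv_cancelV. Qed.
Lemma wg_Vmul : right_inverse wg_one wg_inv wg_mul.
Proof. by move=> p; rewrite -[p]reprK wg_piV wg_piM; apply/wg_piP; exact: word_eqv_cancel. Qed.

HB.instance Definition _ :=
  isGroup.Build word_group wg_mulA wg_mul1 wg_1mul wg_mulV wg_Vmul.

Definition wg_gen x : word_group := \pi_word_group [:: x].

Lemma wg_gen_prod w : \prod_(x <- w) wg_gen x = \pi_word_group w.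
Proof.
elim: w => [|x w IH]; first by rewrite big_nil.
by rewrite big_cons IH; exact: (wg_piM [:: x] w).
Qed.

End WordGroup.

(** Apply the hypothesis to the universal map: it kills relations of length [n]
    as they bound cells, hence all loops of length [n.+1] are null-homotopic. *)
Lemma relations_extend_no_taut n : relations_extend n n.+1 -> ~ group_spectrum S n.+1.
Proof.
move=> hK [v [p [hs [hloop hnn]]]]; apply: hnn; rewrite hs.
pose f := wg_gen n.+1.
have walkE w : all gen w -> word_walk w = 1 :: trace 1 w.
  by move=> hw; rewrite /word_walk (all_filterP hw).
have hk : kills n f.
  move=> w hw hsw e; rewrite wg_gen_prod; apply/wg_piP/asboolP; rewrite walkE //.
  rewrite -[trace 1 w]cats0; apply: (@eh_cell _ _ _ [::] [::]).
  by split; [rewrite edge_loop_trace hw e eqxx | rewrite size_scanl].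
have := hloop; rewrite edge_loop_increments => /andP[h1 /eqP h2].
have := hK _ f hk (increments v p) h1; rewrite size_pairmap hs => /(_ (leqnn _) h2).
rewrite wg_gen_prod => /wg_piP/asboolP; rewrite walkE // => /(hom_mul v).
by rewrite /= mulg1 -trace_mul trace_increments.
Qed.

End CayleyWords.

(** * Extension of maps from generators to balls *)
Section WordMetric.
Variables (G : groupType) (S : seq G).
Hypothesis hS : generates S.
Implicit Types (x g : G) (w : seq G).

Lemma word_inv_gen w : all (gen S) (word_inv w) = all (gen S) w.
Proof. by rewrite /word_inv all_rev all_map; apply: eq_all => x /=; rewrite genV. Qed.

Lemma word_inv_prod w : \prod_(x <- word_inv w) x = (\prod_(x <- w) x)^-1.
Proof.
elim: w => [|x w IH]; first by rewrite !big_nil invg1.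
by rewrite /word_inv /= rev_cons -cats1 big_cat big_seq1 -/(word_inv w) IH big_cons invgM.
Qed.

Lemma gen_word g : exists2 w, all (gen S) w & \prod_(x <- w) x = g.
Proof.
pose H : set G := fun g => exists2 w, all (gen S) w & \prod_(x <- w) x = g.
suff hH : (smallest (@subgroup G) [set` S] `<=` H)%classic by apply: hH; rewrite hS.
apply: smallest_sub; first split.
- by exists [::]; rewrite ?big_nil.
- move=> _ _ [u hu <-] [v hv <-]; exists (u ++ word_inv v).
    by rewrite all_cat hu word_inv_gen.
  by rewrite big_cat /= word_inv_prod.
- move=> x /= hx; have [->|ne] := eqVneq x 1; first by exists [::]; rewrite ?big_nil.
  by exists [:: x]; rewrite ?big_seq1 //= /gen ne hx.
Qed.

Lemma geodesicP g : exists w, [/\ all (gen S) w, \prod_(x <- w) x = g &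
  forall w', all (gen S) w' -> \prod_(x <- w') x = g -> (size w <= size w')%N].
Proof.
have [w0 h1 h2] := gen_word g.
have hex : exists n, `[< exists2 w, all (gen S) w & \prod_(x <- w) x = g /\ size w = n >].
  by exists (size w0); apply/asboolP; exists w0.
case: (ex_minnP hex) => n /asboolP[w hw [e <-]] hmin; exists w; split=> // w' hw' e'.
by apply: hmin; apply/asboolP; exists w'.
Qed.

Definition geodesic g : seq G := sval (cid (geodesicP g)).
Definition wlen g : nat := size (geodesic g).

Lemma geodesic_gen g : all (gen S) (geodesic g).
Proof. by rewrite /geodesic; case: cid => w p /=; case: p. Qed.
Lemma geodesic_prod g : \prod_(x <- geodesic g) x = g.
Proof. by rewrite /geodesic; case: cid => w p /=; case: p. Qed.
Lemma wlen_le w : all (gen S) w -> (wlen (\prod_(x <- w) x)%g <= size w)%N.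
Proof. by move=> hw; rewrite /wlen /geodesic; case: cid => w' p /=; case: p => _ _; exact. Qed.

Lemma wlen1 : wlen 1 = 0.
Proof. by have := @wlen_le [::] isT; rewrite big_nil leqn0 => /eqP. Qed.

Lemma wlenM g h : (wlen (g * h)%g <= wlen g + wlen h)%N.
Proof.
have := @wlen_le (geodesic g ++ geodesic h); rewrite all_cat !geodesic_gen size_cat big_cat /=.
by rewrite !geodesic_prod; exact.
Qed.

Lemma wlenV g : wlen g^-1 = wlen g.
Proof.
have h k : (wlen k^-1 <= wlen k)%N.
  have := @wlen_le (word_inv (geodesic k)).
  by rewrite word_inv_gen geodesic_gen word_inv_prod geodesic_prod size_rev size_map; exact.
by apply/eqP; rewrite eqn_leq h -{1}[g]invgK h.
Qed.

Lemma wlen_gen x : gen S x -> (wlen x <= 1)%N.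
Proof. by move=> hx; have := @wlen_le [:: x]; rewrite /= hx big_seq1; exact. Qed.

Section Values.
Variables (Q : groupType) (n : nat) (f : G -> Q).
Hypothesis hf : kills S n f.
Hypothesis hn : (2 <= n)%N.

Lemma kills_inv x : gen S x -> f x^-1 = (f x)^-1.
Proof.
move=> hx; have := @hf [:: x^-1; x]; rewrite !big_cons !big_nil !mulg1 /= genV hx mulVg.
by move=> /(_ isT hn erefl) e; apply: (@mulIg _ (f x)); rewrite e mulVg.
Qed.

Lemma kills_word_inv w : all (gen S) w ->
  \prod_(x <- word_inv w) f x = (\prod_(x <- w) f x)^-1.
Proof.
elim: w => [|x w IH] /=; first by rewrite !big_nil invg1.
move=> /andP[hx hw]; rewrite /word_inv /= rev_cons -cats1 big_cat big_seq1 -/(word_inv w).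
by rewrite IH // big_cons invgM kills_inv.
Qed.

Lemma kills_eq u v : all (gen S) u -> all (gen S) v ->
  \prod_(x <- u) x = \prod_(x <- v) x -> (size u + size v <= n)%N ->
  \prod_(x <- u) f x = \prod_(x <- v) f x.
Proof.
move=> hu hv e hl; have := @hf (u ++ word_inv v).
rewrite all_cat hu word_inv_gen hv size_cat size_rev size_map !big_cat /=.
rewrite word_inv_prod kills_word_inv // e mulgV => /(_ isT hl erefl) h.
by apply: (@mulIg _ (\prod_(x <- v) f x)^-1); rewrite h mulgV.
Qed.

(** The only extension of the values of [f] on the generators that can be
    multiplicative on balls. *)
Definition extension g : Q := \prod_(x <- geodesic g) f x.

Lemma extension1 : extension 1 = 1.
Proof. by rewrite /extension; have := wlen1; rewrite /wlen => /size0nil ->; rewrite big_nil. Qed.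

(** Two words for the same element, of total length at most [n], have the same
    value, as their quotient is a relation that [f] kills. *)
Lemma extensionM g h : (2 * (wlen g + wlen h) <= n)%N ->
  extension (g * h) = extension g * extension h.
Proof.
move=> hl; rewrite /extension -big_cat; apply: kills_eq.
- exact: geodesic_gen.
- by rewrite all_cat !geodesic_gen.
- by rewrite big_cat /= !geodesic_prod.
- rewrite size_cat; apply: leq_trans hl; rewrite mul2n -addnn leq_add2r; exact: wlenM.
Qed.

Lemma extension_gen x : gen S x -> extension x = f x.
Proof.
move=> hx; have e : \prod_(y <- [:: x]) f y = f x by rewrite big_seq1.
rewrite /extension -e; apply: kills_eq.
- exact: geodesic_gen.
- by rewrite /= hx.
- by rewrite geodesic_prod big_seq1.
- by apply: leq_trans hn; rewrite addn1 ltnS; exact: wlen_gen.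
Qed.

End Values.

Lemma gen_bound (F : G -> nat) : exists b, forall x, gen S x -> (F x <= b)%N.
Proof.
exists (\max_(x <- S ++ map (@monoid.inv G) S) F x) => x /andP[_ hx].
apply: leq_bigmax_seq => //; rewrite mem_cat; case/orP: hx => [->//|hx].
by apply/orP; right; rewrite -[x]invgK; exact: map_f.
Qed.

End WordMetric.

(** * Transfer of gaps in the spectrum *)

(** Words are mapped letter by letter, so an injective map preserves overlaps.  It
    has to commute with inversion only for the letters that occur. *)
Lemma word_small_cancellation_map (A B A' B' : groupType) (h : A + B -> A' + B')
    (C : seq (seq (A + B))) :
  (forall x y, same_factor (h x) (h y) = same_factor x y) ->
  (forall x, trivial_letter (h x) -> trivial_letter x) -> injective h ->
  (forall c x, c \in C -> x \in c -> h (letter_inv x) = letter_inv (h x)) ->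
  word_small_cancellation C -> word_small_cancellation (map (map h) C).
Proof.
move=> hs ht hi hV [halt hnt hlen hpiece].
have hcyc Y : cyclic_words (map (map h) C) Y -> exists2 Z, cyclic_words C Z & Y = map h Z.
  move=> [_ /mapP[c hc ->] [n [->|->]]].
    by exists (rot n c); [exists c => //; exists n; left | rewrite map_rot].
  exists (rot n (winv c)); first by exists c => //; exists n; right.
  rewrite map_rot /winv map_rev -!map_comp; congr (rot _ (rev _)).
  by apply/eq_in_map => x hx /=; rewrite (hV c).
split.
- by move=> Y /hcyc[Z /halt hZ ->]; rewrite cycle_map; apply: sub_cycle hZ => x y /=; rewrite hs.
- move=> Y /hcyc[Z /hnt hZ ->]; rewrite all_map; apply: sub_all hZ => x /=.
  by apply: contra; exact: ht.
- by move=> Y /hcyc[Z /hlen hZ ->]; rewrite size_map.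
- move=> s t t' /hcyc[Y hY e] /hcyc[Z hZ e'] ne n1 n2.
  have es : take (size s) Y = take (size s) Z.
    by apply: (inj_map hi); rewrite !map_take -e -e' !take_size_cat.
  have et := congr1 (drop (size s)) e; rewrite drop_size_cat // -map_drop in et.
  have et' := congr1 (drop (size s)) e'; rewrite drop_size_cat // -map_drop in et'.
  have sz : size (take (size s) Y) = size s.
    by rewrite -(size_map h) map_take -e take_size_cat.
  rewrite -(cat_take_drop (size s) Y) in hY; rewrite -(cat_take_drop (size s) Z) -es in hZ.
  have := hpiece _ _ _ hY hZ; rewrite sz cat_take_drop e size_map; apply.
  + by move=> e2; apply: ne; rewrite et et' e2.
  + by move=> e2; apply: n1; rewrite et e2.
  + by move=> e2; apply: n2; rewrite et' e2.
Qed.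

(** The group [G] is the quotient by the words of [C], up to isomorphism.  The
    constants compare the word metrics: [m] bounds the relators, [c0] the generators
    of the factors in terms of those of [G], and [c1] the words chosen to represent
    the generators of [G]. *)
Section Transfer.
Variables A B : groupType.
Local Notation L := (A + B)%type.
Local Notation F := (free_product A B).
Variables (C : seq (seq L)) (G : groupType) (pi : F -> G).
Hypothesis hC : word_small_cancellation C.
Hypothesis piM : forall x y, pi (x * y) = pi x * pi y.
Hypothesis pi_ker : forall x, pi x = 1 <-> normal_closure (relator_set C) x.
Hypothesis pi_surj : forall g, exists x, pi x = g.
Variables (SA : seq A) (SB : seq B) (SG : seq G).
Hypotheses (hSA : generates SA) (hSB : generates SB) (hSG : generates SG).

Local Notation llen := (letter_len (wlen hSA) (wlen hSB)).
Local Notation lword := (word_len (wlen hSA) (wlen hSB)).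

Lemma pi1 : pi 1 = 1.
Proof. by apply: (@mulgI _ (pi 1)); rewrite -piM !mulg1. Qed.

Definition lift_word (g : G) : seq L := fp_word (sval (cid (pi_surj g))).

Lemma pi_lift_word g : pi (wprod (lift_word g)) = g.
Proof. by rewrite /lift_word; case: cid => x /= <-; rewrite wprod_word. Qed.

Definition lift_words (w : seq G) : seq L := flatten (map lift_word w).

Lemma pi_lift_words w : pi (wprod (lift_words w)) = \prod_(g <- w) g.
Proof.
elim: w => [|g w IH]; first by rewrite /lift_words /wprod !big_nil pi1.
by rewrite /lift_words /= wprod_cat piM pi_lift_word -/(lift_words w) IH big_cons.
Qed.

Lemma word_value_cat (Q : groupType) (fA : A -> Q) (fB : B -> Q) u v :
  word_value fA fB (u ++ v) = word_value fA fB u * word_value fA fB v.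
Proof. by rewrite /word_value big_cat. Qed.

Lemma word_value_lift_words (Q : groupType) (fA : A -> Q) (fB : B -> Q) w :
  word_value fA fB (lift_words w) = \prod_(g <- w) word_value fA fB (lift_word g).
Proof.
elim: w => [|g w IH]; first by rewrite /lift_words /word_value !big_nil.
by rewrite /lift_words /= word_value_cat -/(lift_words w) IH big_cons.
Qed.

Definition inA (a : A) : G := pi (fp_letter (inl a)).
Definition inB (b : B) : G := pi (fp_letter (inr b)).

Lemma inA_prod w : inA (\prod_(a <- w) a) = \prod_(a <- w) inA a.
Proof.
elim: w => [|a w IH]; last by rewrite !big_cons -IH /inA fp_letter_inlM piM.
by rewrite !big_nil /inA fp_letter1l pi1.
Qed.

Lemma inB_prod w : inB (\prod_(a <- w) a) = \prod_(a <- w) inB a.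
Proof.
elim: w => [|a w IH]; last by rewrite !big_cons -IH /inB fp_letter_inrM piM.
by rewrite !big_nil /inB fp_letter1r pi1.
Qed.

Variables (m c0 c1 : nat).
Hypothesis hm : forall c, c \in C -> (lword c <= m)%N.
Hypothesis hc0A : forall a, gen SA a -> (wlen hSG (inA a) <= c0)%N.
Hypothesis hc0B : forall b, gen SB b -> (wlen hSG (inB b) <= c0)%N.
(** The bound required by [lift_relation] less its constant term [2 * m], so that
    it is additive under concatenation. *)
Definition cost (w : seq L) : nat := (lword w + 2 * m * size w)%N.
Hypothesis hc1 : forall g, gen SG g -> (cost (lift_word g) <= c1)%N.

Lemma cost_cat u v : cost (u ++ v) = (cost u + cost v)%N.
Proof. by rewrite /cost /word_len big_cat size_cat mulnDr /=; lia. Qed.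

Lemma cost_lift_words w : all (gen SG) w -> (cost (lift_words w) <= c1 * size w)%N.
Proof.
elim: w => [|g w IH] /=; first by rewrite /cost /lift_words /word_len /= big_nil muln0.
move=> /andP[hg hw]; rewrite /lift_words /= cost_cat -/(lift_words w) mulnS.
by apply: leq_add; [exact: hc1 | exact: IH].
Qed.

Section Lift.
Variables (Q : groupType) (fA : A -> Q) (fB : B -> Q) (J : nat).
Hypothesis fA1 : fA 1 = 1.
Hypothesis fAM : forall a b, (wlen hSA a + wlen hSA b <= J)%N -> fA (a * b) = fA a * fA b.
Hypothesis fB1 : fB 1 = 1.
Hypothesis fBM : forall a b, (wlen hSB a + wlen hSB b <= J)%N -> fB (a * b) = fB a * fB b.
Hypothesis fC : forall c, c \in C -> word_value fA fB c = 1.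
Local Notation value := (word_value fA fB).

Lemma lift_kernel w : pi (wprod w) = 1 -> (cost w + 2 * m <= J)%N -> value w = 1.
Proof.
move=> /pi_ker hw hJ.
have hmJ : (2 * m <= J)%N by apply: leq_trans hJ; exact: leq_addl.
apply: (lift_relation (wlen1 hSA) (wlenM hSA) (wlenV hSA) (wlen1 hSB) (wlenM hSB)
  (wlenV hSB) fA1 fAM fB1 fBM hC hm hmJ fC hw).
by apply: leq_trans hJ; rewrite /cost; lia.
Qed.

Lemma lift_eq u v : pi (wprod u) = pi (wprod v) ->
  (2 * (cost u + cost v) + 2 * m <= J)%N -> value u = value v.
Proof.
move=> e hJ; apply: (@mulIg _ (value v)^-1); rewrite mulgV.
have hv : (2 * lword v <= J)%N by move: hJ; rewrite /cost; lia.
have ew : lword (winv v) = lword v.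
  by apply: word_len_winv => a; rewrite wlenV.
rewrite -(word_value_winv (wlen1 hSA) (wlenV hSA) (wlen1 hSB) (wlenV hSB) fA1 fAM fB1 fBM hv).
rewrite -word_value_cat; apply: lift_kernel.
  by rewrite wprod_cat wprod_winv piM e -piM mulgV pi1.
by rewrite cost_cat {2}/cost ew size_rev size_map -/(cost v); lia.
Qed.

(** Maps on the factors that kill the relators induce a map on the generators of
    [G] that kills relations, of length limited by the balls on which the maps are
    multiplicative. *)
Lemma lift_kills n : (c1 * n + 2 * m <= J)%N -> kills SG n (fun g => value (lift_word g)).
Proof.
move=> hJ w hw hs e; rewrite -word_value_lift_words; apply: lift_kernel.
  by rewrite pi_lift_words.
apply: leq_trans hJ; rewrite leq_add2r; apply: leq_trans (cost_lift_words hw) _.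
by rewrite leq_mul2l hs orbT.
Qed.

Lemma lift_letter (x : L) : (letter_len (wlen hSA) (wlen hSB) x <= 1)%N ->
  (wlen hSG (pi (fp_letter x)) <= c0)%N ->
  (2 * (1 + 2 * m + c1 * c0) + 2 * m <= J)%N ->
  letter_value fA fB x = \prod_(g <- geodesic hSG (pi (fp_letter x))) value (lift_word g).
Proof.
move=> hx hg hJ; rewrite -word_value_lift_words.
have -> : letter_value fA fB x = value [:: x] by rewrite /word_value big_seq1.
apply: lift_eq; first by rewrite pi_lift_words wprod1 geodesic_prod.
have h1 : (cost [:: x] <= 1 + 2 * m)%N by rewrite /cost /word_len big_seq1 muln1; lia.
have h2 := cost_lift_words (geodesic_gen hSG (pi (fp_letter x))).
have h3 : (c1 * size (geodesic hSG (pi (fp_letter x))) <= c1 * c0)%N by rewrite leq_mul2l hg orbT.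
by move: hJ h1 h2 h3; clear; lia.
Qed.
End Lift.

Section Push.
Variables (Q : groupType) (f : G -> Q) (n : nat).
Hypothesis hf : kills SG n f.

(** The converse direction: the value under [f] of an element of [G].  It is
    composed with the maps of [A] and [B] to [G]. *)
Definition push (g : G) : Q := \prod_(x <- geodesic hSG g) f x.

Lemma prod_flatten (T : Type) (R : groupType) (w : seq T) (phi : T -> seq G) (k : G -> R) :
  \prod_(x <- flatten (map phi w)) k x = \prod_(y <- w) \prod_(x <- phi y) k x.
Proof. by elim: w => [|y w IH]; rewrite ?big_nil // big_cons /= big_cat IH. Qed.

Lemma push_prod (w : seq G) b : (forall g, g \in w -> (wlen hSG g <= b)%N) ->
  exists v, [/\ all (gen SG) v, \prod_(x <- v) x = \prod_(g <- w) g,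
    (size v <= b * size w)%N & \prod_(g <- w) push g = \prod_(x <- v) f x].
Proof.
move=> hb; exists (flatten (map (geodesic hSG) w)); split.
- by elim: (w) => //= y w' IH; rewrite all_cat geodesic_gen.
- rewrite (prod_flatten w (geodesic hSG) (fun x => x)).
  by apply: eq_bigr => y _; exact: geodesic_prod.
- elim: w hb => //= y w IH hb; rewrite size_cat mulnS; apply: leq_add.
    by apply: hb; rewrite inE eqxx.
  by apply: IH => x hx; apply: hb; rewrite inE hx orbT.
- by rewrite (prod_flatten w (geodesic hSG) f).
Qed.

Lemma push_trivial (w : seq G) b : (forall g, g \in w -> (wlen hSG g <= b)%N) ->
  (b * size w <= n)%N -> \prod_(g <- w) g = 1 -> \prod_(g <- w) push g = 1.
Proof.
move=> hb hs e; have [v [h1 h2 h3 ->]] := push_prod hb.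
by apply: hf; rewrite ?h2 //; exact: leq_trans hs.
Qed.

Lemma push_kills (H : groupType) (SH : seq H) (phi : H -> G) k :
  (forall w, \prod_(x <- w) phi x = phi (\prod_(x <- w) x)) ->
  (forall x, gen SH x -> (wlen hSG (phi x) <= c0)%N) ->
  (c0 * k <= n)%N -> kills SH k (fun x => push (phi x)).
Proof.
move=> hphi hb hk w hw hs e; rewrite -(big_map phi xpredT push).
apply: (push_trivial (b := c0)).
- by move=> g /mapP[x hx ->]; apply: hb; exact: (allP hw).
- by rewrite size_map; apply: leq_trans hk; rewrite leq_mul2l hs orbT.
- rewrite big_map hphi e; have := hphi [::]; by rewrite !big_nil => <-.
Qed.

(** The converse direction: the value under [f] of an element of [G].  It is
    composed with the maps of [A] and [B] to [G]. *)
Definition push_letter (x : L) : seq G :=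
  match x with
  | inl a => map inA (geodesic hSA a)
  | inr b => map inB (geodesic hSB b)
  end.

Lemma push_letters (w : seq L) : exists v : seq G,
  [/\ forall g, g \in v -> (wlen hSG g <= c0)%N, \prod_(g <- v) g = pi (wprod w),
    size v = lword w & word_value (extension hSA (fun a => push (inA a)))
      (extension hSB (fun b => push (inB b))) w = \prod_(g <- v) push g].
Proof.
elim: w => [|x w [v [h1 h2 h3 h4]]].
  by exists [::]; rewrite /word_value /word_len /wprod !big_nil pi1.
exists (push_letter x ++ v); split.
- move=> g; rewrite mem_cat => /orP[|/h1//].
  case: x => a /= /mapP[y hy ->].
    by apply: hc0A; exact: (allP (geodesic_gen hSA a)).
  by apply: hc0B; exact: (allP (geodesic_gen hSB a)).
- rewrite big_cat wprod_cons piM -h2 /=; congr (_ * _).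
  case: x => a /=; rewrite big_map.
    by rewrite -inA_prod geodesic_prod.
  by rewrite -inB_prod geodesic_prod.
- by rewrite size_cat h3 /word_len big_cons; congr addn; case: x => a; rewrite /= size_map.
- rewrite /word_value big_cons -/(word_value _ _ w) h4 big_cat /=; congr (_ * _).
  by case: x => a /=; rewrite big_map.
Qed.
End Push.

(** A map [f] on [G] is restricted to the factors, extended there using their
    gaps, and compared with [f] on the generators of [G]. *)
Theorem relations_extend_quotient i j c : (2 <= i)%N -> (c0 + c0 * m <= c)%N ->
  (1 + c1 * c0 <= c)%N -> (2 * (c1 + 2 * m) + 2 <= c)%N ->
  relations_extend SA i j -> relations_extend SB i j ->
  relations_extend SG (c * i) (j %/ c).
Proof.
move=> hi hc2 hc3 hc4 KA KB Q f hf.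
have hci b : (b <= c)%N -> (b <= c * i)%N.
  by move=> h; apply: leq_trans h _; rewrite leq_pmulr //; lia.
have hn : (2 <= c * i)%N by apply: hci; lia.
have hk : (c0 * i <= c * i)%N by rewrite leq_mul2r; lia.
have kA : kills SA j (fun a => push f (inA a)).
  by apply: KA; apply: (push_kills hf) hk => [w|]; [rewrite inA_prod | exact: hc0A].
have kB : kills SB j (fun b => push f (inB b)).
  by apply: KB; apply: (push_kills hf) hk => [w|]; [rewrite inB_prod | exact: hc0B].
move=> w hw hs e; case: w hw hs e => [|g0 w0]; first by rewrite !big_nil.
move: (g0 :: w0) (isT : (0 < size (g0 :: w0))%N) => w hw0 hw hs e.
have hj : (c * size w <= j)%N.
  by rewrite mulnC; apply: leq_trans (leq_trunc_div j c); rewrite leq_mul2r hs orbT.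
have hcw : (c <= c * size w)%N by rewrite leq_pmulr.
have hj2 : (2 <= j)%N by lia.
(* Balls of radius [J] suffice, as [extensionM] compares products of total length [2 * J]. *)
pose J := j./2; have hJ : (2 * J <= j)%N by rewrite mul2n -[leqRHS]odd_double_half leq_addl.
pose fA := extension hSA (fun a => push f (inA a)).
pose fB := extension hSB (fun b => push f (inB b)).
have fAM a b : (wlen hSA a + wlen hSA b <= J)%N -> fA (a * b) = fA a * fA b.
  by move=> h; apply: (extensionM kA hj2); apply: leq_trans hJ; rewrite leq_mul2l.
have fBM a b : (wlen hSB a + wlen hSB b <= J)%N -> fB (a * b) = fB a * fB b.
  by move=> h; apply: (extensionM kB hj2); apply: leq_trans hJ; rewrite leq_mul2l.
have fC r : r \in C -> word_value fA fB r = 1.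
  move=> hr; have [v [h1 h2 h3 ->]] := push_letters f r.
  apply: (push_trivial hf h1).
    rewrite h3; apply: leq_trans (hci _ hc2); apply: leq_trans (leq_addl _ _).
    by rewrite leq_mul2l hm ?orbT.
  by rewrite h2; apply/pi_ker; apply: normal_closure_gen; exists r.
(* Both sides are values of [f] on words for [g]; the second has at most [c1 * c0] letters. *)
have fE g : gen SG g -> f g = word_value fA fB (lift_word g).
  move=> hg; have [v [h1 h2 h3 ->]] := push_letters f (lift_word g).
  have [u [h4 h5 h6 ->]] := push_prod f h1.
  have <- : \prod_(x <- [:: g]) f x = f g by rewrite big_seq1.
  apply: (kills_eq hf hn) => //; first by rewrite /= hg.
    by rewrite big_seq1 h5 h2 pi_lift_word.
  apply: leq_trans (hci _ hc3); rewrite leq_add2l; apply: leq_trans h6 _.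
  rewrite h3 mulnC leq_mul2r; apply/orP; right.
  by apply: leq_trans (hc1 hg); exact: leq_addr.
rewrite big_seq (eq_bigr (fun g => word_value fA fB (lift_word g))); last first.
  by move=> g hg; apply: fE; exact: (allP hw).
rewrite -big_seq -word_value_lift_words.
apply: (lift_kernel (extension1 _ _) fAM (extension1 _ _) fBM fC).
  by rewrite pi_lift_words.
have h1 := cost_lift_words hw.
have h2 : ((2 * (c1 + 2 * m)) * size w <= c * size w)%N by rewrite leq_mul2r; lia.
have h3 : (2 * m <= 2 * m * size w)%N by rewrite leq_pmulr.
have h4 : (2 * (c1 * size w + 2 * m * size w) <= j)%N.
  by apply: leq_trans hj; apply: leq_trans h2; rewrite -mulnDl mulnA.
have h5 : (c1 * size w + 2 * m * size w <= J)%N by rewrite /J geq_half_double -mul2n.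
by lia.
Qed.

(** Both factors are treated at once, because the quotient that receives [G]
    involves both maps; for a single factor the other map can be taken constant. *)
Theorem relations_extend_factors i j c : (2 <= i)%N -> (c0 <= c)%N ->
  (2 * c1 + 4 * m <= c)%N -> (4 * (1 + 2 * m + c1 * c0) + 4 * m <= c)%N ->
  relations_extend SG i j ->
  forall (Q0 Q1 : groupType) (f0 : A -> Q0) (f1 : B -> Q1),
  kills SA (c * i) f0 -> kills SB (c * i) f1 ->
  kills SA (j %/ c) f0 /\ kills SB (j %/ c) f1.
Proof.
move=> hi hc2 hc3 hc4 KG Q0 Q1 f0 f1 k0 k1.
have hci b : (b <= c)%N -> (b <= c * i)%N.
  by move=> h; apply: leq_trans h _; rewrite leq_pmulr //; lia.
have hn : (2 <= c * i)%N by apply: hci; lia.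
pose J := (c * i)./2; have hJ : (2 * J <= c * i)%N by rewrite mul2n -[leqRHS]odd_double_half leq_addl.
have hhalf b : (2 * b <= c * i)%N -> (b <= J)%N by move=> h; rewrite /J geq_half_double -mul2n.
(* The second coordinate keeps the relators distinct, the first one records the maps. *)
pose A' := factor_pair Q0 A; pose B' := factor_pair Q1 B.
pose hA (a : A) : A' := (extension hSA f0 a, a).
pose hB (b : B) : B' := (extension hSB f1 b, b).
have hAM a b : (wlen hSA a + wlen hSA b <= J)%N -> hA (a * b) = hA a * hA b.
  move=> h; rewrite /hA (extensionM k0 hn) //; apply: leq_trans hJ; by rewrite leq_mul2l.
have hBM a b : (wlen hSB a + wlen hSB b <= J)%N -> hB (a * b) = hB a * hB b.
  move=> h; rewrite /hB (extensionM k1 hn) //; apply: leq_trans hJ; by rewrite leq_mul2l.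
have hA1 : hA 1 = 1 by rewrite /hA extension1.
have hB1 : hB 1 = 1 by rewrite /hB extension1.
pose h (x : L) : (A' + B')%type := match x with inl a => inl (hA a) | inr b => inr (hB b) end.
have hC' : word_small_cancellation (map (map h) C).
  apply: word_small_cancellation_map hC.
  - by case=> [?|?] [?|?].
  - by case=> a /= /eqP[_ ->].
  - by case=> [a|a] [b|b] //= [_ ->].
  - move=> r x hr hx; have hlx : (llen x <= m)%N.
      apply: leq_trans (hm hr); rewrite /word_len (big_rem x hx) /=; exact: leq_addr.
    have hlJ : (2 * llen x <= J)%N by apply: hhalf; apply: hci; lia.
    case: x hlJ {hx hlx} => a /= hl; congr (_ _).
      by apply: (@mulIg _ (hA a)); rewrite mulVg -hAM ?mulVg ?wlenV //; lia.
    by apply: (@mulIg _ (hB a)); rewrite mulVg -hBM ?mulVg ?wlenV //; lia.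
pose N := relator_set (map (map h) C).
pose Q := ncl_quotient N.
pose pr (x : free_product A' B') : Q := (\pi_Q x)%qT.
have prM x y : pr (x * y) = pr x * pr y by exact: ncl_pi_mul.
have pr_ker x : pr x = 1 -> normal_closure N x.
  move=> e; have /ncl_piP : pr 1 = pr x by rewrite e.
  by rewrite invg1 mul1g.
have pr1 x : normal_closure N x -> pr x = 1.
  move=> hx; suff -> : pr x = pr 1 by [].
  by symmetry; apply/ncl_piP; rewrite invg1 mul1g.
pose FA (a : A) : Q := pr (fp_letter (inl (hA a))).
pose FB (b : B) : Q := pr (fp_letter (inr (hB b))).
have FA1 : FA 1 = 1 by rewrite /FA hA1 fp_letter1l.
have FB1 : FB 1 = 1 by rewrite /FB hB1 fp_letter1r.
have FAM a b : (wlen hSA a + wlen hSA b <= J)%N -> FA (a * b) = FA a * FA b.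
  by move=> hl; rewrite /FA hAM // fp_letter_inlM prM.
have FBM a b : (wlen hSB a + wlen hSB b <= J)%N -> FB (a * b) = FB a * FB b.
  by move=> hl; rewrite /FB hBM // fp_letter_inrM prM.
have FW w : word_value FA FB w = pr (wprod (map h w)).
  elim: w => [|x w IH]; first by rewrite /word_value /wprod !big_nil.
  by rewrite /word_value big_cons -/(word_value FA FB w) IH /= wprod_cons prM; case: x.
have FC r : r \in C -> word_value FA FB r = 1.
  by move=> hr; rewrite FW; apply: pr1; apply: normal_closure_gen; exists (map h r) => //; exact: map_f.
pose f (g : G) : Q := word_value FA FB (lift_word g).
have kG : kills SG j f.
  apply: KG; apply: (lift_kills FA1 FAM FB1 FBM FC); apply: hhalf.
  have h1 : ((2 * c1 + 4 * m) * i <= c * i)%N by rewrite leq_mul2r hc3 orbT.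
  have h2 : (4 * m <= 4 * m * i)%N by rewrite leq_pmulr //; lia.
  by move: h1 h2; rewrite mulnDl mulnDr !mulnA; clear; lia.
have hJ2 : (2 * (1 + 2 * m + c1 * c0) + 2 * m <= J)%N.
  by apply: hhalf; apply: hci; apply: leq_trans hc4; clear; lia.
have hk k : (k <= j %/ c)%N -> (c0 * k <= j)%N.
  move=> hk; apply: leq_trans (leq_trunc_div j c); rewrite mulnC.
  by apply: leq_mul.
split=> u hu hs e.
(* On generators [FA] factors through [G], where the gap applies. *)
- have EA a : gen SA a -> FA a = push f (inA a).
    move=> ha; have := @lift_letter Q FA FB J FA1 FAM FB1 FBM FC (inl a); apply=> //.
      by rewrite /=; exact: wlen_gen.
    exact: hc0A.
  have h1 : \prod_(a <- u) FA a = 1.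
    have kf : kills SA (j %/ c) (fun a => push f (inA a)).
      apply: (push_kills kG) (hk _ (leqnn _)) => [w|]; last exact: hc0A.
      by rewrite inA_prod.
    rewrite big_seq (eq_bigr (fun a => push f (inA a))) => [|a ha]; last first.
      by apply: EA; exact: (allP hu).
    by rewrite -big_seq; exact: kf.
  have h2 w : \prod_(a <- w) FA a = pr (fp_letter (inl (\prod_(a <- w) hA a))).
    elim: w => [|a w IH]; first by rewrite !big_nil fp_letter1l.
    by rewrite !big_cons IH fp_letter_inlM prM.
  have h3 : \prod_(a <- u) hA a = 1.
    by apply: (left_factor_embeds hC'); apply: pr_ker; rewrite -h2.
  have h4 w : (\prod_(a <- w) hA a).1 = \prod_(a <- w) extension hSA f0 a.
    by elim: w => [|a w IH]; rewrite ?big_nil // !big_cons /= IH.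
  have := h4 u; rewrite h3 => e1; apply: etrans (esym e1).
  rewrite !big_seq; apply: eq_bigr => a ha.
  by rewrite (extension_gen _ k0 hn) //; exact: (allP hu).
- have EB a : gen SB a -> FB a = push f (inB a).
    move=> ha; have := @lift_letter Q FA FB J FA1 FAM FB1 FBM FC (inr a); apply=> //.
      by rewrite /=; exact: wlen_gen.
    exact: hc0B.
  have h1 : \prod_(a <- u) FB a = 1.
    have kf : kills SB (j %/ c) (fun a => push f (inB a)).
      apply: (push_kills kG) (hk _ (leqnn _)) => [w|]; last exact: hc0B.
      by rewrite inB_prod.
    rewrite big_seq (eq_bigr (fun a => push f (inB a))) => [|a ha]; last first.
      by apply: EB; exact: (allP hu).
    by rewrite -big_seq; exact: kf.
  have h2 w : \prod_(a <- w) FB a = pr (fp_letter (inr (\prod_(a <- w) hB a))).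
    elim: w => [|a w IH]; first by rewrite !big_nil fp_letter1r.
    by rewrite !big_cons IH fp_letter_inrM prM.
  have h3 : \prod_(a <- u) hB a = 1.
    by apply: (right_factor_embeds hC'); apply: pr_ker; rewrite -h2.
  have h4 w : (\prod_(a <- w) hB a).1 = \prod_(a <- w) extension hSB f1 a.
    by elim: w => [|a w IH]; rewrite ?big_nil // !big_cons /= IH.
  have := h4 u; rewrite h3 => e1; apply: etrans (esym e1).
  rewrite !big_seq; apply: eq_bigr => a ha.
  by rewrite (extension_gen _ k1 hn) //; exact: (allP hu).
Qed.
End Transfer.

(** For [k = c] the inequality [l <= l' * c] is the lower bound [l / k <= l'],
    and [k ^ 2 + 2 k + 2 <= l] gives [2 * c < l]. *)
Lemma spectra_equivalentP (c : nat) (H H' : set nat) : (0 < c)%N ->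
  (forall l, (2 * c < l)%N -> H l -> exists2 l', H' l' & (l <= l' * c /\ l' <= l * c)%N) ->
  (forall l, (2 * c < l)%N -> H' l -> exists2 l', H l' & (l <= l' * c /\ l' <= l * c)%N) ->
  spectra_equivalent H H'.
Proof.
move=> c0 h1 h2; have c0R : (0 < c%:R :> real)%R by rewrite ltr0n.
exists (c%:R)%R => // l; rewrite -natrX -natrM -!natrD ler_nat => hl.
have hl2 : (2 * c < l)%N.
  by apply: leq_trans hl; rewrite addn2 ltnS; apply: leqW; exact: leq_addl.
by split=> [/(h1 _ hl2)|/(h2 _ hl2)] [l' hl' [le1 le2]]; exists l' => //;
  rewrite ler_pdivrMr // -!natrM !ler_nat le1.
Qed.

(** Here [l.-1 %/ c < n] amounts to [l <= n * c].  The interval up to [l * c] is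
    thus free of taut lengths, and its lower end is at least 2. *)
Lemma taut_length_near (G : groupType) (S : seq G) (l c : nat) :
  (0 < c)%N -> (2 * c < l)%N ->
  ~ (exists2 n, group_spectrum S n & (l <= n * c /\ n <= l * c)%N) ->
  relations_extend S (l.-1 %/ c) (l * c).
Proof.
move=> c0 hl hn; apply: no_taut_relations_extend; first by rewrite leq_divRL //; lia.
move=> n /andP[h1 h2] hs; apply: hn; exists n => //; split=> //.
by move: h1; rewrite ltn_divLR //; lia.
Qed.

(** Since [c * (l.-1 %/ c) <= l.-1] and [l * c %/ c = l], a gap stretched by [c]
    at both ends still excludes [l]. *)
Lemma relations_extend_close (G : groupType) (S : seq G) (l c : nat) :
  (0 < c)%N -> (0 < l)%N ->
  relations_extend S (c * (l.-1 %/ c)) (l * c %/ c) -> ~ group_spectrum S l.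
Proof.
case: l => // l c0 _; rewrite mulnK //= => K; apply: relations_extend_no_taut.
move=> Q f hf; apply: K; apply: killsW hf; rewrite mulnC; exact: leq_trunc_div.
Qed.

Theorem theorem3 (A B : groupType) (rels : set (free_product A B))
    (hfin : fin_gen_symmetrized rels)
    (hsc : small_cancellation (1 / 6%:R)%R rels)
    (SA : seq A) (SB : seq B) (SG : seq (ncl_quotient rels))
    (hSA : generates SA) (hSB : generates SB) (hSG : generates SG) :
  spectra_equivalent (group_spectrum SG)
    (group_spectrum SA `|` group_spectrum SB)%classic.
Proof.
have [C [hC presC]] := presentation_words hfin hsc.
pose G := ncl_quotient rels.
pose pi (x : free_product A B) : G := (\pi_G x)%qT.
have piM x y : pi (x * y) = pi x * pi y by exact: ncl_pi_mul.
have pi_ker x : pi x = 1 <-> normal_closure (relator_set C) x.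
  split=> [e|/presC hx].
    by apply/presC; have /ncl_piP : pi 1 = pi x by []; rewrite invg1 mul1g.
  by symmetry; apply/ncl_piP; rewrite invg1 mul1g.
have pi_surj g : exists x, pi x = g by exists (repr g); rewrite /pi reprK.
pose m := \max_(r <- C) word_len (wlen hSA) (wlen hSB) r.
have hm r : r \in C -> (word_len (wlen hSA) (wlen hSB) r <= m)%N.
  by move=> hr; exact: leq_bigmax_seq.
have [cA hcA] := gen_bound SA (fun a => wlen hSG (inA pi a)).
have [cB hcB] := gen_bound SB (fun b => wlen hSG (inB pi b)).
have [c1 hc1] := gen_bound SG (fun g => cost hSA hSB m (lift_word pi_surj g)).
pose c0 := (cA + cB)%N.
have hc0A a : gen SA a -> (wlen hSG (inA pi a) <= c0)%N.
  by move=> ha; apply: leq_trans (hcA a ha) _; exact: leq_addr.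
have hc0B b : gen SB b -> (wlen hSG (inB pi b) <= c0)%N.
  by move=> hb; apply: leq_trans (hcB b hb) _; exact: leq_addl.
(* The sum satisfies the constraints of both transfer theorems. *)
pose c := (c0 + c0 * m + 2 * c1 + 4 * m + 4 * (1 + 2 * m + c1 * c0) + 4 * m + 2)%N.
have c_gt0 : (0 < c)%N by rewrite /c addn2.
have K2 l : (2 * c < l)%N -> (2 <= l.-1 %/ c)%N by move=> hl; rewrite leq_divRL //; lia.
apply: (spectra_equivalentP c_gt0) => l hl hs.
- apply: contrapT => hno.
  apply: (@relations_extend_close G SG l c c_gt0 _ _ hs); first by lia.
  apply: (relations_extend_quotient hC piM pi_ker hm hc0A hc0B hc1 (K2 l hl)).
  + by rewrite /c; clear; lia.
  + by rewrite /c; clear; lia.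
  + by rewrite /c; clear; lia.
  + by apply: taut_length_near => // -[n hn le]; apply: hno; exists n => //; left.
  + by apply: taut_length_near => // -[n hn le]; apply: hno; exists n => //; right.
- apply: contrapT => hno.
  have KG := @taut_length_near G SG l c c_gt0 hl hno.
  have hl0 : (0 < l)%N by lia.
  have [e1 e2 e3] : [/\ c0 <= c, 2 * c1 + 4 * m <= c & 4 * (1 + 2 * m + c1 * c0) + 4 * m <= c]%N.
    by rewrite /c; clear; split; lia.
  have ext := relations_extend_factors hC piM pi_ker hm hc0A hc0B hc1 (K2 l hl) e1 e2 e3 KG.
  have kills1 (H : groupType) (SH : seq H) (Q : groupType) n : kills SH n (fun=> 1 : Q).
    by move=> w _ _ _; rewrite big1.
  case: hs; apply: (relations_extend_close c_gt0 hl0) => Q f hf.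
    by have [] := ext Q Q f (fun=> 1) hf (kills1 _ _ _ _).
  by have [] := ext Q Q (fun=> 1) f (kills1 _ _ _ _) hf.
Qed.
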